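(* Let $N\ge3$ with $4\nmid N$. The crossing vector $\mathbf C_m^{(N)}(\beta)$ of the regular polygonal $N$-gasket satisfies a closed finite-dimensional polynomial recursion: there is a polynomial map $\mathcal R_N$, independent of $m$ and $\beta$, with $\mathbf C_{m+1}^{(N)}(\beta)=\mathcal R_N(\mathbf C_m^{(N)}(\beta))$ for all $m\ge0$, $\beta\ge0$. Define the crossing critical inverse temperature by $$\beta_{\mathrm c,N}^{\mathrm{cr}}:=\inf\Bigl\{\beta\ge0:\sup_{m\ge0}\|\mathbf C_m^{(N)}(\beta)\|_\infty<\infty\Bigr\}.$$ Then the connective constant $\mu_N$ of the one-sided graph $F_\infty^{(N)}$ satisfies $\mu_N=e^{\beta_{\mathrm c,N}^{\mathrm{cr}}}$. For $N\in\{6,9\}$, put $\tau=(\sqrt5-1)/2$ and $d_N=N/3$. Then $$\mu_N=\left(\frac{\sqrt{1+4\tau^{1/d_N}}-1}{2}\right)^{-1/d_N}.$$ In particular, $\mu_6$ and $\mu_9$ are algebraic numbers.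
   Context: **Polygonal $N$-gasket.** Let $N\ge3$, $4\nmid N$. Identify $\mathbb R^2$ with $\mathbb C$; $q_j=e^{2\pi\mathrm i j/N}$, $V_0^{(N)}=\{q_j:j\in\mathbb Z/N\mathbb Z\}$, and $F_0^{(N)}$ is the $N$-cycle on $V_0^{(N)}$ ($q_j$ adjacent to $q_{j\pm1}$). Put $k_N=\lfloor N/4\rfloor$, $\ell_N=N-4k_N$, $s_N=k_N+1$, $$\rho_N=\frac{\sin(\pi/N)}{\sin(\pi/N)+\sin((2s_N-1)\pi/N)},\qquad \Psi_j^{(N)}(x)=q_j+\rho_N(x-q_j).$$ The regular polygonal $N$-gasket is the attractor of $\{\Psi_j^{(N)}\}_{j\in\mathbb Z/N\mathbb Z}$. With root $O=q_0$ (fixed by $\Psi_0^{(N)}$), $F_m^{(N)}=\bigcup_{w\in(\mathbb Z/N\mathbb Z)^m}\bigl((\Psi_0^{(N)})^{-m}\circ\Psi^{(N)}_{w_1}\circ\cdots\circ\Psi^{(N)}_{w_m}\bigr)(F_0^{(N)})$ (union of image graphs) and $F_\infty^{(N)}=\bigcup_mF_m^{(N)}$. $\mu_N=\lim_{n\to\infty}c_n^{1/n}$ (the limit exists), where $c_n$ is the number of $n$-step self-avoiding walks in $F_\infty^{(N)}$ starting at $O$ (sequences of $n+1$ distinct vertices, consecutive ones adjacent). **Crossing vector.** Let $a_{j,m}=(\Psi_0^{(N)})^{-m}(q_j)$, $j\in\mathbb Z/N\mathbb Z$; these are the boundary vertices of $F_m^{(N)}$. A self-avoiding walk $w$ of length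 (number of edges) $L(w)$ has weight $e^{-\beta L(w)}$; a crossing is a self-avoiding walk in $F_m^{(N)}$ between two prescribed distinct boundary vertices, and partition functions are sums of weights. - If $N\notin\{3,5\}$: $X_m^{(N)}(\beta)$ is the partition function of crossings from $a_{0,m}$ to $a_{s_N,m}$, $Y_m^{(N)}(\beta)$ that of crossings from $a_{-s_N,m}$ to $a_{s_N,m}$, and $\mathbf C_m^{(N)}=(X_m^{(N)},Y_m^{(N)})$. - If $N=3$: $x_m(\beta)$, $y_m(\beta)$ are the partition functions of crossings between two fixed boundary vertices which respectively avoid and visit the third boundary vertex, and $\mathbf C_m^{(3)}=(x_m,y_m)$. - If $N=5$: $\phi_{1,m},\phi_{2,m}$ are the partition functions of crossings from $a_{0,m}$ to $a_{2,m}$ which respectively avoid and visit $a_{-2,m}$; $\theta_{1,m},\theta_{2,m}$ those of crossings from $a_{-2,m}$ to $a_{2,m}$ which respectively avoid and visit $a_{0,m}$; $\mathbf C_m^{(5)}=(\phi_{1,m},\phi_{2,m},\theta_{1,m},\theta_{2,m})$. The infimum defining $\beta_{\mathrm c,N}^{\mathrm{cr}}$ is understood in $[0,\infty]$. *)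

(* Defs.v *)
From mathcomp Require Import all_boot all_order all_algebra finmap.
From mathcomp Require Import all_classical all_reals all_analysis.
From mathcomp.real_closed Require Import complex.
(* Not imported: its notations clash with those of mathcomp-analysis. *)
From mathcomp.multinomials Require mpoly.

Set Implicit Arguments.
Unset Strict Implicit.
Unset Printing Implicit Defensive.

Import Order.TTheory GRing.Theory Num.Theory.
Import numFieldNormedType.Exports.

Local Open Scope classical_set_scope.
Local Open Scope ring_scope.
Local Open Scope complex_scope.

Section Graphs.
Variable T : Type.

Record graph := Graph { vert : set T ; adj : T -> T -> Prop }.

Definition image_graph (f : T -> T) (G : graph) : graph :=
  Graph (f @` vert G)
        (fun x y => exists u v, [/\ adj G u v, f u = x & f v = y]).

Definition union_graph (I : Type) (G : I -> graph) : graph :=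
  Graph (\bigcup_i vert (G i)) (fun x y => exists i, adj (G i) x y).

End Graphs.

(* The self-avoiding walk visiting a and then, in order, the entries of p;
   its length is size p. *)
Definition saw (T : eqType) (G : graph T) (a : T) (p : seq T) : Prop :=
  [/\ forall x, x \in a :: p -> vert G x,
      path (fun x y => `[< adj G x y >]) a p
    & uniq (a :: p)].

Section Gasket.
Variable (R : realType) (N : nat).

(* q_j is N-periodic in j, so an integer index stands for its class mod N. *)
Definition q (j : int) : R[i] :=
  let t := 2 * pi * j%:~R / N%:R in cos t +i* sin t.

Definition sN : nat := (N %/ 4)%N.+1.

Definition rho : R :=
  sin (pi / N%:R) /
    (sin (pi / N%:R) + sin ((2 * sN%:R - 1) * pi / N%:R)).

Definition Psi (j : int) (x : R[i]) : R[i] := q j + rho%:C * (x - q j).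

Definition Psi_inv (j : int) (x : R[i]) : R[i] := q j + (rho^-1)%:C * (x - q j).

Definition F0 : graph R[i] :=
  Graph (range q)
        (fun x y => exists j : int, x = q j /\ (y = q (j + 1) \/ y = q (j - 1))).

Definition Psi_word (w : seq 'I_N) : R[i] -> R[i] :=
  foldr (fun (j : 'I_N) f => Psi (j : nat)%:Z \o f) id w.

Definition F (m : nat) : graph R[i] :=
  union_graph (fun w : m.-tuple 'I_N =>
    image_graph (iter m (Psi_inv 0) \o Psi_word w) F0).

Definition Finf : graph R[i] := union_graph F.

(* Finf is locally finite, so this is a genuine (finite) cardinality. *)
Definition saw_count (n : nat) : nat :=
  #|` fset_set [set p | saw Finf (q 0) p /\ size p = n]|%fset.

Definition saw_root (n : nat) : R := (saw_count n)%:R `^ (n%:R^-1).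

Definition mu : R := limn saw_root.

Definition bdry (m : nat) (j : int) : R[i] := iter m (Psi_inv 0) (q j).

(* Sum over the crossings of F m from a to b whose vertex sequence satisfies V;
   there are finitely many of them since F m is a finite graph. *)
Definition Z (m : nat) (a b : R[i]) (V : seq R[i] -> Prop) (beta : R) : R :=
  \sum_(p \in [set p | [/\ saw (F m) a p, last a p = b & V (a :: p)]])
     expR (- beta * (size p)%:R).

(* For N = 3 the two prescribed boundary vertices are those of indices 0 and 1. *)
Definition crossing_seq (m : nat) (beta : R) : seq R :=
  let a := bdry m in
  let s := sN%:Z in
  if (N == 3)%N then
    [:: Z m (a 0) (a 1) (fun w => a (- 1) \notin w) beta;
        Z m (a 0) (a 1) (fun w => a (- 1) \in w) beta]
  else if (N == 5)%N then
    [:: Z m (a 0) (a 2) (fun w => a (- 2) \notin w) beta;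
        Z m (a 0) (a 2) (fun w => a (- 2) \in w) beta;
        Z m (a (- 2)) (a 2) (fun w => a 0 \notin w) beta;
        Z m (a (- 2)) (a 2) (fun w => a 0 \in w) beta]
  else
    [:: Z m (a 0) (a s) (fun=> True) beta;
        Z m (a (- s)) (a s) (fun=> True) beta].

Definition crossing_dim : nat := (if N == 5 then 4 else 2)%N.

Definition crossing (m : nat) (beta : R) : 'rV[R]_crossing_dim :=
  \row_i (crossing_seq m beta)`_i.

(* The norm on row vectors is the max norm. *)
Definition beta_cr : \bar R :=
  ereal_inf [set beta%:E | beta in
    [set beta : R | 0 <= beta /\
       (ereal_sup [set `|crossing m beta|%:E | m in [set: nat]] < +oo)%E]].

End Gasket.

Definition poly_map (R : realType) (d : nat)
    (P : 'I_d -> mpoly.mpoly d R) (v : 'rV[R]_d) : 'rV[R]_d :=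
  \row_i mpoly.meval (v 0) (P i).

(* Main.v *)
Require Import Defs.
From mathcomp Require Import all_boot all_order all_algebra finmap.
From mathcomp Require Import all_classical all_reals all_analysis.
From mathcomp.real_closed Require Import complex.
From mathcomp.multinomials Require mpoly.
From mathcomp Require Import zify ring lra.

(* Let s = s_N. The cells of level m + 1 form a ring in which consecutive cells share
   exactly one vertex, the images of the corners q_(+s) and q_(-s). A crossing of
   level m + 1 therefore runs along one of the two arcs of cells between its ends,
   crossing the first and the last cell from a corner q_i to q_(i +- s) and every
   intermediate cell from q_(i -+ s) to q_(i +- s). Weights multiply along the arc,
   whence the recursion; only when the arc uses all N cells do the end cells share a
   further vertex, which makes the avoid/visit refinement necessary for N = 3, 5.

   Lower bound. If the crossing weights are unbounded at beta, then X_m and Y_m are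
   both at least 1 for some m. Concatenating crossings of level m then produces at
   least kappa e^(beta n) self-avoiding walks of length n, uniformly in n.

   Upper bound. If they are bounded at beta_1 < beta, then X_m(beta) decays
   geometrically, because a crossing of level m has length greater than m. A walk of
   level m + 1 from the root follows one arc and ends inside a cell, so the weight
   W_m of all walks satisfies W_(m+1) <= W_m (1 + 2 X_m (1 + Y_m + ... + Y_m^(N-1)))
   and stays bounded; hence there are at most C e^(beta n) walks of length n.

   For N = 6, 9 one has N = 3 s, X_m = Y_m and X_(m+1) = X_m^(s+1) (1 + X_m^s), whose
   positive fixed point t satisfies t^s (1 + t^s) = 1, while X_0 = y + y^2 with
   y = e^(- s beta). *)

Set Implicit Arguments.
Unset Strict Implicit.
Unset Printing Implicit Defensive.

Import Order.TTheory GRing.Theory Num.Theory.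
Import numFieldNormedType.Exports.

Local Open Scope classical_set_scope.
Local Open Scope ring_scope.

(** * Weights and prefix counts of sets of words *)

(** Weights multiply only if a concatenation of pieces can be decoded and is self-avoiding by
    itself. Walks are therefore stored without their first vertex: a piece then meets its final
    junction once, at its end, and pieces in cells that do not close up around the ring meet only in
    junctions. The lower bound uses only arcs of fewer than N cells, and it counts prefixes of
    crossings, because a given n need not be the length of a crossing. The delicate point is that
    unbounded weights must bring X_m and Y_m to 1 at the same level. For N = 3 they coincide. For N
    other than 3, 5 one has Y_m <= X_m, and Y_(m+2) < 1 limits the growth of X after level m. For N
    = 5 at least half of the weight avoids the third corner, whence 3/4 X_m <= Y_m. The geometry
    reduces to projections on a line: rho_N makes neighbouring cells touch in their extreme points
    for the direction of a side of the polygon, and these are unique because 4 does not divide N. *)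

Section Words.
Context {T : choiceType} {R : realType}.
Implicit Types (A B : set (seq T)) (p q : seq T).

(** A walk is stored without its starting vertex, so the size of a word is its number of edges and
    walks are joined by concatenating words. *)
Definition catset A B : set (seq T) :=
  [set pq.1 ++ pq.2 | pq in A `*` B].

Lemma catsetP A B p :
  catset A B p <-> exists p1 p2, [/\ A p1, B p2 & p = p1 ++ p2].
Proof.
split=> [[[p1 p2] [/= Ap Bq] <-]|[p1 [p2 [Ap Bq ->]]]].
  by exists p1, p2.
by exists (p1, p2).
Qed.

Lemma catset_fin A B : finite_set A -> finite_set B -> finite_set (catset A B).
Proof. by move=> fA fB; apply: finite_image; apply: finite_setX. Qed.

Lemma catsetS A A' B B' : A `<=` A' -> B `<=` B' -> catset A B `<=` catset A' B'.
Proof.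
move=> AA BB p /catsetP[p1 [p2 [/AA h1 /BB h2 ->]]].
by apply/catsetP; exists p1, p2.
Qed.

Lemma catsetA A B C : catset A (catset B C) = catset (catset A B) C.
Proof.
apply/seteqP; split=> p /catsetP[p1 [p2 [h1 h2 ->]]].
  case/catsetP: h2 => p3 [p4 [h3 h4 ->]]; rewrite catA; apply/catsetP.
  by exists (p1 ++ p3), p4; split=> //; apply/catsetP; exists p1, p3.
case/catsetP: h1 => p3 [p4 [h3 h4 ->]]; rewrite -catA; apply/catsetP.
by exists p3, (p4 ++ p2); split=> //; apply/catsetP; exists p4, p2.
Qed.

(* Every word of A meets b exactly once, in last position; this makes a
   concatenation with words avoiding b uniquely decodable. *)
Definition ends_at A (b : T) := forall p, A p -> exists2 p', p = rcons p' b & b \notin p'.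
Definition avoids A (b : T) := forall p, A p -> b \notin p.

Lemma split_uniq (b : T) p p' q q' : b \notin p -> b \notin p' ->
  rcons p b ++ q = rcons p' b ++ q' -> p = p' /\ q = q'.
Proof.
rewrite !cat_rcons => bp bp' E.
have S : size p = size p'.
  have := congr1 (index b) E; rewrite !index_cat (negbTE bp) (negbTE bp') /=.
  by rewrite eqxx !addn0.
by move/eqP: E; rewrite eqseq_cat // => /andP[/eqP-> /eqP[->]].
Qed.

Lemma catset_inj A B b : ends_at A b -> 
  set_inj (A `*` B) (fun pq : seq T * seq T => pq.1 ++ pq.2).
Proof.
move=> eA [p q] [p' q']; rewrite !inE /= => -[/eA[r -> br] _] [/eA[r' -> br'] _].
by move/(split_uniq br br') => [-> ->].
Qed.

Definition wt (beta : R) A : R := \sum_(p \in A) expR (- beta * (size p)%:R).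

Variable beta : R.

Lemma wt_fset A : finite_set A ->
  wt beta A = \sum_(p <- fset_set A) expR (- beta * (size p)%:R).
Proof. exact: fsbig_finite. Qed.

Lemma wt_ge0 A : 0 <= wt beta A.
Proof. by apply: fsumr_ge0 => i _; apply: expR_ge0. Qed.

Lemma wt_set0 : wt beta set0 = 0.
Proof. exact: fsbig_set0. Qed.

Lemma wt_set1 p : wt beta [set p] = expR (- beta * (size p)%:R).
Proof. exact: fsbig_set1. Qed.

Lemma wtU A B : finite_set A -> finite_set B -> A `&` B `<=` set0 ->
  wt beta (A `|` B) = wt beta A + wt beta B.
Proof. by move=> fA fB AB; rewrite /wt fsbigU // => x /AB. Qed.

Lemma wt_split (P : set (seq T)) A : finite_set A ->
  wt beta A = wt beta (A `&` P) + wt beta (A `&` ~` P).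
Proof.
move=> fA; rewrite -wtU; first by rewrite -setIUr setUv setIT.
- exact: finite_setIl.
- exact: finite_setIl.
- by move=> x [[_ h] [_ h']].
Qed.

Lemma le_wt A B : finite_set B -> A `<=` B -> wt beta A <= wt beta B.
Proof.
move=> fB AB; rewrite (wt_split A fB) (_ : B `&` A = A) ?lerDl ?wt_ge0 //.
by apply/setIidPr.
Qed.

Lemma wtU_le A B : finite_set A -> finite_set B ->
  wt beta (A `|` B) <= wt beta A + wt beta B.
Proof.
move=> fA fB; have fU : finite_set (A `|` B) by rewrite finite_setU.
by rewrite (wt_split A fU) lerD //; apply: le_wt => // x; case=> -[].
Qed.

Lemma wt_le_sum A (B : nat -> set (seq T)) n : finite_set A ->
    (forall i, finite_set (B i)) -> (forall p, A p -> exists2 i, (i < n)%N & B i p) ->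
  wt beta A <= \sum_(i < n) wt beta (B i).
Proof.
elim: n A => [|n IH] A fA fB hA.
  by rewrite big_ord0 (_ : A = set0) ?wt_set0 // -subset0 => p /hA[].
have h1 : wt beta (A `&` B n) <= wt beta (B n) by apply: (le_wt (fB n)) => p [].
rewrite big_ord_recr /= (wt_split (B n) fA) addrC lerD //.
apply: IH => //; first exact: finite_setIl.
move=> p [/hA hp]; case: hp => i; rewrite ltnS leq_eqVlt => /orP[/eqP->//|ii] Bi _; by exists i.
Qed.

Lemma wt_map (f : T -> T) A : injective f -> wt beta (map f @` A) = wt beta A.
Proof.
move=> fi; rewrite /wt fsbig_image; last by move=> x y _ _; apply: inj_map.
by apply: eq_fsbigr => p _; rewrite size_map.
Qed.

Lemma wt_catX A B : finite_set A -> finite_set B ->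
  wt beta A * wt beta B =
  \sum_(pq \in A `*` B) expR (- beta * (size (pq.1 ++ pq.2))%:R).
Proof.
move=> fA fB; rewrite /wt mulr_fsuml.
under eq_fsbigr => p _ do rewrite mulr_fsumr.
rewrite pair_fsbig //; apply: eq_fsbigr => pq _.
by rewrite -expRD size_cat natrD mulrDr.
Qed.

Lemma wt_cat A B b : finite_set A -> finite_set B -> ends_at A b ->
  wt beta (catset A B) = wt beta A * wt beta B.
Proof.
move=> fA fB eA; rewrite wt_catX // /wt fsbig_image //; exact: catset_inj eA.
Qed.

End Words.

(** * Prefix counts and exponential branching *)

Section Counting.
Context {T : choiceType} {R : realType}.
Implicit Types (A B : set (seq T)) (p q : seq T).

(** At beta = 0 every word weighs 1, so counting inherits the lemmas on weights. *)
Definition cnt A : R := wt 0 A.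

Lemma cntE A : finite_set A -> cnt A = (#|` fset_set A|)%:R.
Proof.
move=> fA; rewrite /cnt wt_fset // -sum1_size natr_sum.
by apply: eq_bigr => p _; rewrite oppr0 mul0r expR0.
Qed.

Lemma cnt_image (f : seq T -> seq T) A : injective f -> cnt (f @` A) = cnt A.
Proof.
move=> fi; rewrite /cnt /wt fsbig_image; last by move=> x y _ _ /fi.
by apply: eq_fsbigr => p _; rewrite !oppr0 !mul0r.
Qed.

Lemma cnt_gt0 A : 0 < cnt A -> exists p, A p.
Proof.
move=> h; apply: contrapT => /forallNP h0; move: h.
by rewrite (_ : A = set0) ?/cnt ?wt_set0 ?ltxx // -subset0 => p /h0.
Qed.

Lemma cnt_ge1 A p : finite_set A -> A p -> 1 <= cnt A.
Proof.
move=> fA Ap.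
have <- : wt (0 : R) [set p] = 1 by rewrite wt_set1 oppr0 mul0r expR0.
by apply: le_wt => // x ->.
Qed.

Definition pref n B : set (seq T) := [set take n q | q in [set q | B q /\ (n <= size q)%N]].

Lemma pref_fin n B : finite_set B -> finite_set (pref n B).
Proof.
move=> fB; apply: finite_image; apply: sub_finite_set fB; by move=> q [].
Qed.

Lemma prefS n A B : A `<=` B -> pref n A `<=` pref n B.
Proof. by move=> AB _ [q [/AB Bq nq] <-]; exists q. Qed.

Lemma pref_cat A B n p r : A p -> (size p <= n)%N -> pref (n - size p) B r ->
  pref n (catset A B) (p ++ r).
Proof.
move=> Ap pn [q [Bq sq] <-]; exists (p ++ q); last first.
  by rewrite take_cat ltnNge pn.
split; last by rewrite size_cat; lia.
by apply/catsetP; exists p, q.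
Qed.

(** A word of [A] survives whole in a prefix of length n and can be read off it, since its only [b]
    marks its end. Different words of [A] thus give disjoint families of prefixes. *)
Lemma cnt_pref_cat A B b n : finite_set A -> finite_set B ->
    ends_at A b -> avoids B b -> (forall p, A p -> (size p <= n)%N) ->
  \sum_(p <- fset_set A) cnt (pref (n - size p) B) <= cnt (pref n (catset A B)).
Proof.
move=> fA fB eA aB sA.
(* The prefixes whose factor from [A] lies in [s]; disjointness is used one word at a time, by
   induction on [s]. *)
pose U (s : seq (seq T)) :=
  [set x | exists2 p, p \in s & exists2 r, pref (n - size p) B r & x = p ++ r].
have US s : {subset s <= A} -> U s `<=` pref n (catset A B).
  move=> sA' _ [p /sA' Ap [r Br ->]]; move: Ap; rewrite inE => Ap.
  by apply: pref_cat => //; exact: sA.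
have fU s : {subset s <= A} -> finite_set (U s).
  by move=> /US h; apply: sub_finite_set h _; apply/pref_fin/catset_fin.
suff H s : uniq s -> {subset s <= A} ->
    \sum_(p <- s) cnt (pref (n - size p) B) <= cnt (U s).
  apply: (le_trans (H _ (fset_uniq _) _)); last apply: le_wt.
  - by move=> p; rewrite in_fset_set.
  - by apply/pref_fin/catset_fin.
  - by apply: US => p; rewrite in_fset_set.
elim: s => [|p s IH] /=; first by move=> _ _; rewrite big_nil wt_ge0.
move=> /andP[ps us] sA'; rewrite big_cons.
have sA1 : {subset s <= A} by move=> x xs; apply: sA'; rewrite inE xs orbT.
have pA : A p by have := sA' p; rewrite mem_head inE; apply.
have i1 : injective (cat p) by move=> x y /eqP; rewrite eqseq_cat // eqxx => /eqP.
rewrite -(cnt_image _ i1) (le_trans (lerD (lexx _) (IH us sA1))) //.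
rewrite /cnt -wtU.
- apply: le_wt; first exact: fU.
  move=> x [[r Br <-]|[p' ps' h]]; first by exists p; rewrite ?mem_head //; exists r.
  by exists p' => //; rewrite inE ps' orbT.
- by apply/finite_image/pref_fin.
- exact: fU.
- move=> _ [[r [q [Bq _] <-] <-] [p' ps' [_ [q' [Bq' _] <-]]]] E.
  move: (sA1 _ ps'); rewrite inE => pA'.
  have [r1 e1 n1] := eA _ pA; have [r2 e2 n2] := eA _ pA'.
  move: E; rewrite e1 e2 => /(split_uniq n1 n2) [r12 _].
  by move: ps'; rewrite e2 -r12 -e1 (negbTE ps).
Qed.

(* Appending words from A to the left of an exponentially branching family
   keeps it exponentially branching, l steps further. *)
Definition expands (kappa beta : R) A (S : set T) (l : nat) :=
  forall n0 B, finite_set B -> (forall q, B q -> forall x, x \in q -> ~ S x) ->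
    (forall n, (n <= n0)%N -> kappa * expR (beta * n%:R) <= cnt (pref n B)) ->
  forall n, (n <= n0 + l)%N -> kappa * expR (beta * n%:R) <= cnt (pref n (catset A B)).

(* A word of A of length l <= M leaves n - l steps to be made and
   e^(beta (n - l)) = e^(- beta l) e^(beta n), so 1 <= wt A gives e^(beta n) back; M only
   enters in lengths n <= M, where one prefix is enough. *)
Lemma expands_base (beta : R) A (S : set T) b M : 0 <= beta ->
    finite_set A -> ends_at A b -> S b -> 1 <= wt beta A ->
    (forall p, A p -> (size p <= M)%N) ->
  expands (expR (- beta * M%:R)) beta A S 1.
Proof.
move=> b0 fA eA Sb wA sA n0 B fB aB hB n nn0.
have aB' : avoids B b by move=> q /aB h; apply/negP => /h.
have [/= nM|Mn] := leqP n M; last first.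
  have le : forall p, A p -> (size p <= n)%N.
    by move=> p /sA h; apply: leq_trans h (ltnW Mn).
  apply: le_trans (cnt_pref_cat fA fB eA aB' le).
  apply: (@le_trans _ _ (\sum_(p <- fset_set A)
      expR (- beta * M%:R) * expR (beta * (n - size p)%:R))); last first.
    rewrite big_seq [leRHS]big_seq; apply: ler_sum => p.
    rewrite in_fset_set // inE => Ap; apply: hB.
    by have [r -> _] := eA _ Ap; rewrite size_rcons; lia.
  rewrite -big_distrr /= ler_pM2l ?expR_gt0 //.
  rewrite -[leLHS]mulr1 (le_trans (ler_wpM2l _ wA)) ?expR_ge0 // wt_fset //.
  rewrite big_distrr /= big_seq [leRHS]big_seq; apply: ler_sum => p.
  rewrite in_fset_set // inE => /le pn.
  by rewrite -expRD ler_expR natrB // mulrBr mulNr.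
have : 0 < cnt (pref n0 B).
  by apply: lt_le_trans (hB _ (leqnn _)); rewrite mulr_gt0 ?expR_gt0.
move/cnt_gt0 => [_ [q [Bq sq] _]].
have [p Ap] : exists p, A p.
  apply: contrapT => /forallNP h0; move: wA.
  by rewrite (_ : A = set0) ?wt_set0 ?ler10 // -subset0 => p /h0.
apply: (@le_trans _ _ 1); last first.
  apply: (@cnt_ge1 _ (take n (p ++ q))); first by apply/pref_fin/catset_fin.
  exists (p ++ q) => //; split; first by apply/catsetP; exists p, q.
  by rewrite size_cat; have [r -> _] := eA _ Ap; rewrite size_rcons; lia.
by rewrite -expRD -[leRHS]expR0 ler_expR mulNr addrC subr_le0 ler_wpM2l // ler_nat.
Qed.

Lemma expands_cat k beta A A' (S S' : set T) l l' :
    expands k beta A S l -> expands k beta A' S' l' -> finite_set A' ->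
    (forall q, A' q -> forall x, x \in q -> ~ S x) ->
  expands k beta (catset A A') (S `|` S') (l' + l).
Proof.
move=> eA eA' fA' aA' n0 B fB aB hB n; rewrite addnA -catsetA.
apply: eA; first exact: catset_fin.
  move=> _ /catsetP[p [q [/aA' hp /aB hq ->]]] x.
  by rewrite mem_cat => /orP[/hp|/hq h] // Sx; apply: h; left.
move=> m; apply: eA' => // q /aB h x /h Hx S'x; apply: Hx; by right.
Qed.

Lemma expands_sub k beta A A' (S S' : set T) l l' :
  expands k beta A S l -> A `<=` A' -> finite_set A' -> S `<=` S' -> (l' <= l)%N ->
  expands k beta A' S' l'.
Proof.
move=> eA AA' fA' SS' ll' n0 B fB aB hB n nl.
apply: le_trans (eA n0 B fB _ hB n _) _.
- by move=> q /aB h x /h Hx /SS'.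
- by apply: leq_trans nl _; rewrite leq_add2l.
- apply: le_wt; first exact/pref_fin/catset_fin.
  exact/prefS/catsetS.
Qed.

(** The arbitrary family [B] outside the image has to be pulled back too, which is why [f] is a
    bijection of the whole type. *)
Lemma expands_map k beta (f g : T -> T) A (S : set T) l : cancel f g -> cancel g f ->
  expands k beta A S l -> expands k beta (map f @` A) (f @` S) l.
Proof.
move=> fK gK eA n0 B fB aB hB n nl.
have prefM h m C : pref m (map h @` C) = map h @` pref m C.
  apply/seteqP; split=> [_ [_ [[q Cq <-] mq] <-]|_ [_ [q [Cq mq] <-] <-]].
    exists (take m q); last by rewrite map_take.
    by exists q => //; split=> //; move: mq; rewrite size_map.
  exists (map h q); last by rewrite map_take.
  by split; [exists q|rewrite size_map].
have -> : catset (map f @` A) B = map f @` catset A (map g @` B).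
  apply/seteqP; split=> [_ /catsetP[_ [q [[p Ap <-] Bq ->]]]|].
    exists (p ++ map g q); first by apply/catsetP; exists p, (map g q); split=> //; exists q.
    by rewrite map_cat (mapK gK).
  move=> _ [_ /catsetP[p [_ [Ap [q Bq <-] ->]]] <-].
  by rewrite map_cat (mapK gK); apply/catsetP; exists (map f p), q; split=> //; exists p.
rewrite prefM cnt_image; last exact/inj_map/(can_inj fK).
apply: (eA n0) => //; first exact: finite_image.
  move=> _ [q /aB h <-] _ /mapP[x /h Hx ->] Sx; apply: Hx; exists (g x) => //.
move=> m /hB; rewrite prefM cnt_image //; exact/inj_map/(can_inj gK).
Qed.

End Counting.

Section FiniteWords.
Context {T : choiceType}.

Lemma finite_uniq_seqs (V : set T) : finite_set V ->
  finite_set [set p : seq T | uniq p /\ forall x, x \in p -> V x].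
Proof.
move=> fV.
have H n : finite_set [set p : seq T | size p = n /\ forall x, x \in p -> V x].
  elim: n => [|n IH].
    by apply: sub_finite_set (finite_set1 [::]) => -[|x p] [] // _ /=.
  apply: sub_finite_set (finite_image2 cons fV IH) => -[|x p] [] //= [sp] h.
  exists x; first by apply: h; rewrite mem_head.
  by exists p => //; split=> // y yp; apply: h; rewrite inE yp orbT.
have {}H n : finite_set [set p : seq T | (size p <= n)%N /\ forall x, x \in p -> V x].
  elim: n => [|n IH].
    by apply: sub_finite_set (H 0%N) => p [] /=; case: p.
  have := H n.+1; move=> {}H.
  have : finite_set ([set p : seq T | (size p <= n)%N /\ forall x, x \in p -> V x] `|`
      [set p : seq T | size p = n.+1 /\ forall x, x \in p -> V x]) by rewrite finite_setU.
  apply: sub_finite_set => p [/=]; rewrite leq_eqVlt => /orP[/eqP|] h h'; [by right|by left].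
apply: sub_finite_set (H #|` fset_set V|) => p [up pV]; split=> //.
apply: uniq_leq_size => // x /pV Vx; by rewrite in_fset_set // inE.
Qed.

End FiniteWords.

(** * Self-avoiding walks in a ring of cells *)

Section Chains.
Context {T : choiceType}.
Implicit Types (P : nat -> set (seq T)) (B : set (seq T)).

Definition avoid (x : T) : set (seq T) := [set p : seq T | x \notin p].

(** The last factor [B] is left open: crossings of the last cell give crossings of the ring, walks
    in it give walks that stop inside a cell. *)
Fixpoint chain P (i n : nat) B : set (seq T) :=
  if n is n'.+1 then catset (P i) (chain P i.+1 n' B) else B.

Definition cat_stable (Q : set (seq T)) :=
  forall A B : set (seq T), catset A B `&` Q = catset (A `&` Q) (B `&` Q).

Lemma avoid_stable x : cat_stable (avoid x).
Proof.
move=> A B; apply/seteqP; split=> p.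
  case=> /catsetP[p1 [p2 [h1 h2 ->]]]; rewrite /avoid /= mem_cat negb_or => /andP[? ?].
  by apply/catsetP; exists p1, p2.
case/catsetP=> [p1 [p2 [[h1 n1] [h2 n2] ->]]]; split; first by apply/catsetP; exists p1, p2.
by rewrite /avoid /= mem_cat negb_or n1.
Qed.

Lemma setT_stable : cat_stable setT.
Proof. by move=> A B; rewrite !setIT. Qed.

Lemma chain_filter Q P i n B : cat_stable Q ->
  chain P i n B `&` Q = chain (fun j => P j `&` Q) i n (B `&` Q).
Proof. by move=> hQ; elim: n i => //= n IH i; rewrite hQ IH. Qed.

Lemma chainS P P' i n B B' : (forall j, P j `<=` P' j) -> B `<=` B' ->
  chain P i n B `<=` chain P' i n B'.
Proof. by move=> PP BB; elim: n i => //= n IH i; apply: catsetS. Qed.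

Lemma chain_fin P i n B : (forall j, finite_set (P j)) -> finite_set B ->
  finite_set (chain P i n B).
Proof. by move=> fP fB; elim: n i => //= n IH i; apply: catset_fin. Qed.

Lemma wt_chain (R : realType) (beta : R) P i n B (c : nat -> T) :
    (forall j, finite_set (P j)) -> finite_set B ->
    (forall j, ends_at (P j) (c j)) ->
  wt beta (chain P i n B) = \prod_(i <= j < i + n) wt beta (P j) * wt beta B.
Proof.
move=> fP fB eP; elim: n i => /= [|n IH] i; first by rewrite addn0 big_geq // mul1r.
rewrite (wt_cat beta _ _ (eP i)) ?IH //; last exact: chain_fin.
by rewrite [in RHS]big_ltn ?addnS ?ltnS ?leq_addr // mulrA.
Qed.

Definition crossings (e : rel T) a b : set (seq T) :=
  [set p | [/\ path e a p, uniq (a :: p) & last a p = b]].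
Definition walks (e : rel T) a : set (seq T) :=
  [set p | path e a p /\ uniq (a :: p)].

Lemma crossings_ends (e : rel T) a b : a <> b -> ends_at (crossings e a b) b.
Proof.
move=> ab p [_ up lp]; case: (lastP p) up lp => // p' x.
rewrite last_rcons -rcons_cons rcons_uniq inE negb_or => /andP[/andP[_ h] _] <-.
by exists p'.
Qed.

Lemma crossings_fin (e : rel T) a b (V : set T) : finite_set V ->
  (forall x y, e x y -> V y) -> finite_set (crossings e a b).
Proof.
move=> fV eV; apply: sub_finite_set (finite_uniq_seqs fV) => p [+ + _].
move=> pp /= /andP[_ ->]; split=> // x; elim: p a pp => // y p IH a /= /andP[/eV Vy pp].
by rewrite inE => /orP[/eqP->|/(IH _ pp)].
Qed.

Lemma walks_fin (e : rel T) a (V : set T) : finite_set V ->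
  (forall x y, e x y -> V y) -> finite_set (walks e a).
Proof.
move=> fV eV; apply: sub_finite_set (finite_uniq_seqs fV) => p [].
move=> pp /= /andP[_ ->]; split=> // x; elim: p a pp => // y p IH a /= /andP[/eV Vy pp].
by rewrite inE => /orP[/eqP->|/(IH _ pp)].
Qed.

End Chains.

(* D i and e i are the vertices and edges of the i-th cell, v i is the vertex shared
   by the cells i and i + 1; all indices are read modulo N. *)
Record cell_ring (T : choiceType) (E : rel T) (N : nat) (D : nat -> set T)
    (e : nat -> rel T) (v : nat -> T) : Prop := CellRing {
  cr_N : (2 < N)%N;
  cr_E : forall x y, E x y <-> exists i, e i x y;
  cr_D : forall i x y, e i x y -> D i x /\ D i y;
  cr_per : forall i j, i = j %[mod N] -> [/\ D i = D j, e i = e j & v i = v j];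
  cr_v : forall i, D i (v i) /\ D i.+1 (v i);
  cr_int : forall i j x, D i x -> D j x ->
    [\/ i = j %[mod N], j = i.+1 %[mod N] /\ x = v i | i = j.+1 %[mod N] /\ x = v j];
  cr_neq : forall i, v i <> v i.+1 }.

Lemma modn_eq_small N i j : i = j %[mod N] -> (i <= j)%N -> (j < i + N)%N -> i = j.
Proof.
move=> E ij jN; have : (j == i %[mod N])%N by apply/eqP.
rewrite eqn_mod_dvd // => /dvdnP[[|k]]; first by lia.
by rewrite mulSn; have := leq_addr (k * N) N; lia.
Qed.

Section Ring.
Context {T : choiceType} {E : rel T} {N : nat} {D : nat -> set T}
    {e : nat -> rel T} {v : nat -> T}.
Hypothesis H : cell_ring E N D e v.

(** The index is that of the entry vertex: [cross i] traverses the cell i + 1. *)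
Definition cross i := crossings (e i.+1) (v i) (v i.+1).

Lemma cross_ends i : ends_at (cross i) (v i.+1).
Proof. exact/crossings_ends/(cr_neq H). Qed.

Lemma path_D i a p x : D i a -> path (e i) a p -> x \in a :: p -> D i x.
Proof.
elim: p a => [|y p IH] a Da /=; first by move=> _; rewrite inE => /eqP->.
move=> /andP[/(cr_D H)[_ Dy] pp]; rewrite inE => /orP[/eqP->//|]; exact: IH.
Qed.

Lemma sub_path_E i a p : path (e i) a p -> path E a p.
Proof. by apply: sub_path => x y h; apply/(cr_E H); exists i. Qed.

Lemma adjacent_D i x : D i x -> D i.+1 x -> x = v i.
Proof.
move=> h1 h2; have N2 := cr_N H; case: (cr_int H h1 h2) => -[].
- by move=> h; have := modn_eq_small h; lia.
- by [].
- by move=> h; have := modn_eq_small h; lia.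
Qed.

(** The first edge outside the cell i starts at a vertex of two cells, hence at the junction with
    the next or the preceding cell. *)
Lemma exit_cell i a p : D i a -> path E a p ->
  path (e i) a p \/
  exists p1 y p2, [/\ p = p1 ++ y :: p2, path (e i) a p1 &
    exists2 j, e j (last a p1) y &
      (j = i.+1 %[mod N] /\ last a p1 = v i) \/ (i = j.+1 %[mod N] /\ last a p1 = v j)].
Proof.
elim: p a => [|y p IH] a Da /=; first by left.
move=> /andP[/(cr_E H)[j ej] pp]; have [eij|neij] := boolP (e i a y).
  have [_ Dy] := cr_D H eij; have [h|[p1 [z [p2 [-> pp1 h]]]]] := IH _ Dy pp.
    by left; rewrite h.
  by right; exists (y :: p1), z, p2; split=> //=; rewrite eij.
right; exists [::], y, p; split=> //=; exists j => //.
case: (cr_int H Da (cr_D H ej).1) => [/(cr_per H)[_ eE _]|h|h]; [|by left|by right].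
by move: neij; rewrite eE ej.
Qed.

(** A walk that has entered the cell i + 1 through [v i] cannot leave it there again: it stops in
    that cell or goes on through [v i.+1]. Induction on its length. *)
Lemma forward i y p : uniq [:: v i, y & p] -> path E (v i) (y :: p) -> e i.+1 (v i) y ->
  exists n, chain cross i n (crossings (e (i + n).+1) (v (i + n)) (last y p)) (y :: p).
Proof.
have [m] := ubnP (size p); elim: m i y p => // m IH i y p sp up pp ey.
have [_ Dv] := cr_v H i.
have [h|[p1 [z [p2 [Ep pp1 [j ej hj]]]]]] := exit_cell Dv pp.
  by exists 0%N; rewrite /= !addn0; split.
(* Otherwise the walk leaves the cell at [v i]: either [v i] = [v i.+1], or [y] lies in both cells i
   and i + 1 and equals [v i]. *)
have p1n : p1 <> [::].
  move=> p10; move: Ep ej hj; rewrite p10 /= => -[zy pp2]; rewrite -zy => ej.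
  case=> [[_ /(cr_neq H)] //|[hj _]].
  have /(cr_per H)[DE _ _] : i = j %[mod N].
    by apply/eqP; have /eqP := hj; rewrite -(addn1 i) -(addn1 j) eqn_modDr.
  have Dy : y = v i.
    by apply: adjacent_D; [have [] := cr_D H ej; rewrite DE|have [] := cr_D H ey].
  by move: up; rewrite /= inE Dy eqxx.
have lp1 : last (v i) p1 \in p1.
  by case: p1 p1n {Ep pp1 ej hj} => // x p1 _ /=; exact: mem_last.
move: hj => [[hj l1]|[hj l1]]; last first.
  have /(cr_per H)[_ _ vE] : i = j %[mod N].
    by apply/eqP; have /eqP := hj; rewrite -(addn1 i) -(addn1 j) eqn_modDr.
  by move: up lp1; rewrite l1 -vE Ep /= => /andP[+ _] h; rewrite mem_cat h.
have [_ eE _] := cr_per H hj.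
have Ep' : v i :: y :: p = (v i :: p1) ++ z :: p2 by rewrite Ep.
move: up; rewrite Ep' cat_uniq => /and3P[u1 u12 u2].
have S : size p = (size p1 + size p2)%N.
  by have /(congr1 size) := Ep; rewrite /= size_cat /= addnS => -[].
have s1 : (0 < size p1)%N by case: (p1) p1n.
have [] := IH i.+1 z p2.
- by lia.
- rewrite cons_uniq u2 andbT -l1; apply/negP => h; move: u12 => /negP; apply.
  by apply/hasP; exists (last (v i) p1) => //=; rewrite inE lp1 orbT.
- by move: pp; rewrite Ep cat_path l1 => /andP[].
- by rewrite -eE -l1.
move=> n hn; exists n.+1; rewrite Ep /=; apply/catsetP; exists p1, (z :: p2).
have -> : last y p = last z p2 by have := congr1 (last y) Ep; rewrite last_cat.
by split=> //; rewrite addnS -addSn.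
Qed.

Lemma chain_mem i n B p k : chain cross i n B p -> (0 < k <= n)%N -> v (i + k) \in p.
Proof.
elim: n i k p => [|n IH] i k p; first by lia.
move=> /catsetP[p1 [p2 [c1 c2 ->]]]; rewrite mem_cat.
have [p' -> _] := cross_ends c1.
case: k => // -[|k] kn; first by rewrite addn1 mem_rcons mem_head.
by rewrite addnS -addSn (IH _ k.+1 _ c2) ?orbT.
Qed.

(** After N cells the chain would pass [v i] again. *)
Lemma chain_size_lt i n B p : chain cross i n B p -> uniq (v i :: p) -> (n < N)%N.
Proof.
move=> c /= /andP[/negP vp _]; rewrite ltnNge; apply/negP => Nn; apply: vp.
have [_ _ ->] := @cr_per _ _ _ _ _ _ H i (i + N) (esym (modnDr _ _)).
by apply: chain_mem c _; have := cr_N H; lia.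
Qed.

Lemma chain_D i n b p x : chain cross i n (crossings (e (i + n).+1) (v (i + n)) b) p ->
  x \in p -> exists2 k, (k <= n)%N & D (i + k).+1 x.
Proof.
elim: n i p => [|n IH] i p.
  rewrite /= addn0 => -[pp _ _] xp; exists 0%N => //; rewrite addn0.
  by apply: path_D pp _; [have [] := cr_v H i|rewrite inE xp orbT].
move=> /catsetP[p1 [p2 [[pp1 _ _] c2 ->]]]; rewrite mem_cat => /orP[xp|xp].
  exists 0%N => //; rewrite addn0.
  by apply: path_D pp1 _; [have [] := cr_v H i|rewrite inE xp orbT].
move: c2; rewrite -(addSnnS i n) => c2.
by have [k kn Dk] := IH _ _ c2 xp; exists k.+1 => //; rewrite addnS -addSn.
Qed.

Lemma chain_path i n b p : chain cross i n (crossings (e (i + n).+1) (v (i + n)) b) p ->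
  path E (v i) p /\ last (v i) p = b.
Proof.
elim: n i p => [|n IH] i p.
  by rewrite /= addn0 => -[/sub_path_E].
move=> /catsetP[p1 [p2 [[/sub_path_E pp1 _ l1] c2 ->]]].
move: c2; rewrite -(addSnnS i n) => /IH[pp2 l2].
by rewrite cat_path last_cat l1 pp1.
Qed.

Lemma chain_last i n b p : chain cross i n (crossings (e (i + n).+1) (v (i + n)) b) p ->
  D (i + n).+1 b.
Proof.
elim: n i p => [|n IH] i p.
  rewrite /= addn0 => -[pp _ <-]; apply: path_D pp (mem_last _ _).
  by case: (cr_v H i).
by move=> /catsetP[p1 [p2 [_ c2 _]]]; move: c2; rewrite -(addSnnS i n) => /IH.
Qed.

(** The chain occupies n + 1 < N consecutive cells, which do not close up. Its first cell meets the
    later ones only in [v i.+1], where the remaining chain starts and which it does not revisit. *)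
Lemma chain_uniq i n b p : (n.+1 < N)%N ->
  chain cross i n (crossings (e (i + n).+1) (v (i + n)) b) p -> uniq (v i :: p).
Proof.
elim: n i p => [|n IH] i p nN; first by rewrite /= addn0 => -[].
move=> /catsetP[p1 [p2 [[pp1 u1 l1] c2 ->]]].
move: c2; rewrite -(addSnnS i n) => c2.
have := IH _ _ (ltnW nN) c2; rewrite -cat_cons cat_uniq u1 /= => /andP[v2 ->].
rewrite andbT; apply/hasPn => x x2; apply/negP => x1.
have D1 : D i.+1 x by apply: path_D pp1 x1; have [] := cr_v H i.
have [k kn D2] := chain_D c2 x2.
case: (cr_int H D1 D2) => [h|[_ xv]|[h _]].
- by have := modn_eq_small h; lia.
- by move: v2; rewrite -xv x2.
- by have := modn_eq_small h; lia.
Qed.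

(** For k > 0, an arc through the cells 0 to k; [k.-1] counts the cells strictly between the end
    cells. Self-avoidance is imposed separately. *)
Definition around a b k : set (seq T) :=
  catset (crossings (e 0%N) a (v 0%N))
    (chain cross 0 k.-1 (crossings (e k) (v k.-1) b)).

Lemma around_path a b k p : (0 < k)%N -> around a b k p ->
  path E a p /\ last a p = b.
Proof.
case: k => // k _ /catsetP[p1 [p2 [[pp1 _ l1] c2 ->]]].
by have [pp2 l2] := chain_path c2; rewrite cat_path last_cat l1 (sub_path_E pp1).
Qed.

(* The first and the last cell of a chain running round the whole ring share
   one more vertex; this is the only possible self-intersection. *)
Lemma around_uniq a b k p0 p : (0 < k < N)%N -> D 0 a -> 
    crossings (e 0%N) a (v 0%N) p0 ->
    chain cross 0 k.-1 (crossings (e k) (v k.-1) b) p ->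
  (k.+1 = N -> v k \in a :: p0 -> v k \notin p) -> uniq (a :: p0 ++ p).
Proof.
case: k => // k /= kN Da [pp0 u0 l0] c hk.
have := chain_uniq kN c; rewrite /= => /andP[v2 up].
rewrite -[_ && _]/(uniq ((a :: p0) ++ p)) cat_uniq u0 up andbT /=.
apply/hasPn => x xp; apply/negP => x0.
have D0 : D 0 x by apply: path_D x0.
have [j jk Dj] := chain_D c xp.
have [h|[_ xv]|[h xv]] := cr_int H D0 Dj.
- by have := modn_eq_small h; lia.
- by move: v2; rewrite -xv xp.
- have [jE kE] : j = k /\ k.+2 = N.
    have [/(modn_eq_small h)|] := ltnP j.+2 N; first by lia.
    by lia.
  by move: xv; rewrite jE add0n => xv; have := hk kE; rewrite -xv x0 xp => /(_ isT).
Qed.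

Lemma around_lt_uniq a b k p : (0 < k)%N -> (k.+1 < N)%N -> D 0 a ->
  around a b k p -> uniq (a :: p).
Proof.
move=> k0 kN Da /catsetP[p1 [p2 [c1 c2 ->]]].
by apply: (around_uniq _ _ c1 c2) => //; lia.
Qed.


Lemma crossings_avoid i a b x : D i a -> ~ D i x -> x <> a ->
  crossings (e i) a b `&` avoid x = crossings (e i) a b.
Proof.
move=> Da nD xa; apply/setIidPl => p [pp _ _]; apply/negP => xp; apply: nD.
by apply: path_D pp _; rewrite // inE xp orbT.
Qed.

Lemma cross_avoid i x : ~ D i.+1 x -> cross i `&` avoid x = cross i.
Proof.
move=> nD; apply: crossings_avoid => //; first by case: (cr_v H i).
by move=> xv; apply: nD; rewrite xv; case: (cr_v H i).
Qed.

(** The cells 0 and k = N - 1 also share [v k], which the first and the last piece may not both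
    visit; the union distinguishes whether the first one does. *)
Lemma around_full a b k : (0 < k)%N -> k.+1 = N -> D 0 a ->
    (forall j, D j a -> j = 0 %[mod N]) ->
  let c0 := crossings (e 0%N) a (v 0%N) in
  let c1 := chain cross 0 k.-1 (crossings (e k) (v k.-1) b) in
  around a b k `&` [set p | uniq (a :: p)] =
    catset (c0 `&` avoid (v k)) c1 `|` catset (c0 `&` ~` avoid (v k)) (c1 `&` avoid (v k)).
Proof.
move=> k0 kN D0 Da c0 c1; have kN' : (0 < k < N)%N by lia.
have av : a <> v k.
  move=> av; have [Dv _] := cr_v H k; move: Dv; rewrite -av => /Da h.
  by have := modn_eq_small (esym h); lia.
apply/seteqP; split=> p.
  move=> [/catsetP[p1 [p2 [h1 h2 ->]]]] /= /andP[_]; rewrite cat_uniq => /and3P[_ /hasPn h _].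
  have [v1|v1] := boolP (v k \in p1); last by left; apply/catsetP; exists p1, p2.
  right; apply/catsetP; exists p1, p2; split=> //; first by split=> //; rewrite /avoid /= v1.
  by split=> //; rewrite /avoid /=; apply/negP => /h; rewrite v1.
move=> [|] /catsetP[p1 [p2 [[h1 n1] h2 ->]]].
  split; first by apply/catsetP; exists p1, p2.
  apply: (around_uniq kN' D0 h1 h2) => _; rewrite inE => /orP[/eqP/esym//|h].
  by move: n1; rewrite /avoid /= h.
case: h2 => h2 n2; split; first by apply/catsetP; exists p1, p2.
by apply: (around_uniq kN' D0 h1 h2).
Qed.

(** Even together with the cell i the chain leaves some cell of the ring free, so it could return to
    the cell i only through [v i]. *)
Lemma chain_avoids_cell i n b q x : (n.+2 < N)%N ->
  chain cross i n (crossings (e (i + n).+1) (v (i + n)) b) q -> x \in q -> ~ D i x.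
Proof.
move=> nN c xq Dx; have [k kn Dk] := chain_D c xq.
have := chain_uniq (ltnW nN) c; rewrite /= => /andP[/negP vq _].
case: (cr_int H Dx Dk) => [h|[_ xv]|[h _]].
- by have := modn_eq_small h; lia.
- by apply: vq; rewrite -xv.
- by have := modn_eq_small h; lia.
Qed.

Lemma expands_chain (R : realType) (kappa beta : R) i n b l : (n.+1 < N)%N ->
    (forall j x y, finite_set (crossings (e j) x y)) ->
    (forall j, expands kappa beta (cross j) (D j.+1) l) ->
    expands kappa beta (crossings (e (i + n).+1) (v (i + n)) b) (D (i + n).+1) l ->
  expands kappa beta (chain cross i n (crossings (e (i + n).+1) (v (i + n)) b))
    [set x | exists2 k, (k <= n)%N & D (i + k).+1 x] l.
Proof.
move=> + fin hc; elim: n i => [|n IH] i nN hl.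
  apply: (expands_sub hl) => //; first by rewrite /= addn0; exact: fin.
  by move=> x; rewrite addn0 => Dx; exists 0%N; rewrite ?addn0.
have fch : finite_set (chain cross i.+1 n
    (crossings (e (i.+1 + n).+1) (v (i.+1 + n)) b)).
  by apply: chain_fin => // j; exact: fin.
move: hl; rewrite -(addSnnS i n) => hl.
have h := expands_cat (hc i) (IH i.+1 (ltnW nN) hl) fch
  (fun q cq x xq => @chain_avoids_cell i.+1 n b q x nN cq xq).
apply: (expands_sub h) => //; last exact: leq_addl.
  by apply: catset_fin => //; exact: fin.
move=> x [Dx|[k kn Dx]]; first by exists 0%N; rewrite ?addn0.
by exists k.+1 => //; rewrite addnS -addSn.
Qed.

(** The first cell and the rest of the arc gain l each. Doubling suffices to reach any length at a
    high level, so the gains of further cells are discarded. *)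
Lemma expands_around (R : realType) (kappa beta : R) a b k l : (0 < k)%N -> (k.+1 < N)%N ->
    D 0 a -> (forall j x y, finite_set (crossings (e j) x y)) ->
    (forall j, expands kappa beta (cross j) (D j.+1) l) ->
    expands kappa beta (crossings (e 0%N) a (v 0%N)) (D 0%N) l ->
    expands kappa beta (crossings (e k) (v k.-1) b) (D k) l ->
  expands kappa beta (around a b k) [set x | exists i, D i x] (l + l).
Proof.
case: k => // k _ kN Da fin hc h0 h1.
have fch : finite_set (chain cross 0 k (crossings (e k.+1) (v k) b)).
  by apply: chain_fin => // j; exact: fin.
have h := expands_cat h0 (@expands_chain _ kappa beta 0 k b l (ltnW kN) fin hc h1) fch
  (fun q cq x xq => @chain_avoids_cell 0 k b q x kN cq xq).
apply: (expands_sub h) => //; first by apply: catset_fin => //; exact: fin.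
by move=> x [Dx|[i _ Dx]]; [exists 0%N|exists (0 + i).+1].
Qed.

Lemma around_size a b k L p : (0 < k)%N ->
    (forall p, crossings (e 0%N) a (v 0%N) p -> (L <= size p)%N) ->
    (forall p, crossings (e k) (v k.-1) b p -> (L <= size p)%N) ->
  around a b k p -> (L + L <= size p)%N.
Proof.
move=> k0 h0 h1 /catsetP[p1 [p2 [/h0 c0 c1 ->]]]; rewrite size_cat leq_add //.
move: c1 h1; set B := crossings (e k) _ _ => + h1; elim: (k.-1) (0%N) p2 => [|n IH] i p2 /=.
  exact: h1.
move=> /catsetP[q1 [q2 [_ /IH h ->]]]; rewrite size_cat; exact: leq_trans h (leq_addl _ _).
Qed.

(** Intermediate cells contribute independent factors, and so do the end cells unless the arc fills
    the ring; then the last piece must avoid [v k] whenever the first one visits it. The hypotheses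
    on [Q] say that it restricts intermediate cells only. *)
Lemma wt_around (R : realType) (beta : R) (Q : set (seq T)) a b k :
    (forall i x y, finite_set (crossings (e i) x y)) ->
    D 0 a -> (forall j, D j a -> j = 0 %[mod N]) -> (0 < k < N)%N -> cat_stable Q ->
  let c0 := crossings (e 0%N) a (v 0%N) in
  let c1 := crossings (e k) (v k.-1) b in
    c0 `&` Q = c0 -> c1 `&` Q = c1 ->
  wt beta (around a b k `&` [set p | uniq (a :: p)] `&` Q) =
  (if k.+1 == N then
     wt beta (c0 `&` avoid (v k)) * wt beta c1 +
     (wt beta c0 - wt beta (c0 `&` avoid (v k))) * wt beta (c1 `&` avoid (v k))
   else wt beta c0 * wt beta c1) *
  \prod_(0 <= j < k.-1) wt beta (cross j `&` Q).
Proof.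
move=> fin D0 Da kN hQ c0 c1 Q0 Q1.
have av0 : a <> v 0.
  move=> av; have [_ Dv] := cr_v H 0; move: Dv; rewrite -av => /Da h.
  by have := modn_eq_small (esym h); have := cr_N H; lia.
have e0 : ends_at c0 (v 0) by exact: crossings_ends.
have eI (A B : set (seq T)) x : ends_at A x -> ends_at (A `&` B) x by move=> h p [/h].
have fc j : finite_set (cross j) by exact: fin.
have f0 : finite_set c0 by exact: fin.
have f1 : finite_set c1 by exact: fin.
have fch (P : nat -> set (seq T)) B : (forall j, finite_set (P j)) -> finite_set B ->
    finite_set (chain P 0 k.-1 B).
  exact: chain_fin.
have wc (P : nat -> set (seq T)) B : (forall j, finite_set (P j)) -> finite_set B ->
    (forall j, ends_at (P j) (v j.+1)) ->
    wt beta (chain P 0 k.-1 B) = \prod_(0 <= j < k.-1) wt beta (P j) * wt beta B.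
  by move=> fP fB eP; rewrite (wt_chain beta 0 k.-1 fP fB eP).
have [kE|kE] := eqVneq k.+1 N; last first.
  rewrite (_ : around a b k `&` _ = around a b k); last first.
    apply/setIidPl => p; apply: around_lt_uniq => //; first by case/andP: kN.
    by move: kE => /eqP; lia.
  rewrite /around hQ chain_filter // -/c0 -/c1 Q0 Q1.
  rewrite (wt_cat beta f0 _ e0); last by apply: fch => // j; exact: finite_setIl.
  rewrite wc //; first by rewrite mulrCA mulrC.
    by move=> j; exact: finite_setIl.
  by move=> j; apply/eI/cross_ends.
have k0 : (0 < k)%N by case/andP: kN.
rewrite (around_full b k0 kE D0 Da) -/c0 -/c1 setIUl.
set A := catset _ _ `&` Q; set B := catset _ _ `&` Q.
have AE : A = catset (c0 `&` avoid (v k)) (chain (fun j => cross j `&` Q) 0 k.-1 c1).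
  by rewrite /A hQ chain_filter // Q1 -setIA (setIC (avoid _)) setIA Q0.
have BE : B = catset (c0 `&` ~` avoid (v k))
    (chain (fun j => cross j `&` avoid (v k) `&` Q) 0 k.-1 (c1 `&` avoid (v k))).
  rewrite /B hQ !chain_filter //; last exact: avoid_stable.
  by rewrite -!setIA (setIC _ Q) !setIA Q0 -(setIA c1) (setIC _ Q) setIA Q1.
rewrite wtU; first last.
- move=> p [[]]; rewrite /A /B => /catsetP[p1 [p2 [[c1' n1] _ ->]]] _.
  move=> [/catsetP[q1 [q2 [[d1 m1] _ E']]] _].
  have [r1 r1E n1'] := e0 _ c1'; have [s1 s1E m1'] := e0 _ d1.
  move: E' n1 m1; rewrite r1E s1E => /(split_uniq n1' m1')[-> _].
  by move=> h /(_ h).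
- rewrite BE; apply: catset_fin; first exact: finite_setIl.
  by apply: fch => [j|]; do ?[exact: fc|exact: f1|apply: finite_setIl].
- rewrite AE; apply: catset_fin; first exact: finite_setIl.
  by apply: fch => [j|]; do ?[exact: fc|exact: f1|apply: finite_setIl].
(* [v k] lies only in the cells k and k + 1 = N, the latter being the cell 0, so the intermediate
   pieces avoid it anyway. *)
have Dvk j : (j.+1 < k)%N -> ~ D j.+1 (v k).
  move=> jk Dj; have [Dk _] := cr_v H k.
  case: (cr_int H Dj Dk) => [h|[h vv]|[h _]].
  - by have := modn_eq_small h; lia.
  - have kj : k = j.+2 by have := modn_eq_small (esym h); lia.
    by move: vv; rewrite kj => /esym/(cr_neq H).
  - by have := modn_eq_small h; lia.
rewrite AE BE.
rewrite (wt_cat beta _ _ (eI c0 _ _ e0)); [|exact: finite_setIl|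
  by apply: fch => [j|]; do ?[exact: fc|exact: f1|apply: finite_setIl]].
rewrite (wt_cat beta _ _ (eI c0 _ _ e0)); [|exact: finite_setIl|
  by apply: fch => [j|]; do ?[exact: fc|exact: f1|apply: finite_setIl]].
rewrite wc //; [|by move=> j; exact: finite_setIl|by move=> j; apply/eI/cross_ends].
rewrite wc //; [|by move=> j; do ?[exact: fc|apply: finite_setIl]|exact: finite_setIl|
  by move=> j; do 2!apply/eI; apply/cross_ends].
rewrite (eq_big_nat (F1 := fun j => wt beta (cross j `&` avoid (v k) `&` Q)) _ _
  (F2 := fun j => wt beta (cross j `&` Q))); last first.
  by move=> j jk; rewrite cross_avoid //; apply: Dvk; lia.
have -> : wt beta c0 - wt beta (c0 `&` avoid (v k)) = wt beta (c0 `&` ~` avoid (v k)).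
  by rewrite (wt_split beta (avoid (v k)) f0) addrAC subrr add0r.
ring.
Qed.

Lemma chain_head n b p : b <> v 0 ->
    chain cross 0 n (crossings (e n.+1) (v n) b) p ->
  exists y p', p = y :: p' /\ e 1 (v 0%N) y.
Proof.
move=> bv; case: n => [|n] /=.
  by case: p => [|y p] [/= + _]; [move=> _ /esym|case/andP=> ey _ _; exists y, p].
move=> /catsetP[p1 [p2 [[]]]]; case: p1 => [|y p1] /=.
  by move=> _ _ /(cr_neq H).
by move=> /andP[ey _] _ _ _ ->; exists y, (p1 ++ p2).
Qed.

(** The piece [p1] is the longest prefix inside the cell 0: if an edge of that cell followed it, [y]
    would be common to the cells 0 and 1, that is [v 0], which is already visited. *)
Lemma leave_size a p1 y p2 q r : crossings (e 0%N) a (v 0%N) p1 -> e 1 (v 0%N) y ->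
  uniq (a :: p1 ++ y :: p2) -> path (e 0%N) a q -> p1 ++ y :: p2 = q ++ r ->
  (size q <= size p1)%N.
Proof.
move=> [pp1 _ l1] ey up pq E1; rewrite leqNgt; apply/negP => sq.
have qE : q = p1 ++ y :: take (size q - (size p1).+1) p2.
  have := congr1 (take (size q)) E1; rewrite (take_size_cat r (erefl (size q))) => {1}<-.
  rewrite take_cat ltnNge (ltnW sq) /=; congr cat.
  by have -> : (size q - size p1)%N = (size q - (size p1).+1).+1 by lia.
move: pq; rewrite qE cat_path l1 /= => /and3P[_ e0 _].
have yv : y = v 0 by apply: adjacent_D; [have [] := cr_D H e0|have [] := cr_D H ey].
have := up; rewrite -cat_cons cat_uniq => /and3P[_ /hasPn/(_ y)].
by rewrite mem_head yv -l1 mem_last => /(_ isT).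
Qed.

End Ring.

(** * Both directions around the ring *)

Section TwoWays.
Context {T : choiceType} {E : rel T} {N : nat} {D D' : nat -> set T}
    {e e' : nat -> rel T} {v v' : nat -> T}.
(* The primed data list the same ring in the opposite direction. *)
Hypotheses (H : cell_ring E N D e v) (H' : cell_ring E N D' e' v').
Hypotheses (D0 : D' 0%N = D 0%N) (e0 : e' 0%N = e 0%N).
Hypotheses (e1 : e' 1%N = e N.-1) (v0 : v' 0%N = v N.-1).

Lemma walk_from_corner a p : D 0%N a -> walks E a p ->
  [\/ walks (e 0%N) a p,
    exists2 n, (n < N)%N &
      catset (crossings (e 0%N) a (v 0%N))
        (chain (cross (e := e) (v := v)) 0 n (crossings (e n.+1) (v n) (last a p))) p |
    exists2 n, (n < N)%N &
      catset (crossings (e' 0%N) a (v' 0%N))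
        (chain (cross (e := e') (v := v')) 0 n (crossings (e' n.+1) (v' n) (last a p))) p].
Proof.
move=> Da [pp up].
have [h|[p1 [y [p2 [Ep pp1 [j ej hj]]]]]] := exit_cell H Da pp; first by apply: Or31.
move: up pp; rewrite Ep -cat_cons => up pp.
have lv : last a p1 = v 0%N -> uniq [:: v 0%N, y & p2].
  move=> l1; have := up; rewrite cat_uniq => /and3P[_ /hasPn/(_ (v 0%N)) h u2].
  by rewrite cons_uniq u2 andbT; apply/negP => /h; rewrite -l1 mem_last.
have lv' : last a p1 = v' 0%N -> uniq [:: v' 0%N, y & p2].
  move=> l1; have := up; rewrite cat_uniq => /and3P[_ /hasPn/(_ (v' 0%N)) h u2].
  by rewrite cons_uniq u2 andbT; apply/negP => /h; rewrite -l1 mem_last.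
move: (up); rewrite cat_uniq => /andP[u1 _].
move: pp; rewrite cat_path => /andP[_ pp].
case: hj => -[hj l1].
- have [_ eE _] := cr_per H hj.
  move: pp ej; rewrite l1 eE => pp ej.
  have [n c] := forward H (lv l1) pp ej.
  have nN := chain_size_lt H c (lv l1).
  apply: Or32; exists n => //; apply/catsetP; exists p1, (y :: p2); split=> //.
  by move: c; rewrite add0n last_cat /=.
- have jE : j = N.-1 %[mod N].
    apply/eqP; rewrite -(eqn_modDr 1) !addn1 prednK; last by have := cr_N H; lia.
    by rewrite -hj mod0n modnn.
  have [_ eE vE] := cr_per H jE.
  move: pp ej; rewrite l1 eE vE -v0 -e1 => pp ej.
  have l1' : last a p1 = v' 0%N by rewrite l1 vE v0.
  have [n c] := forward H' (lv' l1') pp ej.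
  have nN := chain_size_lt H' c (lv' l1').
  apply: Or33; exists n => //; apply/catsetP; exists p1, (y :: p2); split=> //.
    by rewrite e0; split.
  by move: c; rewrite add0n last_cat /=.
Qed.

(** The end [b] lies in a single cell, whose index in the chosen direction fixes the number of cells
    traversed. *)
Lemma crossings_around a b k k' : D 0%N a -> (0 < k < N)%N -> (0 < k' < N)%N ->
    (forall j, D j b -> j = k %[mod N]) -> (forall j, D' j b -> j = k' %[mod N]) ->
  crossings E a b =
    (around (e := e) (v := v) a b k `&` [set p | uniq (a :: p)]) `|`
    (around (e := e') (v := v') a b k' `&` [set p | uniq (a :: p)]).
Proof.
move=> Da kN kN' Db Db'; apply/seteqP; split=> p; last first.
  by case=> -[h up]; [have [] := around_path H _ h|have [] := around_path H' _ h];
    try (by case/andP: kN); try (by case/andP: kN').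
move=> [pp up lp].
(* The case n + 1 = N would put the end back into the cell 0, against 0 < m < N. *)
have nk n m : n.+1 = m %[mod N] -> (n < N)%N -> (0 < m < N)%N -> n = m.-1.
  move=> h nN mN; have [nN'|nN'] := ltnP n.+1 N.
    by move: h; rewrite !modn_small //; lia.
  have nE : n.+1 = N by lia.
  by move: h; rewrite nE modnn modn_small; lia.
case: (walk_from_corner Da (conj pp up)) => [[pe _]|[n nN]|[n nN]]; last first.
- move=> /catsetP[p1 [p2 [c1 c2 Ep]]]; right; split=> //.
  move: c2; rewrite lp => c2; have kn : n = k'.-1.
    by apply: nk => //; apply: Db'; apply: (chain_last H' c2).
  move: c2; rewrite kn prednK; last by case/andP: kN'.
  by move=> c2; apply/catsetP; exists p1, p2.
- move=> /catsetP[p1 [p2 [c1 c2 Ep]]]; left; split=> //.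
  move: c2; rewrite lp => c2; have kn : n = k.-1.
    by apply: nk => //; apply: Db; apply: (chain_last H c2).
  move: c2; rewrite kn prednK; last by case/andP: kN.
  by move=> c2; apply/catsetP; exists p1, p2.
- have := path_D H Da pe (mem_last _ _); rewrite lp => /Db h.
  by have := modn_eq_small h; lia.
Qed.

(** In either direction the piece in the cell 0 is the longest prefix inside that cell, so for a
    common walk it would end both at [v 0] and at [v N.-1]. *)
Lemma around_disjoint a b k k' : D 0%N a -> ~ D 0%N b -> (0 < k)%N -> (0 < k')%N ->
  (around (e := e) (v := v) a b k `&` [set p | uniq (a :: p)]) `&`
  (around (e := e') (v := v') a b k' `&` [set p | uniq (a :: p)]) `<=` set0.
Proof.
case: k => // k; case: k' => // k' Da Db _ _ p [[/catsetP[p1 [p2 [c1 c2 E1]]] up]].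
move=> [/catsetP[q1 [q2 [d1 d2 E2]]] _] /=.
have [|y [p3 [Ey ey]]] := chain_head H _ c2.
  by move=> bv; apply: Db; rewrite bv; case: (cr_v H 0).
have [|z [q3 [Ez ez]]] := chain_head H' _ d2.
  by move=> bv; apply: Db; rewrite bv -D0; case: (cr_v H' 0).
have up1 : uniq (a :: p1 ++ y :: p3) by rewrite -Ey -E1.
have up2 : uniq (a :: q1 ++ z :: q3) by rewrite -Ez -E2.
have s1 : (size q1 <= size p1)%N.
  apply: (leave_size H c1 ey up1 (q := q1) (r := q2)); last by rewrite -Ey -E1.
  by rewrite -e0; case: d1.
have s2 : (size p1 <= size q1)%N.
  apply: (leave_size H' d1 ez up2 (q := p1) (r := p2)); last by rewrite -Ez -E2.
  by rewrite e0; case: c1.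
have pq : p1 = q1.
  have s : size p1 = size q1 by apply/eqP; rewrite eqn_leq s1 s2.
  by have /eqP := E1; rewrite E2 eqseq_cat // => /andP[/eqP-> _].
case: c1 => _ _; rewrite pq; case: d1 => _ _ -> v00.
have N2 := cr_N H; apply: (cr_neq H (i := N.-1)).
have h0 : 0%N = N.-1.+1 %[mod N] by rewrite prednK ?modnn ?mod0n //; lia.
have [_ _ <-] := cr_per H h0.
by rewrite -v0 v00.
Qed.


(** Union bound over the direction and the number of cells traversed; the last factor is relaxed to
    any walk in the last cell, and self-intersecting concatenations are counted as well. *)
Lemma wt_walks_le (R : realType) (beta X Y W : R) a : D 0%N a ->
    (forall i x y, finite_set (crossings (e i) x y)) ->
    (forall i x y, finite_set (crossings (e' i) x y)) ->
    (forall i x, finite_set (walks (e i) x)) -> (forall i x, finite_set (walks (e' i) x)) ->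
    finite_set (walks E a) -> a <> v 0%N -> a <> v' 0%N ->
    wt beta (walks (e 0%N) a) = W ->
    wt beta (crossings (e 0%N) a (v 0%N)) = X -> wt beta (crossings (e' 0%N) a (v' 0%N)) = X ->
    (forall i, wt beta (cross (e := e) (v := v) i) = Y) ->
    (forall i, wt beta (cross (e := e') (v := v') i) = Y) ->
    (forall i, wt beta (walks (e i.+1) (v i)) = W) ->
    (forall i, wt beta (walks (e' i.+1) (v' i)) = W) ->
  wt beta (walks E a) <= W * (1 + 2 * X * \sum_(i < N) Y ^+ i).
Proof.
move=> Da f f' g g' fE av av' w0 wX wX' wY wY' wW wW'.
pose B i := catset (crossings (e 0%N) a (v 0%N))
  (chain (cross (e := e) (v := v)) 0 i (walks (e i.+1) (v i))).
pose B' i := catset (crossings (e' 0%N) a (v' 0%N))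
  (chain (cross (e := e') (v := v')) 0 i (walks (e' i.+1) (v' i))).
have fB i : finite_set (B i) by apply: catset_fin => //; apply: chain_fin => // j; exact: f.
have fB' i : finite_set (B' i) by apply: catset_fin => //; apply: chain_fin => // j; exact: f'.
have wB i : wt beta (B i) = X * (Y ^+ i * W).
  rewrite (wt_cat beta _ _ (crossings_ends av)) //; last by apply: chain_fin => // j; exact: f.
  rewrite (wt_chain beta 0 i _ _ (cross_ends H)) //; last by move=> j; exact: f.
  rewrite wX wW; congr (_ * (_ * _)).
  by rewrite (eq_bigr (fun=> Y)) // prodr_const_nat subn0.
have wB' i : wt beta (B' i) = X * (Y ^+ i * W).
  rewrite (wt_cat beta _ _ (crossings_ends av')) //; last by apply: chain_fin => // j; exact: f'.
  rewrite (wt_chain beta 0 i _ _ (cross_ends H')) //; last by move=> j; exact: f'.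
  rewrite wX' wW'; congr (_ * (_ * _)).
  by rewrite (eq_bigr (fun=> Y)) // prodr_const_nat subn0.
have cw (t : rel T) x y : crossings t x y `<=` walks t x by move=> p [].
pose P := [set p | exists2 i, (i < N)%N & B i p].
pose P' := [set p | exists2 i, (i < N)%N & B' i p].
have fP : finite_set (walks E a `&` P) by exact: finite_setIl.
have sP : wt beta (walks E a `&` P) <= \sum_(i < N) wt beta (B i).
  by apply: wt_le_sum => // p [_].
have sP' : wt beta (walks E a `&` P') <= \sum_(i < N) wt beta (B' i).
  by apply: wt_le_sum => [|//|p [_]//]; exact: finite_setIl.
have step : wt beta (walks E a) <= W + (wt beta (walks E a `&` P) + wt beta (walks E a `&` P')).
  rewrite -w0; apply: le_trans (lerD (lexx _) (wtU_le _ _ _)) => //; last exact: finite_setIl.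
  apply: le_trans (wtU_le _ _ _) => //; last first.
    by rewrite finite_setU; split=> //; exact: finite_setIl.
  apply: le_wt; first by rewrite !finite_setU; do !split=> //; exact: finite_setIl.
  move=> p wp; case: (walk_from_corner Da wp) => [h|[n nN h]|[n nN h]]; first by left.
    right; left; split=> //; exists n => //; apply: catsetS h => //.
    by apply: chainS; [move=> j|exact: cw].
  right; right; split=> //; exists n => //; apply: catsetS h => //.
  by apply: chainS; [move=> j|exact: cw].
apply: (le_trans step); rewrite mulrDr mulr1 lerD //.
have <- : \sum_(i < N) wt beta (B i) + \sum_(i < N) wt beta (B' i) =
    W * (2 * X * \sum_(i < N) Y ^+ i).
  under eq_bigr do rewrite wB; under [X in _ + X]eq_bigr do rewrite wB'.
  by rewrite -big_distrr -big_distrl /=; ring.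
exact: lerD.
Qed.

End TwoWays.

(** * Transport of crossings along bijections, and reversal *)

Section Transport.
Context {T : choiceType}.
Implicit Types (e : rel T).

Lemma path_map_iff e e' (f : T -> T) a p : (forall x y, e' (f x) (f y) = e x y) ->
  path e' (f a) (map f p) = path e a p.
Proof. by move=> h; elim: p a => //= y p IH a; rewrite h IH. Qed.

Lemma walks_map e e' (f g : T -> T) a : cancel f g -> cancel g f ->
  (forall x y, e' (f x) (f y) = e x y) ->
  walks e' (f a) = map f @` walks e a.
Proof.
move=> fK gK h; have fi := can_inj fK.
apply/seteqP; split=> p.
  move=> [pp up]; exists (map g p); last by rewrite (mapK gK).
  by split; rewrite -?(path_map_iff _ _ h) ?(mapK gK) // -(map_inj_uniq fi) /= (mapK gK).
by move=> [q [pq uq] <-]; split; rewrite ?(path_map_iff _ _ h) // -map_cons map_inj_uniq.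
Qed.

Lemma crossings_map e e' (f g : T -> T) a b : cancel f g -> cancel g f ->
  (forall x y, e' (f x) (f y) = e x y) ->
  crossings e' (f a) (f b) = map f @` crossings e a b.
Proof.
move=> fK gK h; have fi := can_inj fK.
apply/seteqP; split=> p.
  move=> [pp up lp]; exists (map g p); last by rewrite (mapK gK).
  split; last by apply: fi; rewrite -last_map (mapK gK).
    by rewrite -(path_map_iff _ _ h) (mapK gK).
  by rewrite -(map_inj_uniq fi) /= (mapK gK).
move=> [q [pq uq lq] <-]; split; rewrite ?(path_map_iff _ _ h) //.
  by rewrite -map_cons map_inj_uniq.
by rewrite last_map lq.
Qed.

Lemma map_avoid (f : T -> T) (A : set (seq T)) x : injective f ->
  (map f @` A) `&` avoid (f x) = map f @` (A `&` avoid x).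
Proof.
move=> fi; apply/seteqP; split=> p.
  by move=> [[q Aq <-]]; rewrite /avoid /= mem_map // => h; exists q.
by move=> [q [Aq h] <-]; split; [exists q|rewrite /avoid /= mem_map].
Qed.

(** Words omit the start, so the last vertex of [p], now the start, is dropped and [a] is put at the
    end. *)
Definition reversal (a : T) p := rev (belast a p).

Lemma reversalE a p : last a p :: reversal a p = rev (a :: p).
Proof. by rewrite [in RHS]lastI rev_rcons. Qed.

Lemma last_reversal a p : last (last a p) (reversal a p) = a.
Proof. by have := congr1 (last a) (reversalE a p); rewrite /= rev_cons last_rcons. Qed.

Lemma reversalK a p : reversal (last a p) (reversal a p) = p.
Proof.
have := reversalE (last a p) (reversal a p).
by rewrite last_reversal reversalE revK => -[].
Qed.

Lemma crossings_reversal e a b p : symmetric e -> crossings e a b p ->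
  crossings e b a (reversal a p).
Proof.
move=> es [pp up <-]; split; last exact: last_reversal.
  by rewrite /reversal rev_path; under eq_path do rewrite es.
by rewrite reversalE rev_uniq.
Qed.

Lemma wt_crossings_rev (R : realType) (beta : R) e a b x : symmetric e ->
    x <> a -> x <> b ->
  wt beta (crossings e a b `&` avoid x) = wt beta (crossings e b a `&` avoid x).
Proof.
move=> es xa xb.
have av u w p : x <> u -> x <> w -> crossings e u w p -> x \notin p -> x \notin reversal u p.
  move=> xu xw [_ _ lp] xp; have := congr1 (fun s => x \in s) (reversalE u p).
  rewrite mem_rev !inE lp (negbTE xp) orbF.
  by rewrite !(introF eqP) //= => ->.
have -> : crossings e b a `&` avoid x = reversal a @` (crossings e a b `&` avoid x).
  apply/seteqP; split=> [p [h hx]|_ [p [h hx] <-]]; last first.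
    by split; [exact: crossings_reversal|exact: av h hx].
  exists (reversal b p); last by case: (h) => _ _ <-; rewrite reversalK.
  by split; [exact: crossings_reversal|exact: av h hx].
rewrite /wt fsbig_image; last first.
  move=> p q; rewrite !inE => -[[_ _ lp] _] [[_ _ lq] _] /= E.
  by rewrite -(reversalK a p) -(reversalK a q) lp lq E.
by apply: eq_fsbigr => p _; rewrite size_rev size_belast.
Qed.
End Transport.

(** * Geometry of the cells *)

Section Trigonometry.
Local Open Scope complex_scope.
Context {R : realType}.
Implicit Types x y : R.

Lemma sin_sub_sin x y : sin x - sin y = 2 * sin ((x - y) / 2) * cos ((x + y) / 2).
Proof.
rewrite [in sin x](_ : x = (x + y) / 2 + (x - y) / 2); last by field.
rewrite [in sin y](_ : y = (x + y) / 2 - (x - y) / 2); last by field.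
by rewrite sinD sinB; ring.
Qed.

Lemma cos_lt0_pi x : pi / 2 < x < pi + pi / 2 -> cos x < 0.
Proof.
move=> hx; rewrite -(subrK pi x) cosDpi oppr_lt0; apply: cos_gt0_pihalf.
by move: hx => /andP[]; lra.
Qed.

Variable N : nat.
Hypotheses (N3 : (3 <= N)%N) (N4 : ~~ (4 %| N)%N).
Local Notation s := (sN N).

(** As 4 does not divide N, the bound 4 s - 4 < N is strict; this excludes a tie in [width_max]. *)
Lemma sN_bounds : [/\ (0 < s)%N, (4 * s - 4 < N)%N & (N < 4 * s)%N].
Proof.
have N4' : (N %% 4)%N != 0%N := N4.
by split; rewrite /sN; lia.
Qed.

Let NR : 0 < N%:R :> R. Proof. by rewrite ltr0n; lia. Qed.
Let Nn0 : N%:R != 0 :> R. Proof. by rewrite gt_eqF. Qed.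
Let NR3 : 3 <= N%:R :> R. Proof. by rewrite ler_nat. Qed.

(* Angles are measured in units of pi / N. *)
Definition ang (a : R) : R := a * pi / N%:R.

Let ang_lt a b : (ang a < ang b) = (a < b).
Proof. by rewrite /ang ltr_pM2r ?invr_gt0 // ltr_pM2r ?pi_gt0. Qed.

Let angN : ang N%:R = pi. Proof. by rewrite /ang; field. Qed.
Let angN2 : ang (N%:R / 2) = pi / 2. Proof. by rewrite /ang; field. Qed.

Lemma sin_ang_gt0 a : 0 < a < N%:R -> 0 < sin (ang a).
Proof.
move=> /andP[a0 aN]; apply: sin_gt0_pi; rewrite -angN ang_lt aN andbT.
by rewrite -(_ : ang 0 = 0) ?ang_lt // /ang !mul0r.
Qed.

Lemma cos_ang_gt0 a : - (N%:R / 2) < a < N%:R / 2 -> 0 < cos (ang a).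
Proof.
move=> /andP[a0 aN]; apply: cos_gt0_pihalf; rewrite -angN2 ang_lt aN andbT.
by rewrite -(_ : ang (- (N%:R / 2)) = - ang (N%:R / 2)) ?ang_lt // /ang !mulNr.
Qed.

Lemma cos_ang_lt0 a : N%:R / 2 < a < N%:R + N%:R / 2 -> cos (ang a) < 0.
Proof.
move=> /andP[a0 aN]; apply: cos_lt0_pi; rewrite -angN2 ang_lt a0 /=.
by rewrite -angN -(_ : ang (N%:R + N%:R / 2) = ang N%:R + ang (N%:R / 2)) ?ang_lt // /ang !mulrDl.
Qed.

Lemma sin_sub_sin_ang a b :
  sin (ang a) - sin (ang b) = 2 * sin (ang ((a - b) / 2)) * cos (ang ((a + b) / 2)).
Proof. by rewrite sin_sub_sin /ang; congr (2 * sin _ * cos _); field. Qed.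

Let sR : [/\ 0 < s%:R :> R, 4 * s%:R - 3 <= N%:R :> R & N%:R + 1 <= 4 * s%:R :> R].
Proof.
have [s0 s1 s2] := sN_bounds; split; first by rewrite ltr0n.
  have : ((4 * s)%N%:R <= (N + 3)%N%:R :> R) by rewrite ler_nat; lia.
  by rewrite natrM natrD; lra.
have : ((N + 1)%N%:R <= (4 * s)%N%:R :> R) by rewrite ler_nat; lia.
by rewrite natrM natrD; lra.
Qed.

(** Half the width of the unit polygon in the direction of its side from q_0 to q_1; half of that
    side is sin(pi/N). *)
Definition width : R := sin (ang (2 * s%:R - 1)).

Lemma rhoE : rho R N = sin (ang 1) / (sin (ang 1) + width).
Proof. by rewrite /rho /width /ang mul1r. Qed.

(** Among the odd multiples of pi/N below 2 pi, (2 s - 1) pi/N is the one strictly nearest to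
    pi/2. *)
Lemma width_max (r : nat) : (0 < r <= N)%N -> r != s ->
  sin (ang (2 * r%:R - 1)) < width.
Proof.
move=> /andP[r0 rN] rs; have [s0 s1 s2] := sR.
have rN' : r%:R <= N%:R :> R by rewrite ler_nat.
have r0' : 1 <= r%:R :> R by rewrite ler1n.
rewrite -subr_gt0 /width sin_sub_sin_ang.
have [h|h|h] := ltngtP r s; last by move: rs; rewrite h eqxx.
- have h' : r%:R + 1 <= s%:R :> R by rewrite natr1 ler_nat.
  by rewrite mulr_gt0 ?mulr_gt0 ?sin_ang_gt0 ?cos_ang_gt0 //; lra.
- have h' : s%:R + 1 <= r%:R :> R by rewrite natr1 ler_nat.
  rewrite nmulr_lgt0 ?cos_ang_lt0 //; last by lra.
  have -> : ang ((2 * s%:R - 1 - (2 * r%:R - 1)) / 2) = - ang (r%:R - s%:R).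
    by rewrite /ang; field.
  by rewrite sinN mulrN oppr_lt0 mulr_gt0 ?sin_ang_gt0 //; lra.
Qed.

Lemma width_gt0 : 0 < width.
Proof. by have [s0 s1 s2] := sR; have := NR3 => ?; apply: sin_ang_gt0; lra. Qed.

Lemma side_gt0 : 0 < sin (ang 1).
Proof. by have := NR3 => ?; apply: sin_ang_gt0; lra. Qed.

Lemma rho_gt0 : 0 < rho R N.
Proof.
by rewrite rhoE divr_gt0 ?addr_gt0 ?side_gt0 ?width_gt0.
Qed.

Lemma rho_lt1 : rho R N < 1.
Proof.
by rewrite rhoE ltr_pdivrMr ?addr_gt0 ?side_gt0 ?width_gt0 // mul1r ltrDl width_gt0.
Qed.

(** The cells 0 and 1 just touch: their centres are at distance 2 (1 - rho) sin(pi/N), and their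
    half-widths add up to 2 rho [width]. *)
Lemma rho_width : (1 - rho R N) * sin (ang 1) = rho R N * width.
Proof.
rewrite rhoE; have := side_gt0; have := width_gt0 => *; field; lra.
Qed.

(** Since sin(ang t) >= sin(ang 2) and [width] >= cos(ang 1), the product is at least 2 sin(ang 1)
    cos(ang 1)^2; and 2 cos(ang 1)^2 > 1 because cos(ang 2) > 0 for N >= 5. *)
Lemma width_far (t : R) : (2 <= t <= N%:R - 2) -> (5 <= N)%N ->
  sin (ang 1) < width * sin (ang t).
Proof.
move=> /andP[t2 tN] N5; have N5' : 5 <= N%:R :> R by rewrite (ler_nat _ 5).
have [s0 s1 s2] := sR.
have h1 : sin (ang 2) <= sin (ang t).
  rewrite -subr_ge0 sin_sub_sin_ang.
  have [->|tn2] := eqVneq t 2; first by rewrite subrr mul0r {1}/ang !mul0r sin0 mulr0 mul0r.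
  have [->|tN2] := eqVneq t (N%:R - 2).
    have -> : (N%:R - 2 + 2) / 2 = N%:R / 2 :> R by field.
    by rewrite angN2 cos_pihalf mulr0.
  have t2' : 2 < t by rewrite lt_def tn2.
  have tN' : t < N%:R - 2 by rewrite lt_def eq_sym tN2.
  by rewrite ltW // mulr_gt0 ?mulr_gt0 ?sin_ang_gt0 ?cos_ang_gt0 //; lra.
have h2 : cos (ang 1) <= width.
  have -> : cos (ang 1) = sin (ang (N%:R / 2 - 1)).
    have -> : ang (N%:R / 2 - 1) = - (ang 1 - pi / 2) by rewrite /ang; field.
    by rewrite sinN sinBpihalf opprK.
  rewrite -subr_ge0 sin_sub_sin_ang ltW //.
  by rewrite mulr_gt0 ?mulr_gt0 ?sin_ang_gt0 ?cos_ang_gt0 //; lra.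
have c1 : 0 < cos (ang 1) by rewrite cos_ang_gt0; lra.
have c2 : 0 < cos (ang 2) by rewrite cos_ang_gt0; lra.
have E2 : ang 2 = ang 1 *+ 2 by rewrite /ang; ring.
move: c2; rewrite E2 cos_mulr2n => c2.
have s1' := side_gt0; have w0 := width_gt0.
apply: (@lt_le_trans _ _ (cos (ang 1) * sin (ang 2))).
  rewrite E2 sin_mulr2n; move: c2 s1'; rewrite !mulr2n !expr2; nra.
apply: ler_pM => //; first exact: ltW.
by rewrite ltW // sin_ang_gt0 //; lra.
Qed.

End Trigonometry.

Section Isomorphic.
Context {T : choiceType} {R : realType}.

(** Every piece of an arc is such a copy of one of the two standard crossings; bounds on length and
    branching are carried over by it. *)
Definition isom (A : set (seq T)) (S : set T) (A' : set (seq T)) (S' : set T) :=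
  exists f g : T -> T, [/\ cancel f g, cancel g f, A' = map f @` A & S' = f @` S].

Lemma isom_trans A S A' S' A'' S'' :
  isom A S A' S' -> isom A' S' A'' S'' -> isom A S A'' S''.
Proof.
move=> [f [g [fK gK -> ->]]] [f' [g' [fK' gK' -> ->]]]; exists (f' \o f), (g \o g').
split; [exact: can_comp|exact: can_comp| |by rewrite image_comp].
by rewrite image_comp; congr image; apply: funext => p /=; rewrite map_comp.
Qed.

Lemma isom_size A S A' S' L : isom A S A' S' ->
  (forall p, A p -> (L <= size p)%N) -> forall p, A' p -> (L <= size p)%N.
Proof. by move=> [f [g [_ _ -> _]]] h _ [p /h hp <-]; rewrite size_map. Qed.

Lemma isom_expands A S A' S' (kappa beta : R) l : isom A S A' S' ->
  expands kappa beta A S l -> expands kappa beta A' S' l.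
Proof. by move=> [f [g [fK gK -> ->]]]; apply: (expands_map fK gK). Qed.

End Isomorphic.

Section Geometry.
Local Open Scope complex_scope.
Context {R : realType}.
Variable N : nat.
Hypotheses (N3 : (3 <= N)%N) (N4 : ~~ (4 %| N)%N).
Local Notation s := (sN N).
Local Notation C := R[i].
Local Notation qq := (q R N).
Local Notation rc := ((rho R N)%:C).
Implicit Types (x y : C).

Let Nn0 : N%:R != 0 :> R. Proof. by rewrite pnatr_eq0; lia. Qed.

Lemma q_add i j : qq (i + j) = qq i * qq j.
Proof.
rewrite /q /=.
rewrite (_ : 2 * pi * (i + j)%:~R / N%:R = 2 * pi * i%:~R / N%:R + 2 * pi * j%:~R / N%:R).
  by rewrite cosD sinD; simpc; rewrite (addrC (sin _ * _)).
by rewrite intrD; field.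
Qed.

Lemma q0 : qq 0 = 1.
Proof. by rewrite /q /= mulr0 mul0r cos0 sin0. Qed.

Lemma q_N : qq N%:Z = 1.
Proof.
rewrite /q /= (_ : 2 * pi * N%:Z%:~R / N%:R = pi *+ 2 :> R); last first.
  by rewrite -mulr_natl -pmulrn; field.
by rewrite cos2pi sin2pi.
Qed.

Lemma q_mul i j : qq (i * j) = qq i ^ j.
Proof.
have u : qq i \is a GRing.unit.
  have : qq i * qq (- i) = 1 by rewrite -q_add subrr q0.
  by move=> h; apply/unitrP; exists (qq (- i)); rewrite [X in X = _ /\ _]mulrC h.
elim/int_rec: j => [|n IH|n IH]; first by rewrite mulr0 q0 expr0z.
  by rewrite -addn1 PoszD mulrDr mulr1 q_add IH exprzDr // expr1z.
by rewrite -addn1 PoszD opprD mulrDr mulrN1 q_add IH exprzDr //; congr (_ * _);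
  rewrite exprN1; apply: (mulrI u); rewrite -q_add subrr q0 divrr.
Qed.

Lemma q_mod i : qq (i %% N)%Z = qq i.
Proof.
have := q_add ((i %/ N)%Z * N) (i %% N)%Z.
by rewrite -divz_eq => ->; rewrite [((i %/ N)%Z * _)%R]mulrC q_mul q_N exp1rz mul1r.
Qed.

Lemma q_neq0 i : qq i != 0.
Proof.
apply/negP => /eqP h; have := q_add i (- i); rewrite subrr q0 h mul0r.
by move/eqP; rewrite oner_eq0.
Qed.

Lemma q_ang i : qq i = cos (ang N (2 * i%:~R)) +i* sin (ang N (2 * i%:~R)).
Proof.
by rewrite /q /ang; congr (cos _ +i* sin _); field.
Qed.

Lemma q_eq_mod i j : qq i = qq j -> (i = j %[mod N])%Z.
Proof.
move=> E; have E1 : qq ((i - j) %% N)%Z = 1.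
  rewrite q_mod; apply: (mulIf (q_neq0 j)).
  by rewrite -q_add subrK mul1r.
apply/eqP; rewrite eqz_mod_dvd; apply/dvdz_mod0P.
have N0 : (N : int) != 0 by lia.
have := modz_ge0 (i - j) N0; have := ltz_mod (i - j) N0; move: E1.
case: ((i - j) %% N)%Z => // -[|t] // + tN _; rewrite q_ang => -[c1 _]; exfalso.
have t0 : (0 : R) < t.+1%:R by rewrite ltr0n.
have t1 : (t.+1%:R : R) < N%:R by rewrite ltr_nat; move: tN; lia.
have := @sin_ang_gt0 R N N3 N4 t.+1%:R; rewrite t0 t1 => /(_ isT); move: c1.
have -> : ang N (2 * (t.+1)%:Z%:~R) = ang N (t.+1)%:R *+ 2 :> R.
  by rewrite /ang -pmulrn -mulr_natl; ring.
rewrite cos_mulr2n cos2sin2; move: (sin _) => z; rewrite -mulr_natl expr2.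
move=> h h0; have : z * z <= 0 by clear E; lra.
by rewrite leNgt mulr_gt0.
Qed.

Lemma eq_q_mod i j : (i = j %[mod N])%Z -> qq i = qq j.
Proof. by move=> h; rewrite -(q_mod i) h q_mod. Qed.

Lemma eq_q_nat (a b : nat) : qq a = qq b <-> (a = b %[mod N])%N.
Proof.
split=> [/q_eq_mod|h]; first by rewrite !modz_nat => -[].
by apply: eq_q_mod; rewrite !modz_nat h.
Qed.

Lemma q_neq i j : (0 < i - j < N%:Z) -> qq i <> qq j.
Proof.
move=> h /q_eq_mod/eqP; rewrite eqz_mod_dvd => /dvdzP[k E].
move: h; rewrite E => /andP[h1 h2].
have N0 : 0 < N%:Z by lia.
have k0 : 0 < k by move: h1; rewrite pmulr_lgt0.
have : 1 * N%:Z <= k * N%:Z by rewrite ler_wpM2r //; lia.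
by rewrite mul1r leNgt h2.
Qed.

Let rc0 : rc != 0.
Proof. by rewrite -(rmorph0 (real_complex R)) (inj_eq (@complexI R)) gt_eqF // rho_gt0. Qed.

Local Notation Ps := (@Psi R N).
Local Notation Pi := (@Psi_inv R N).

Lemma PsiE i x : Ps i x = (1 - rc) * qq i + rc * x.
Proof. by rewrite /Psi; ring. Qed.

Lemma Psi_invE i x : Pi i x = qq i + rc^-1 * (x - qq i).
Proof. by rewrite /Psi_inv fmorphV. Qed.

Lemma PsiK i : cancel (Ps i) (Pi i).
Proof. by move=> x; rewrite Psi_invE /Psi; field. Qed.

Lemma Psi_invK i : cancel (Pi i) (Ps i).
Proof. by move=> x; rewrite Psi_invE /Psi; field. Qed.

Lemma Psi_q i : Ps i (qq i) = qq i.
Proof. by rewrite /Psi subrr mulr0 addr0. Qed.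

Lemma Psi_eq i j : qq i = qq j -> Ps i = Ps j.
Proof. by move=> h; rewrite /Psi h. Qed.

Lemma Psi_inv_eq i j : qq i = qq j -> Pi i = Pi j.
Proof. by move=> h; rewrite /Psi_inv h. Qed.

Lemma Psi_rot i j x : Ps (i + j) (qq i * x) = qq i * Ps j x.
Proof. by rewrite /Psi q_add; ring. Qed.

Lemma Psi_inv_rot i j x : Pi (i + j) (qq i * x) = qq i * Pi j x.
Proof. by rewrite /Psi_inv q_add; ring. Qed.

Lemma q_conj i : qq (- i) = (qq i)^*.
Proof.
rewrite /q /= rmorphN /= mulrN mulNr cosN sinN.
by apply/eqP; rewrite eq_complex /= !eqxx.
Qed.

Lemma Psi_inv_conj i x : Pi (- i) x^* = (Pi i x)^*.
Proof. by rewrite /Psi_inv q_conj !rmorphD !rmorphM !rmorphD !rmorphN /= oppr0. Qed.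

(* The union of the level-m copies of the N-cycle inside the unit cell, that is
   the graph F m before rescaling. *)
Fixpoint level_vert (m : nat) : set C :=
  if m is m'.+1 then [set x | exists i, level_vert m' (Pi i x)] else range qq.

Fixpoint level_adj (m : nat) : rel C := fun x y =>
  if m is m'.+1 then `[< exists i, level_adj m' (Pi i x) (Pi i y) >]
  else `[< adj (F0 R N) x y >].

Local Notation V := level_vert.
Local Notation E := level_adj.

Lemma E_S m x y : E m.+1 x y <-> exists i, E m (Pi i x) (Pi i y).
Proof. by split=> [/asboolP|h] //; apply/asboolP. Qed.

Lemma V_q m i : V m (qq i).
Proof.
elim: m => [|m IH] /=; first by exists i.
by exists i; rewrite -[X in Pi i X]Psi_q PsiK.
Qed.

Lemma E_V m x y : E m x y -> V m x /\ V m y.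
Proof.
elim: m x y => [|m IH] x y /=.
  by move=> /asboolP[j [-> [->|->]]]; split; apply: imageT.
by move=> /asboolP[i /IH[h1 h2]]; split; exists i.
Qed.

Lemma E_sym m x y : E m x y = E m y x.
Proof.
suff H x' y' : E m x' y' -> E m y' x' by apply/idP/idP; apply: H.
elim: m x' y' => [|m IH] x' y' /=.
  move=> /asboolP[j [-> [->|->]]]; apply/asboolP.
    by exists (j + 1); split=> //; right; rewrite addrK.
  by exists (j - 1); split=> //; left; rewrite subrK.
by move=> /asboolP[i /IH h]; apply/asboolP; exists i.
Qed.

Lemma V_rot m i x : V m x -> V m (qq i * x).
Proof.
elim: m x => [|m IH] x /=.
  by move=> [j _ <-]; rewrite -q_add; apply: imageT.
by move=> [j /IH h]; exists (i + j); rewrite Psi_inv_rot.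
Qed.

Lemma E_rot m i x y : E m x y -> E m (qq i * x) (qq i * y).
Proof.
elim: m x y => [|m IH] x y /=.
  move=> /asboolP[j [-> h]]; apply/asboolP; exists (i + j); rewrite q_add; split=> //.
  by case: h => ->; [left|right]; rewrite -q_add addrA.
by move=> /asboolP[j /IH h]; apply/asboolP; exists (i + j); rewrite !Psi_inv_rot.
Qed.

Lemma E_conj m x y : E m x y -> E m x^* y^*.
Proof.
elim: m x y => [|m IH] x y /=.
  move=> /asboolP[j [-> h]]; apply/asboolP; exists (- j); rewrite -q_conj; split=> //.
  by case: h => ->; rewrite -q_conj; [right|left]; congr (q _ _ _); lia.
by move=> /asboolP[j /IH h]; apply/asboolP; exists (- j); rewrite !Psi_inv_conj.
Qed.

Lemma V_conj m x : V m x -> V m x^*.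
Proof.
elim: m x => [|m IH] x /=.
  by move=> [j _ <-]; rewrite -q_conj; apply: imageT.
by move=> [j /IH h]; exists (- j); rewrite !Psi_inv_conj.
Qed.

Lemma int_mod_ord i : exists k : 'I_N, qq i = qq (k : nat).
Proof.
have N0 : (N : int) != 0 by lia.
have := modz_ge0 i N0; have := ltz_mod i N0; rewrite -(q_mod i).
case: (i %% N)%Z => // k kN _; have kN' : (k < N)%N by lia.
by exists (Ordinal kN').
Qed.

Lemma V_fin m : finite_set (V m).
Proof.
elim: m => [|m IH] /=.
  apply: sub_finite_set (finite_image (fun k : 'I_N => qq (k : nat)) (finite_finset (X := setT))).
  by move=> _ [i _ <-]; have [k ->] := int_mod_ord i; exists k.
have fI : finite_set [set: 'I_N] by exact: finite_finset.
apply: sub_finite_set (finite_image2 (fun (k : 'I_N) x => Ps (k : nat) x) fI IH).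
move=> x [i h]; have [k hk] := int_mod_ord i; exists k => //; exists (Pi i x) => //.
by rewrite -(Psi_eq hk) Psi_invK.
Qed.

(** * Linear projections of the cells and their intersections *)

Definition lin (c1 c2 : R) x : R := c1 * complex.Re x + c2 * complex.Im x.

Lemma lin_Psi c1 c2 i x :
  lin c1 c2 (Ps i x) = (1 - rho R N) * lin c1 c2 (qq i) + rho R N * lin c1 c2 x.
Proof.
rewrite /lin PsiE; case: (qq i) => a b; case: x => c d /=.
by ring.
Qed.

(** [Psi] acts on the values of a linear form by convex combination with the value at a corner, so a
    bound at the corners persists at every level. *)
Lemma lin_le c1 c2 M m x : (forall i, lin c1 c2 (qq i) <= M) -> V m x -> lin c1 c2 x <= M.
Proof.
move=> h; elim: m x => [|m IH] x /=; first by move=> [i _ <-].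
move=> [i /IH hx]; rewrite -(Psi_invK i x) lin_Psi.
have := h i; have := @rho_gt0 R N N3 N4; have := @rho_lt1 R N N3 N4.
by move: hx (lin _ _ (qq i)); move: (lin _ _ _) (rho _ _) => a r ha b *; nra.
Qed.

(** Equality in the convex combination forces both terms to be maximal: the cell is that of the
    maximal corner, and inside it the point is that corner again. *)
Lemma lin_max c1 c2 M m x k : (forall i, lin c1 c2 (qq i) <= M) ->
  (forall i, lin c1 c2 (qq i) = M -> qq i = qq k) ->
  V m x -> lin c1 c2 x = M -> x = qq k.
Proof.
move=> h hk; elim: m x => [|m IH] x /=; first by move=> [i _ <-]; apply: hk.
move=> [i Vx]; rewrite -{1 2}(Psi_invK i x) lin_Psi => e.
have hi := h i; have hx := lin_le h Vx.
have := @rho_gt0 R N N3 N4; have := @rho_lt1 R N N3 N4 => r1 r0.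
have e1 : lin c1 c2 (qq i) = M.
  apply/eqP; rewrite eq_le hi /=.
  by set a := lin _ _ (qq i) in e hi *; set b := lin _ _ (Pi i x) in e hx *; nra.
have e2 : lin c1 c2 (Pi i x) = M.
  apply/eqP; rewrite eq_le hx /=.
  by set a := lin _ _ (qq i) in e hi *; set b := lin _ _ (Pi i x) in e hx *; nra.
by rewrite (IH _ Vx e2) -(hk _ e1) Psi_q.
Qed.


Lemma lin_q (t : R) i :
  lin (- sin (ang N t)) (cos (ang N t)) (qq i) = sin (ang N (2 * i%:~R - t)).
Proof.
rewrite q_ang /lin /= (_ : ang N (2 * i%:~R - t) = ang N (2 * i%:~R) - ang N t); last first.
  by rewrite /ang; ring.
by rewrite sinB; ring.
Qed.

Lemma q_ang_eq i j t : qq i = qq j ->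
  sin (ang N (2 * i%:~R - t)) = sin (ang N (2 * j%:~R - t)) :> R.
Proof. by move=> h; rewrite -!lin_q h. Qed.

Lemma q_pos i : exists2 k : nat, (0 < k <= N)%N & qq i = qq k.
Proof.
have [[k kN] /= h] := int_mod_ord (i - 1); exists k.+1; first by lia.
by rewrite -(subrK 1 i) q_add h -q_add -addn1 PoszD.
Qed.

Lemma sin_width i : sin (ang N (2 * i%:~R - 1)) <= width N :> R.
Proof.
have [k kN /(@q_ang_eq _ _ 1) ->] := q_pos i; rewrite -pmulrn.
have [->|ks] := eqVneq k s; first by [].
by apply: ltW; exact: width_max.
Qed.

Lemma sin_width_eq i : sin (ang N (2 * i%:~R - 1)) = width N :> R -> qq i = qq s.
Proof.
have [k kN hk] := q_pos i; rewrite (q_ang_eq 1 hk) hk -pmulrn => e.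
have [->|ks] := eqVneq k s; first by [].
by have := @width_max R N N3 N4 k kN ks; rewrite e ltxx.
Qed.

Let linN c1 c2 x : lin (- c1) (- c2) x = - lin c1 c2 x.
Proof. by rewrite /lin; ring. Qed.

Let sinN_width i : lin (- - sin (ang N 1)) (- cos (ang N 1)) (qq i) =
  sin (ang N (2 * (1 - i)%:~R - 1)) :> R.
Proof.
rewrite linN lin_q -sinN; congr sin; rewrite /ang rmorphB /=; ring.
Qed.

(* Projecting on the direction of q t - q 0 separates the cells 0 and t. *)
Lemma cell_gap (t : nat) u v : Ps 0 u = Ps t v ->
  let l := lin (- sin (ang N t%:R)) (cos (ang N t%:R)) in
  2 * width N * sin (ang N t%:R) = sin (ang N 1) * (l u - l v).
Proof.
move=> e l; have := congr1 l e; rewrite /l !lin_Psi !lin_q -!/l.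
have -> : 2 * (t : int)%:~R - t%:R = t%:R :> R by rewrite -pmulrn; ring.
have -> : ang N (2 * 0%:~R - t%:R) = - ang N t%:R :> R by rewrite /ang; ring.
rewrite sinN => e1; have w := rho_width N3 N4 (R := R).
have r0 : rho R N != 0 by rewrite gt_eqF // rho_gt0.
apply: (mulfI r0).
have e2 : rho R N * (l u - l v) = 2 * (1 - rho R N) * sin (ang N t%:R) by lra.
transitivity (2 * sin (ang N t%:R) * (rho R N * width N)); first by ring.
rewrite -w [RHS]mulrCA e2; ring.
Qed.

(** By [cell_gap] at t = 1 the extents of the two points towards each other add up to 2 [width],
    while each is at most [width]; so both are maximal, hence corners. *)
Lemma cells_adjacent m m' u v : V m u -> V m' v -> Ps 0 u = Ps 1 v ->
  u = qq s /\ v = qq (1 - s%:Z).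
Proof.
move=> Vu Vv e; have := cell_gap (t := 1) e.
set c1 := - sin _; set c2 := cos _ => /= g.
have s0 := side_gt0 N3 N4 (R := R).
have h1 i : lin c1 c2 (qq i) <= width N by rewrite lin_q sin_width.
have h2 i : lin (- c1) (- c2) (qq i) <= width N by rewrite sinN_width sin_width.
have lu := lin_le h1 Vu; have lv := lin_le h2 Vv.
have g' : 2 * width N = lin c1 c2 u + lin (- c1) (- c2) v.
  by rewrite linN; apply: (mulfI (lt0r_neq0 s0)); move: g; rewrite /c1 /c2; nra.
split.
  apply: (lin_max h1 _ Vu); last by lra.
  by move=> i; rewrite lin_q; exact: sin_width_eq.
apply: (lin_max h2 _ Vv); last by lra.
move=> i; rewrite sinN_width => /sin_width_eq h.
by rewrite q_add q_conj -h -q_conj -q_add; congr qq; ring.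
Qed.

(** The trivial bound 1 on each extent is enough, as [width_far] makes the required sum exceed 2. *)
Lemma cells_far m m' (t : nat) u v : V m u -> V m' v -> (2 <= t <= N - 2)%N ->
  Ps 0 u <> Ps t v.
Proof.
move=> Vu Vv tN /cell_gap /=; set c1 := - sin _; set c2 := cos _ => /= g.
have s0 := side_gt0 N3 N4 (R := R).
have h1 i : lin c1 c2 (qq i) <= 1 by rewrite lin_q sin_le1.
have h2 i : lin (- c1) (- c2) (qq i) <= 1 by rewrite linN lin_q -sinN sin_le1.
have lu := lin_le h1 Vu; have := lin_le h2 Vv; rewrite linN => lv.
have : sin (ang N 1) < width N * sin (ang N t%:R) :> R.
  apply: width_far => //; last by lia.
  by rewrite (ler_nat _ 2) /= lerBrDr -natrD ler_nat; lia.
by nra.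
Qed.

Lemma cells_inter m m' i j u v : V m u -> V m' v -> Ps i u = Ps j v ->
  [\/ qq i = qq j,
    [/\ qq j = qq (i + 1), u = qq (i + s%:Z) & v = qq (j - s%:Z)] |
    [/\ qq i = qq (j + 1), u = qq (i - s%:Z) & v = qq (j + s%:Z)]].
Proof.
move=> Vu Vv e.
(* Rotation by q_(-i1) moves the pair to the cells 0 and 1. *)
have adj m1 m2 i1 j1 u1 v1 : V m1 u1 -> V m2 v1 -> Ps i1 u1 = Ps j1 v1 ->
    qq j1 = qq (i1 + 1) -> u1 = qq (i1 + s%:Z) /\ v1 = qq (j1 - s%:Z).
  move=> V1 V2 e1 ht.
  have rotK x k : x = qq k * (qq (- k) * x) by rewrite mulrA -q_add subrr q0 mul1r.
  have e2 : Ps 0 (qq (- i1) * u1) = Ps 1 (qq (- i1) * v1).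
    have := congr1 ( *%R (qq (- i1))) e1.
    by rewrite (Psi_eq ht) -!Psi_rot addNr addrA addNr add0r.
  have [hu hv] := cells_adjacent (V_rot (- i1) V1) (V_rot (- i1) V2) e2.
  split; first by rewrite (rotK u1 i1) hu -q_add.
  by rewrite (rotK v1 i1) hv [RHS]q_add ht -!q_add; congr (q _ _ _); ring.
have [t [tN ht]] : exists t : nat, (t < N)%N /\ qq j = qq (i + t).
  have [[t tN] /= h] := int_mod_ord (j - i); exists t; split=> //.
  by rewrite q_add -h -q_add addrC subrK.
have [t0|t0] := eqVneq t 0%N; first by constructor 1; rewrite ht t0 addr0.
have [t1|t1] := eqVneq t 1%N.
  have h1 : qq j = qq (i + 1) by rewrite ht t1.
  by have [] := adj _ _ _ _ _ _ Vu Vv e h1; constructor 2.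
have [tN1|tN1] := eqVneq t N.-1.
  have h1 : qq i = qq (j + 1).
    rewrite [RHS]q_add ht -q_add tN1 -[LHS]mulr1 -q_N -q_add; congr (q _ _ _); lia.
  by have [] := adj _ _ _ _ _ _ Vv Vu (esym e) h1; constructor 3.
exfalso; apply: (@cells_far m m' t (qq (- i) * u) (qq (- i) * v)); try exact: V_rot.
  by lia.
have := congr1 ( *%R (qq (- i))) e.
by rewrite (Psi_eq ht) -!Psi_rot addNr addrA addNr add0r.
Qed.

(** Rotated to i = 0, the real and imaginary parts are twice [rho_width] multiplied by the sine and
    the cosine of pi/N. *)
Lemma Psi_junction i : Ps i (qq (i + s%:Z)) = Ps (i + 1) (qq (i + 1 - s%:Z)).
Proof.
have -> : qq (i + s%:Z) = qq i * qq s%:Z by rewrite q_add.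
have -> : qq (i + 1 - s%:Z) = qq i * qq (1 - s%:Z) by rewrite -q_add //; congr (q _ _ _); lia.
rewrite Psi_rot; have -> : Ps i (qq i * qq s%:Z) = qq i * Ps 0 (qq s%:Z) by rewrite -Psi_rot addr0.
congr (_ * _); rewrite !PsiE q0.
pose a : R := ang N 1; pose b : R := ang N (2 * s%:R - 1).
have w : (1 - rho R N) * sin a = rho R N * sin b := rho_width N3 N4.
rewrite !q_ang.
have -> : ang N (2 * 1%:~R) = a + a :> R by rewrite /a /ang; ring.
have -> : ang N (2 * s%:Z%:~R) = b + a :> R by rewrite /a /b /ang -pmulrn; ring.
have -> : ang N (2 * (1 - s%:Z)%:~R) = a - b :> R.
  by rewrite /a /b /ang rmorphB /= -pmulrn; ring.
clearbody a b; rewrite !cosD !sinD cosN sinN.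
have c2 := cos2Dsin2 a; have w1 := congr1 ( *%R^~ (sin a)) w.
have w2 := congr1 ( *%R^~ (cos a)) w; move: w w1 w2 => _ /= w1 w2.
apply/eqP; rewrite eq_complex /=; apply/andP; split; apply/eqP.
  rewrite !mul0r !subr0 ?mulr0 ?subr0.
  have c2' : cos a * cos a = 1 - sin a * sin a by move: c2; rewrite !expr2; lra.
  by rewrite c2'; lra.
by lra.
Qed.

Lemma two_s_lt : (2 * s < N)%N.
Proof. by have [h1 h2 h3] := sN_bounds N3 N4; lia. Qed.

(* The cells of level m + 1 listed from cell j0 on, anticlockwise when eps is 1
   and clockwise when it is -1; each shares a vertex with the next one. *)
Section Listing.
Variables (m : nat) (j0 eps : int).
Hypothesis eps1 : eps = 1 \/ eps = -1.

Definition idx (i : nat) : int := j0 + eps * i%:Z.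
Definition cell (i : nat) : set C := [set x | V m (Pi (idx i) x)].
Definition cell_edge (i : nat) : rel C := fun x y => E m (Pi (idx i) x) (Pi (idx i) y).
Definition junction (i : nat) : C := Ps (idx i) (qq (idx i + eps * s%:Z)).

Lemma idxS (i : nat) : idx i.+1 = idx i + eps.
Proof. by rewrite /idx -addn1 PoszD mulrDr mulr1 addrA. Qed.

Lemma q_idx (i k : nat) : qq (idx i) = qq (idx k) <-> (i = k %[mod N])%N.
Proof.
rewrite -eq_q_nat /idx !q_add; split=> [/(mulfI (q_neq0 j0))|].
  by case: eps1 => ->; rewrite ?mul1r // !mulN1r !q_conj => /(can_inj (@conjcK R)).
by case: eps1 => ->; rewrite ?mul1r ?mulN1r ?q_conj => ->.
Qed.

Lemma junctionE (i : nat) : junction i = Ps (idx i.+1) (qq (idx i.+1 - eps * s%:Z)).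
Proof.
rewrite /junction idxS; case: eps1 => ->; first by rewrite mul1r Psi_junction.
have := Psi_junction (idx i - 1); rewrite subrK mulN1r => <-.
by rewrite opprK.
Qed.

Lemma idx_surj j : exists i : nat, qq j = qq (idx i).
Proof.
have [k hk] := int_mod_ord (eps * (j - j0)); exists k; rewrite /idx q_add.
have -> : qq (eps * (k : nat)%:Z) = qq (j - j0).
  by case: eps1 hk => ->; rewrite ?mul1r // !mulN1r !q_conj => <-; rewrite conjcK.
by rewrite -q_add; congr (q _ _ _); lia.
Qed.

Lemma cell_ringP : cell_ring (E m.+1) N cell cell_edge junction.
Proof.
split.
- exact: N3.
- move=> x y; rewrite E_S; split=> [[j h]|[i h]]; last by exists (idx i).
  by have [i hi] := idx_surj j; exists i; rewrite /cell_edge -(Psi_inv_eq hi).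
- by move=> i x y /E_V.
- move=> i k /q_idx h; rewrite /cell /cell_edge /junction (Psi_inv_eq h) (Psi_eq h).
  by rewrite (q_add (idx i)) (q_add (idx k)) h.
- move=> i; split; first by rewrite /cell /= /junction PsiK; exact: V_q.
  by rewrite /cell /= junctionE PsiK; exact: V_q.
- move=> i k x Vi Vk.
  have e : Ps (idx i) (Pi (idx i) x) = Ps (idx k) (Pi (idx k) x) by rewrite !Psi_invK.
  have J (a b : nat) : qq (idx b) = qq (idx a + eps) -> (b = a.+1 %[mod N])%N.
    by rewrite -idxS => /q_idx.
  have K (a b : nat) : qq (idx b) = qq (idx a - eps) -> (a = b.+1 %[mod N])%N.
    by move=> h; apply/q_idx; rewrite idxS q_add h -q_add subrK.
  case: (cells_inter Vi Vk e) => [/q_idx h|[h1 h2 h3]|[h1 h2 h3]]; first by constructor 1.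
    case: eps1 => he; [constructor 2|constructor 3]; split.
    + by apply: J; rewrite he.
    + by rewrite /junction he mul1r -h2 Psi_invK.
    + by apply: K; rewrite he opprK.
    + by rewrite /junction he mulN1r -h3 Psi_invK.
  case: eps1 => he; [constructor 3|constructor 2]; split.
  + by apply: J; rewrite he.
  + by rewrite /junction he mul1r -h3 Psi_invK.
  + by apply: K; rewrite he opprK.
  + by rewrite /junction he mulN1r -h2 Psi_invK.
- move=> i; rewrite junctionE /junction => /(can_inj (PsiK _)).
  have [h1 h2 h3] := sN_bounds N3 N4; have h4 := two_s_lt.
  by case: eps1 => ->; [move/esym|]; apply: q_neq; lia.
Qed.

(** A cell shares with its neighbours only the images of its corners at index distance s, whereas
    this corner is the fixed point of the map of its cell. *)
Lemma corner_cell (i k : nat) : cell i (qq (idx k)) -> (i = k %[mod N])%N.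
Proof.
move=> h; have e : Ps (idx i) (Pi (idx i) (qq (idx k))) = Ps (idx k) (qq (idx k)).
  by rewrite Psi_invK Psi_q.
have [h1 h2 h3] := sN_bounds N3 N4; have h4 := two_s_lt.
case: (cells_inter h (V_q 0 _) e) => [/q_idx //|[_ _ h5]|[_ _ h5]]; exfalso.
  by move: h5; apply: q_neq; lia.
by move/esym: h5; apply: q_neq; lia.
Qed.

Lemma cell_corner (i : nat) : cell i (qq (idx i)).
Proof. by rewrite /cell /= -[X in Pi _ X]Psi_q PsiK; exact: V_q. Qed.

Lemma cell_crossings (i : nat) x y :
  crossings (cell_edge i) (Ps (idx i) x) (Ps (idx i) y) =
  map (Ps (idx i)) @` crossings (E m) x y.
Proof.
apply: (crossings_map (g := Pi (idx i))); [exact: PsiK|exact: Psi_invK|].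
by move=> u v; rewrite /cell_edge !PsiK.
Qed.

Lemma cell_walks (i : nat) x :
  walks (cell_edge i) (Ps (idx i) x) = map (Ps (idx i)) @` walks (E m) x.
Proof.
apply: (walks_map (g := Pi (idx i))); [exact: PsiK|exact: Psi_invK|].
by move=> u v; rewrite /cell_edge !PsiK.
Qed.

End Listing.

Definition corner_crossings (m : nat) (i j : int) : set (seq C) :=
  crossings (E m) (qq i) (qq j).
Local Notation K := corner_crossings.

Lemma E_rotE m i x y : E m (qq i * x) (qq i * y) = E m x y.
Proof.
apply/idP/idP => [|h]; last exact: E_rot.
by move=> /(E_rot (- i)); rewrite !mulrA -q_add addNr q0 !mul1r.
Qed.

Lemma E_conjE m x y : E m x^* y^* = E m x y.
Proof. by apply/idP/idP => [/E_conj|/E_conj //]; rewrite !conjcK. Qed.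

Lemma mulqK i : cancel ( *%R (qq i)) ( *%R (qq (- i))).
Proof. by move=> x; rewrite mulrA -q_add addNr q0 mul1r. Qed.

Lemma mulqNK i : cancel ( *%R (qq (- i))) ( *%R (qq i)).
Proof. by move=> x; rewrite mulrA -q_add subrr q0 mul1r. Qed.

Lemma K_rot m i j k : K m (k + i) (k + j) = map ( *%R (qq k)) @` K m i j.
Proof.
rewrite /K !q_add; apply: (@crossings_map C _ _ _ _ _ _ (mulqK k) (mulqNK k)) => x y.
exact: E_rotE.
Qed.

Lemma K_conj m i j : K m (- i) (- j) = map (@conjc R) @` K m i j.
Proof.
rewrite /K !q_conj; apply: (@crossings_map C _ _ _ _ _ _ (@conjcK R) (@conjcK R)) => x y.
exact: E_conjE.
Qed.

Lemma K_fin m i j : finite_set (K m i j).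
Proof. by apply: crossings_fin (V_fin m) _ => x y /E_V[]. Qed.

Lemma walks_E_fin m x : finite_set (walks (E m) x).
Proof. by apply: walks_fin (V_fin m) _ => {}x y /E_V[]. Qed.

Lemma image_bij (f g : C -> C) (S : set C) : cancel f g -> cancel g f ->
  (forall x, S x -> S (f x)) -> (forall x, S x -> S (g x)) -> f @` S = S.
Proof.
move=> fK gK hf hg; apply/seteqP; split=> [_ [x /hf h <-]//|x Sx].
by exists (g x); [exact: hg|exact: gK].
Qed.

Lemma K_isom_rot m i j k : isom (K m i j) (V m) (K m (k + i) (k + j)) (V m).
Proof.
exists ( *%R (qq k)), ( *%R (qq (- k))); split; [exact: mulqK|exact: mulqNK|exact: K_rot|].
rewrite (image_bij (mulqK k) (mulqNK k)) // => x; exact: V_rot.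
Qed.

Lemma K_isom_conj m i j : isom (K m i j) (V m) (K m (- i) (- j)) (V m).
Proof.
exists (@conjc R), (@conjc R); split; [exact: conjcK|exact: conjcK|exact: K_conj|].
by rewrite (image_bij (@conjcK R) (@conjcK R)) // => x; exact: V_conj.
Qed.

(** Rotations and complex conjugation preserve every level, so all crossings between corners at
    index distance s are copies of one another. *)
Lemma KX_isom m i d : d = s%:Z \/ d = - s%:Z ->
  isom (K m 0 s) (V m) (K m i (i + d)) (V m).
Proof.
move=> hd; have h : isom (K m 0 s) (V m) (K m 0 d) (V m).
  case: hd => ->; last by have := K_isom_conj m 0 s; rewrite oppr0.
  by have := K_isom_rot m 0 s 0; rewrite !add0r.
by have := K_isom_rot m 0 d i; rewrite addr0; exact: isom_trans h.
Qed.

Lemma KY_isom m i d : d = s%:Z \/ d = - s%:Z ->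
  isom (K m (- s%:Z) s) (V m) (K m (i - d) (i + d)) (V m).
Proof.
move=> hd; have h : isom (K m (- s%:Z) s) (V m) (K m (- d) d) (V m).
  case: hd => ->; last by have := K_isom_conj m (- s%:Z) s.
  by have := K_isom_rot m (- s%:Z) s 0; rewrite !add0r.
exact: isom_trans h (K_isom_rot m (- d) d i).
Qed.

Section PieceIsoms.
Variables (m : nat) (j0 eps : int).
Hypothesis eps1 : eps = 1 \/ eps = -1.
Local Notation cell := (cell m j0 eps).
Local Notation edge := (cell_edge m j0 eps).
Local Notation jn := (junction j0 eps).
Local Notation ix := (idx j0 eps).

Let eps_s : eps * s%:Z = s%:Z \/ eps * s%:Z = - s%:Z.
Proof. by case: eps1 => ->; rewrite ?mul1r ?mulN1r; [left|right]. Qed.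

Lemma cell_isom i a b : isom (K m a b) (V m)
  (crossings (edge i) (Ps (ix i) (qq a)) (Ps (ix i) (qq b))) (cell i).
Proof.
exists (Ps (ix i)), (Pi (ix i)); split; [exact: PsiK|exact: Psi_invK|exact: cell_crossings|].
apply/seteqP; split=> [x Vx|_ [x Vx <-]]; last by rewrite /cell /= PsiK.
by exists (Pi (ix i) x); rewrite ?Psi_invK.
Qed.

Lemma first_isom : isom (K m 0 s) (V m) (crossings (edge 0%N) (qq j0) (jn 0%N)) (cell 0%N).
Proof.
have {1}-> : qq j0 = Ps (ix 0) (qq (ix 0)) by rewrite Psi_q /idx mulr0 addr0.
exact: isom_trans (KX_isom _ _ eps_s) (cell_isom _ _ _).
Qed.

Lemma last_isom (i : nat) : isom (K m 0 s) (V m)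
  (crossings (edge i.+1) (jn i) (qq (ix i.+1))) (cell i.+1).
Proof.
rewrite -(Psi_q (ix i.+1)) junctionE //; apply: isom_trans (cell_isom _ _ _).
by rewrite -{2}(subrK (eps * s%:Z) (ix i.+1)); exact: KX_isom.
Qed.

Lemma cross_isom (i : nat) : isom (K m (- s%:Z) s) (V m)
  (cross (e := edge) (v := jn) i) (cell i.+1).
Proof.
rewrite /cross {1}junctionE //; exact: isom_trans (KY_isom _ _ eps_s) (cell_isom _ _ _).
Qed.

End PieceIsoms.

(** * Recursion for the crossing weights *)

Section Weights.
Variable beta : R.
Local Notation w := (wt beta).

Lemma wtK_rot m i j k : w (K m (k + i) (k + j)) = w (K m i j).
Proof. by rewrite K_rot wt_map //; exact: can_inj (mulqK k). Qed.

Lemma wtK_conj m i j : w (K m (- i) (- j)) = w (K m i j).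
Proof. by rewrite K_conj wt_map //; exact: can_inj (@conjcK R). Qed.

Lemma wtKa_rot m i j k t :
  w (K m (k + i) (k + j) `&` avoid (qq (k + t))) = w (K m i j `&` avoid (qq t)).
Proof.
have fi := can_inj (mulqK k).
by rewrite K_rot [qq (k + t)]q_add (map_avoid _ _ fi) wt_map.
Qed.

Lemma wtKa_conj m i j t :
  w (K m (- i) (- j) `&` avoid (qq (- t))) = w (K m i j `&` avoid (qq t)).
Proof.
have fi := can_inj (@conjcK R).
by rewrite K_conj q_conj (map_avoid _ _ fi) wt_map.
Qed.

Lemma wtKa_rev m i j t : qq t <> qq i -> qq t <> qq j ->
  w (K m i j `&` avoid (qq t)) = w (K m j i `&` avoid (qq t)).
Proof. by move=> ti tj; apply: wt_crossings_rev => // x y; exact: E_sym. Qed.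

(* The paper's X_m and Y_m, and the parts of them that avoid the boundary vertex
   completing the triangle q_0, q_s, q_(-s): phi_1 and theta_1 when N = 5. *)
Definition X_weight m := w (K m 0 s).
Definition Y_weight m := w (K m (- s%:Z) s).
Definition X_avoid_weight m := w (K m 0 s `&` avoid (qq (- s%:Z))).
Definition Y_avoid_weight m := w (K m (- s%:Z) s `&` avoid (qq 0)).
Definition walks_weight m := w (walks (E m) (qq 0)).
Local Notation X := X_weight.
Local Notation Y := Y_weight.
Local Notation Xa := X_avoid_weight.
Local Notation Ya := Y_avoid_weight.
Local Notation W := walks_weight.

Lemma walks_rot m i : walks (E m) (qq i) = map ( *%R (qq i)) @` walks (E m) (qq 0).
Proof.
rewrite -{1}(addr0 i) q_add; apply: (@walks_map C _ _ _ _ _ (mulqK i) (mulqNK i)) => x y.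
exact: E_rotE.
Qed.

Lemma wt_walks m i : w (walks (E m) (qq i)) = W m.
Proof. by rewrite walks_rot wt_map //; exact: can_inj (mulqK i). Qed.

Section Pieces.
Variables (m : nat) (j0 eps : int).
Hypothesis eps1 : eps = 1 \/ eps = -1.
Local Notation cell := (cell m j0 eps).
Local Notation edge := (cell_edge m j0 eps).
Local Notation jn := (junction j0 eps).
Local Notation ix := (idx j0 eps).
Let H := cell_ringP m j0 eps1.

Let s_facts : (2 * s < N)%N /\ (0 < s)%N.
Proof. by have [? _ _] := sN_bounds N3 N4; split; [exact: two_s_lt|]. Qed.

Let q_s i t : t = s%:Z \/ t = - s%:Z -> qq i <> qq (i + t).
Proof.
have [s2 s0] := s_facts.
by case=> ->; [move/esym|]; apply: q_neq; lia.
Qed.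

Lemma cell_fin (i : nat) : finite_set (cell i).
Proof.
apply: sub_finite_set (finite_image (Ps (ix i)) (V_fin m)) => x Vx.
by exists (Pi (ix i) x) => //; rewrite Psi_invK.
Qed.

Lemma edge_crossings_fin (i : nat) x y : finite_set (crossings (edge i) x y).
Proof. by apply: crossings_fin (cell_fin i) _ => u v /(cr_D H)[]. Qed.

Lemma edge_walks_fin (i : nat) x : finite_set (walks (edge i) x).
Proof. by apply: walks_fin (cell_fin i) _ => u v /(cr_D H)[]. Qed.

Let KX_gen d i : d = s%:Z \/ d = - s%:Z -> w (K m i (i + d)) = X m.
Proof.
rewrite -{1}(addr0 i) wtK_rot => -[] -> //.
by rewrite -{1}oppr0 wtK_conj.
Qed.

Let KXa_gen d i : d = s%:Z \/ d = - s%:Z ->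
  w (K m i (i + d) `&` avoid (qq (i - d))) = Xa m.
Proof.
rewrite -{1}(addr0 i) wtKa_rot => -[] -> //.
by rewrite -{1}oppr0 wtKa_conj.
Qed.

Let eps_s : eps * s%:Z = s%:Z \/ eps * s%:Z = - s%:Z.
Proof. by case: eps1 => ->; rewrite ?mul1r ?mulN1r; [left|right]. Qed.

Let eps_s' : - (eps * s%:Z) = s%:Z \/ - (eps * s%:Z) = - s%:Z.
Proof. by case: eps_s => ->; rewrite ?opprK; [right|left]. Qed.

Let KXa_last i : w (K m (i - eps * s%:Z) i `&` avoid (qq (i + eps * s%:Z))) = Xa m.
Proof.
rewrite wtKa_rev; first by rewrite -[X in avoid (qq (i + X))]opprK KXa_gen.
  have [s2 s0] := s_facts.
  by case: eps_s => ->; [|move/esym]; apply: q_neq; lia.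
exact/nesym/q_s.
Qed.

Let KY i : w (K m (i - eps * s%:Z) (i + eps * s%:Z)) = Y m.
Proof. by rewrite wtK_rot; case: eps_s => -> //; rewrite wtK_conj. Qed.

Let KYa i : w (K m (i - eps * s%:Z) (i + eps * s%:Z) `&` avoid (qq i)) = Ya m.
Proof.
rewrite -[X in avoid (qq X)](addr0 i) wtKa_rot; case: eps_s => -> //.
by rewrite -[X in avoid (qq X)]oppr0 wtKa_conj.
Qed.

Let PsiI i : injective (Ps i). Proof. exact: can_inj (PsiK i). Qed.

Lemma wt_first : w (crossings (edge 0%N) (qq j0) (jn 0%N)) = X m.
Proof.
have {1}-> : qq j0 = Ps (ix 0) (qq (ix 0)) by rewrite Psi_q /idx mulr0 addr0.
by rewrite /junction cell_crossings wt_map // KX_gen.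
Qed.

Let qN1 : qq (ix N.-1.+1) = qq (ix 0).
Proof. by apply/(q_idx j0 eps1); rewrite prednK ?modnn ?mod0n //; lia. Qed.

Lemma wt_first_avoid : w (crossings (edge 0%N) (qq j0) (jn 0%N) `&` avoid (jn N.-1)) = Xa m.
Proof.
have {1}-> : qq j0 = Ps (ix 0) (qq (ix 0)) by rewrite Psi_q /idx mulr0 addr0.
rewrite /(jn 0%N) cell_crossings junctionE // (Psi_eq qN1) (map_avoid _ _ (@PsiI _)) wt_map //.
by rewrite [qq (ix N.-1.+1 - _)]q_add qN1 -q_add KXa_gen.
Qed.

Lemma wt_last (i : nat) : w (crossings (edge i.+1) (jn i) (qq (ix i.+1))) = X m.
Proof.
rewrite -(Psi_q (ix i.+1)) junctionE // cell_crossings wt_map //.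
by rewrite -{2}(subrK (eps * s%:Z) (ix i.+1)) KX_gen.
Qed.

Lemma wt_last_avoid (i : nat) :
  w (crossings (edge i.+1) (jn i) (qq (ix i.+1)) `&` avoid (jn i.+1)) = Xa m.
Proof.
rewrite -(Psi_q (ix i.+1)) junctionE // cell_crossings /(jn i.+1).
by rewrite (map_avoid _ _ (@PsiI _)) wt_map // KXa_last.
Qed.

Lemma wt_cross (i : nat) : w (cross (e := edge) (v := jn) i) = Y m.
Proof.
rewrite /cross {1}junctionE // /(jn i.+1) cell_crossings wt_map //; exact: KY.
Qed.

Lemma wt_cross_avoid (i : nat) :
  w (cross (e := edge) (v := jn) i `&` avoid (qq (ix i.+1))) = Ya m.
Proof.
rewrite /cross {1}junctionE // /(jn i.+1) cell_crossings -[X in avoid X](Psi_q (ix i.+1)).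
by rewrite (map_avoid _ _ (@PsiI _)) wt_map // KYa.
Qed.

Lemma wt_junction_walks (i : nat) : w (walks (edge i.+1) (jn i)) = W m.
Proof. by rewrite junctionE // cell_walks wt_map // wt_walks. Qed.

Lemma wt_corner_walks : w (walks (edge 0%N) (qq j0)) = W m.
Proof.
have {1}-> : qq j0 = Ps (ix 0) (qq (ix 0)) by rewrite Psi_q /idx mulr0 addr0.
by rewrite cell_walks wt_map // wt_walks.
Qed.

(** The joint weight of the two end pieces of an arc through k + 1 cells. If these are all the
    cells, the pieces may not both visit the further vertex they share. *)
Definition ends (k : nat) := if k.+1 == N then Xa m * X m + (X m - Xa m) * Xa m else X m * X m.

Lemma corner0 (j : nat) : cell j (qq j0) -> (j = 0 %[mod N])%N.
Proof.
have -> : qq j0 = qq (ix 0) by rewrite /idx mulr0 addr0.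
exact: corner_cell.
Qed.

Lemma cell0 : cell 0%N (qq j0).
Proof. have -> : qq j0 = qq (ix 0) by rewrite /idx mulr0 addr0.
exact: cell_corner. Qed.

Lemma wt_around_all (k : nat) : (0 < k < N)%N ->
  w (around (e := edge) (v := jn) (qq j0) (qq (ix k)) k `&` [set p | uniq (qq j0 :: p)]) =
  ends k * Y m ^+ k.-1.
Proof.
move=> kN; have k1 : k.-1.+1 = k by case: k kN.
rewrite -[_ `&` [set _ | _]]setIT (wt_around H beta edge_crossings_fin cell0 (@corner0)) //;
  [|exact: setT_stable|by rewrite setIT|by rewrite setIT].
congr (_ * _); last first.
  rewrite (eq_bigr (fun=> Y m)) ?prodr_const_nat ?subn0 // => i _.
  by rewrite setIT wt_cross.
have wl : w (crossings (edge k) (jn k.-1) (qq (ix k))) = X m.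
  by rewrite -[in edge k]k1 -[in ix k]k1 wt_last.
rewrite wl wt_first /ends; case: eqP => // kE.
have fa : w (crossings (edge 0%N) (qq j0) (jn 0%N) `&` avoid (jn k)) = Xa m.
  by rewrite -wt_first_avoid -kE.
by have := wt_last_avoid k.-1; rewrite k1 fa => ->.
Qed.

(** The corner of index t lies in no cell but its own, so at most the piece [cross t.-1] is
    constrained. *)
Lemma wt_around_avoid (k t : nat) : (0 < k < N)%N -> (0 < t < N)%N -> t != k ->
  w (around (e := edge) (v := jn) (qq j0) (qq (ix k)) k `&` [set p | uniq (qq j0 :: p)] `&`
     avoid (qq (ix t))) =
  ends k * \prod_(0 <= j < k.-1) (if j.+1 == t then Ya m else Y m).
Proof.
move=> kN tN tk; have k1 : k.-1.+1 = k by case: k kN {tk}.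
have nD (j : nat) : (j < N)%N -> j != t -> ~ cell j (qq (ix t)).
  by move=> jN jt /(@corner_cell m j0 eps eps1) h; move: jt; rewrite !modn_small in h; lia.
rewrite (wt_around H beta edge_crossings_fin cell0 (@corner0)) //; first last.
- apply: (crossings_avoid H); first by rewrite -{1}k1; case: (cr_v H k.-1).
    by apply: nD; [lia|rewrite eq_sym].
  by move=> h; apply: (nD k); [lia|rewrite eq_sym|rewrite h -{1}k1; case: (cr_v H k.-1)].
- apply: (crossings_avoid H); [exact: cell0|by apply: nD; lia|].
  by move=> h; apply: (nD 0%N); [lia|lia|rewrite h; exact: cell0].
- exact: avoid_stable.
congr (_ * _); last first.
  apply: eq_big_nat => i ik; case: eqP => it; first by rewrite -it wt_cross_avoid.
  rewrite (cross_avoid H); first exact: wt_cross.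
  by apply: nD; [lia|exact/eqP].
have wl : w (crossings (edge k) (jn k.-1) (qq (ix k))) = X m.
  by rewrite -[in edge k]k1 -[in ix k]k1 wt_last.
rewrite wl wt_first /ends; case: eqP => // kE.
have fa : w (crossings (edge 0%N) (qq j0) (jn 0%N) `&` avoid (jn k)) = Xa m.
  by rewrite -wt_first_avoid -kE.
by have := wt_last_avoid k.-1; rewrite k1 fa => ->.
Qed.

End Pieces.

Section Recursion.
Variables (m : nat) (j0 eps : int).
Hypothesis eps1 : eps = 1 \/ eps = -1.

Lemma eps1N : - eps = 1 \/ - eps = -1.
Proof. by case: eps1 => ->; [right|left; rewrite opprK]. Qed.

Let H := cell_ringP m j0 eps1.
Let H' := cell_ringP m j0 eps1N.

Lemma idx_opp (t : nat) : (t <= N)%N -> qq (idx j0 (- eps) (N - t)) = qq (idx j0 eps t).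
Proof.
move=> tN; rewrite /idx !q_add; congr (_ * _); rewrite -subzn // mulrBr q_add.
have -> : qq (- eps * N) = 1.
  by case: eps1 => ->; rewrite ?opprK ?mul1r ?mulN1r ?q_conj q_N // conjc1.
by rewrite mul1r mulNr opprK.
Qed.

Lemma idx00 e : idx j0 e 0 = j0.
Proof. by rewrite /idx mulr0 addr0. Qed.

Lemma cell_opp0 : cell m j0 (- eps) 0%N = cell m j0 eps 0%N.
Proof. by rewrite /cell !idx00. Qed.

Lemma edge_opp0 : cell_edge m j0 (- eps) 0%N = cell_edge m j0 eps 0%N.
Proof. by rewrite /cell_edge !idx00. Qed.

Lemma idx_opp1 : qq (idx j0 (- eps) 1) = qq (idx j0 eps N.-1).
Proof. by rewrite -idx_opp; [congr (qq (idx _ _ _)); lia|lia]. Qed.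

Lemma edge_opp1 : cell_edge m j0 (- eps) 1%N = cell_edge m j0 eps N.-1.
Proof. by rewrite /cell_edge (Psi_inv_eq idx_opp1). Qed.

Lemma junction_opp0 : junction j0 (- eps) 0%N = junction j0 eps N.-1.
Proof.
have e : qq (idx j0 eps N.-1.+1) = qq (idx j0 (- eps) 0).
  have -> : N.-1.+1 = N by lia.
  by rewrite -idx_opp // subnn.
rewrite [RHS]junctionE // /junction -(Psi_eq e); congr (Ps _ _).
by rewrite q_add -e -q_add mulNr.
Qed.

Lemma K_around (k : nat) : (0 < k < N)%N ->
  K m.+1 j0 (idx j0 eps k) =
    (around (e := cell_edge m j0 eps) (v := junction j0 eps) (qq j0) (qq (idx j0 eps k)) k
       `&` [set p | uniq (qq j0 :: p)]) `|`
    (around (e := cell_edge m j0 (- eps)) (v := junction j0 (- eps)) (qq j0)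
       (qq (idx j0 eps k)) (N - k) `&` [set p | uniq (qq j0 :: p)]).
Proof.
move=> kN.
rewrite /K; apply: (crossings_around H H' edge_opp0 edge_opp1 junction_opp0) => //.
- exact: cell0.
- by lia.
- by move=> j; exact: corner_cell.
- by move=> j; rewrite -idx_opp; [apply: corner_cell; exact: eps1N|lia].
Qed.

Lemma around_fin e (k : nat) b : e = 1 \/ e = -1 ->
  finite_set (around (e := cell_edge m j0 e) (v := junction j0 e) (qq j0) b k).
Proof.
move=> e1; apply: catset_fin; first exact: edge_crossings_fin.
by apply: chain_fin => [i|]; exact: edge_crossings_fin.
Qed.

Lemma wtK_around (Q : set (seq C)) (k : nat) : (0 < k < N)%N ->
  w (K m.+1 j0 (idx j0 eps k) `&` Q) =
    w (around (e := cell_edge m j0 eps) (v := junction j0 eps) (qq j0) (qq (idx j0 eps k)) k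
       `&` [set p | uniq (qq j0 :: p)] `&` Q) +
    w (around (e := cell_edge m j0 (- eps)) (v := junction j0 (- eps)) (qq j0)
       (qq (idx j0 eps k)) (N - k) `&` [set p | uniq (qq j0 :: p)] `&` Q).
Proof.
move=> kN; rewrite K_around // setIUl wtU //.
- by do 2!apply: finite_setIl; apply: around_fin.
- by do 2!apply: finite_setIl; apply: around_fin; exact: eps1N.
move=> p [[h1 _] [h2 _]].
have := around_disjoint H H' cell_opp0 edge_opp0 junction_opp0 (a := qq j0)
  (b := qq (idx j0 eps k)) (k := k) (k' := N - k).
move=> /(_ (cell0 _ _ _)); apply.
- by move/(@corner_cell m j0 eps eps1) => h; have := modn_eq_small h; lia.
- by lia.
- by lia.
- by split; [exact: h1|exact: h2].
Qed.

Lemma wtK_S (k : nat) : (0 < k < N)%N ->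
  w (K m.+1 j0 (idx j0 eps k)) =
    ends m k * Y m ^+ k.-1 + ends m (N - k) * Y m ^+ (N - k).-1.
Proof.
move=> kN; rewrite -[K _ _ _]setIT wtK_around // !setIT wt_around_all //.
by rewrite -(idx_opp (t := k)) ?wt_around_all //; [exact: eps1N|lia|lia].
Qed.

(** For 0 < t < k the cell of the corner is an intermediate one of the first arc, where one factor Y
    becomes Ya, and the opposite arc does not meet it. *)
Lemma wtKa_S (k t : nat) : (0 < t < k)%N -> (k < N)%N ->
  w (K m.+1 j0 (idx j0 eps k) `&` avoid (qq (idx j0 eps t))) =
    ends m k * (Y m ^+ k.-2 * Ya m) + ends m (N - k) * Y m ^+ (N - k).-1.
Proof.
move=> tk kN; rewrite wtK_around //; last by lia.
rewrite wt_around_avoid //; [|lia|lia|lia].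
rewrite -(idx_opp (t := k)); last by lia.
rewrite -(idx_opp (t := t)); last by lia.
rewrite wt_around_avoid //; [|exact: eps1N|lia|lia|lia].
congr (_ * _ + _ * _).
  rewrite (big_cat_nat (n := t.-1)) /=; [|lia|lia].
  rewrite (big_ltn (m := t.-1)); last by lia.
  rewrite prednK ?eqxx; last by lia.
  rewrite [X in X * _](eq_big_nat _ _ (F2 := fun=> Y m)); last by move=> i it; case: eqP => //; lia.
  rewrite [X in _ * (_ * X)](eq_big_nat _ _ (F2 := fun=> Y m)); last first.
    by move=> i it; case: eqP => //; lia.
  rewrite !prodr_const_nat mulrCA -exprD mulrC; congr (_ ^+ _ * _); lia.
rewrite (eq_big_nat _ _ (F2 := fun=> Y m)); last by move=> i it; case: eqP => //; lia.
by rewrite prodr_const_nat subn0.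
Qed.

End Recursion.

Let s_pos : (0 < s)%N. Proof. by have [] := sN_bounds N3 N4. Qed.
Let s2N := two_s_lt.

Lemma X_S m : X m.+1 = ends m s * Y m ^+ s.-1 + ends m (N - s) * Y m ^+ (N - s).-1.
Proof.
rewrite -(@wtK_S m 0 1 (or_introl erefl) s); last by have := s2N; lia.
by rewrite /X /idx add0r mul1r.
Qed.

Lemma Y_S m : Y m.+1 =
  ends m (2 * s) * Y m ^+ (2 * s).-1 + ends m (N - 2 * s) * Y m ^+ (N - 2 * s).-1.
Proof.
rewrite -(@wtK_S m (- s%:Z) 1 (or_introl erefl) (2 * s)); last by have := s2N; lia.
by rewrite /Y /idx mul1r; congr (w (K _ _ _)); lia.
Qed.

Lemma Ya_S m : Ya m.+1 =
  ends m (2 * s) * (Y m ^+ (2 * s).-2 * Ya m) + ends m (N - 2 * s) * Y m ^+ (N - 2 * s).-1.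
Proof.
rewrite -(@wtKa_S m (- s%:Z) 1 (or_introl erefl) (2 * s) s); [|lia|have := s2N; lia].
by rewrite /Ya /idx !mul1r addNr; congr (w (K _ _ _ `&` _)); lia.
Qed.

(** The cells are listed clockwise from q_0, so that q_(-s), of index s, comes before q_s, of index
    N - s. *)
Lemma Xa_S m : Xa m.+1 =
  ends m (N - s) * (Y m ^+ (N - s).-2 * Ya m) + ends m s * Y m ^+ s.-1.
Proof.
have sN' : (N - (N - s))%N = s by have := s2N; lia.
have := @wtKa_S m 0 (-1) (or_intror erefl) (N - s) s; rewrite sN' => <-; try by have := s2N; lia.
rewrite /Xa /idx !add0r !mulN1r /K.
have -> : qq (- (N - s)%N%:Z) = qq s.
  have -> : - (N - s)%N%:Z = s%:Z - N%:Z by have := s2N; lia.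
  by rewrite q_add q_conj q_N conjc1 mulr1.
by [].
Qed.

Lemma Y_eq_X m : N = 3%N -> Y m = X m /\ Ya m = Xa m.
Proof.
move=> N3'; have s1 : s = 1%N by rewrite N3'.
have q1 : qq (- (s%:Z + s)) = qq s by rewrite s1; apply: eq_q_mod; rewrite N3'.
have E1 : K m (- 0) (- (s%:Z + s)) = K m 0 s by rewrite oppr0 /K q1.
split; first by rewrite /X -E1 wtK_conj /Y -(wtK_rot _ _ _ s) addrN.
by rewrite /Xa -E1 wtKa_conj /Ya -(wtKa_rot _ _ _ s) addrN addr0.
Qed.

(** * Crossings of the polygon at level 0 *)

Definition trace (j0 eps : int) (n : nat) : seq C :=
  [seq qq (j0 + eps * i.+1%:Z) | i <- iota 0 n].

Lemma traceS j0 eps n : trace j0 eps n.+1 = qq (j0 + eps) :: trace (j0 + eps) eps n.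
Proof.
rewrite /trace /= mulr1; congr (_ :: _).
rewrite -[1%N]/(1 + 0)%N iotaDl -map_comp; apply: eq_map => i /=.
by rewrite -addrA; congr (q _ _ (_ + _)); lia.
Qed.

Lemma last_trace j0 eps n : last (qq j0) (trace j0 eps n) = qq (j0 + eps * n%:Z).
Proof.
elim: n j0 => [|n IH] j0; first by rewrite mulr0 addr0.
by rewrite traceS /= IH; congr (q _ _ _); lia.
Qed.

Lemma trace_path j0 eps n : eps = 1 \/ eps = -1 -> path (E 0) (qq j0) (trace j0 eps n).
Proof.
move=> e1; elim: n j0 => // n IH j0; rewrite traceS /= IH andbT.
by apply/asboolP; exists j0; split=> //; case: e1 => ->; [left|right].
Qed.

Lemma trace_uniq j0 eps n : eps = 1 \/ eps = -1 -> (n < N)%N -> uniq (qq j0 :: trace j0 eps n).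
Proof.
move=> e1 nN.
have -> : qq j0 :: trace j0 eps n = [seq qq (idx j0 eps i) | i <- iota 0 n.+1].
  rewrite /trace /= {1}/idx mulr0 addr0; congr (_ :: _).
  by rewrite -[1%N]/(1 + 0)%N iotaDl -map_comp.
rewrite map_inj_in_uniq ?iota_uniq // => i k; rewrite !mem_iota => hi hk /(q_idx j0 e1).
by rewrite !modn_small; lia.
Qed.

(** The uniqueness hypothesis includes the vertex before q_j0, so the walk cannot turn back and
    keeps its direction. *)
Lemma path_trace j0 eps p : eps = 1 \/ eps = -1 -> path (E 0) (qq j0) p ->
  uniq [:: qq (j0 - eps), qq j0 & p] -> p = trace j0 eps (size p).
Proof.
move=> e1; elim: p j0 => // y p IH j0 /=; rewrite -/(E 0 _ _) => /andP[/asboolP[j [hj hy]] pp] up.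
have {hy} [hy|hy] : y = qq (j0 + eps) \/ y = qq (j0 - eps).
  rewrite !q_add hj -!q_add.
  by case: e1 hy => -> [] ->; rewrite ?opprK; auto.
  rewrite traceS -hy; congr (_ :: _); apply: IH; rewrite -?hy ?addrK //.
  by move: up; rewrite hy => /andP[_].
by move: up; rewrite hy !inE eqxx /= orbT.
Qed.

Lemma trace_mem j0 eps n x : x \in trace j0 eps n ->
  exists2 i : nat, (i < n)%N & x = qq (j0 + eps * i.+1%:Z).
Proof.
elim: n j0 => // n IH j0; rewrite traceS inE => /orP[/eqP->|/IH[i hi ->]].
  by exists 0%N; rewrite ?mulr1.
by exists i.+1 => //; congr (q _ _ _); lia.
Qed.

Lemma K0 (k : nat) j0 : (0 < k < N)%N ->
  K 0 j0 (j0 + k%:Z) = [set trace j0 1 k] `|` [set trace j0 (-1) (N - k)].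
Proof.
move=> kN; have o1 : (1 : int) = 1 \/ (1 : int) = -1 by left.
have o2 : (-1 : int) = 1 \/ (-1 : int) = -1 by right.
apply/seteqP; split=> p; last first.
  move=> [|] ->; split.
  - exact: trace_path.
  - by apply: trace_uniq => //; lia.
  - by rewrite last_trace mul1r.
  - exact: trace_path.
  - by apply: trace_uniq => //; lia.
  rewrite last_trace; have -> : j0 + -1 * (N - k)%N%:Z = j0 + k%:Z - N%:Z by lia.
  by rewrite q_add q_conj q_N conjc1 mulr1.
move=> [pp up lp].
have [eps [e1 ep]] : exists eps, (eps = 1 \/ eps = -1) /\ p = trace j0 eps (size p).
  case: p pp up lp => [|y p] /=.
    by move=> _ _ h; exists 1; split; [left|].
  rewrite -/(E 0 _ _) => /andP[/asboolP[j [hj hy]] pp] up lp.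
  have [eps [e1 ey]] : exists eps, (eps = 1 \/ eps = -1) /\ y = qq (j0 + eps).
    by case: hy => ->; [exists 1|exists (-1)]; rewrite [qq (j0 + _)]q_add hj -q_add; split.
  exists eps; split=> //; rewrite traceS -ey; congr (_ :: _); apply: path_trace => //.
    by rewrite -ey.
  by rewrite addrK -ey.
(* A longer walk would return to its start after N steps. *)
have nN : (size p < N)%N.
  rewrite ltnNge; apply/negP => Nn; move: up; rewrite ep cons_uniq => /andP[/negP h _]; apply: h.
  apply/mapP; exists N.-1; first by rewrite mem_iota; lia.
  have -> : N.-1.+1 = N by lia.
  by rewrite q_add; case: e1 => ->; rewrite ?mul1r ?mulN1r ?q_conj q_N ?conjc1 mulr1.
have {lp} : qq (j0 + eps * (size p)%:Z) = qq (j0 + k%:Z) by rewrite -last_trace -ep.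
case: e1 ep => -> ep h; [left|right]; rewrite /= {1}ep; congr trace.
  have := h; rewrite mul1r !q_add => /(mulfI (q_neq0 j0)) /eq_q_nat.
  by rewrite !modn_small; lia.
have : qq (size p) = qq (N - k)%N.
  have := h; rewrite mulN1r !q_add q_conj => /(mulfI (q_neq0 j0)) h'.
  have -> : ((N - k)%N : int) = N%:Z - k%:Z by lia.
  by rewrite q_add q_N mul1r q_conj -h' conjcK.
by move/eq_q_nat; rewrite !modn_small; lia.
Qed.

Lemma size_trace j0 eps n : size (trace j0 eps n) = n.
Proof. by rewrite size_map size_iota. Qed.

Lemma wtK0 (k : nat) j0 : (0 < k < N)%N ->
  w (K 0 j0 (j0 + k%:Z)) = expR (- beta) ^+ k + expR (- beta) ^+ (N - k).
Proof.
move=> kN; rewrite K0 // wtU //.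
  by rewrite !wt_set1 !size_trace !expRM_natr.
move=> p [-> ]; move=> /(congr1 (head 0)).
have -> : k = k.-1.+1 by lia.
have -> : (N - k.-1.+1)%N = (N - k.-1.+1).-1.+1 by lia.
by rewrite !traceS /=; apply: q_neq; lia.
Qed.

Lemma X_0 : X 0 = expR (- beta) ^+ s + expR (- beta) ^+ (N - s).
Proof. by rewrite -(wtK0 0) ?add0r //; have := s2N; lia. Qed.

Lemma Y_0 : Y 0 = expR (- beta) ^+ (2 * s) + expR (- beta) ^+ (N - 2 * s).
Proof.
rewrite -(wtK0 (- s%:Z)); last by have := s2N; lia.
by rewrite /Y; congr (w (K _ _ _)); lia.
Qed.

(** The shorter way from q_0 to q_s does not pass q_(-s). *)
Lemma Xa_0 : expR (- beta) ^+ s <= Xa 0.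
Proof.
have -> : expR (- beta) ^+ s = w [set trace 0 1 s] by rewrite wt_set1 size_trace expRM_natr.
apply: le_wt; first by apply: finite_setIl; exact: K_fin.
have sN0 : (0 < s < N)%N by have := s2N; lia.
have e : K 0 0 s = K 0 0 (0 + s%:Z) by rewrite add0r.
move=> _ ->; split; first by rewrite e K0 //; left.
apply/negP => /(@trace_mem)[i hi].
by rewrite add0r mul1r => /esym; apply: q_neq; have := s2N; lia.
Qed.

Lemma Ya_0 : expR (- beta) ^+ (N - 2 * s) <= Ya 0.
Proof.
have -> : expR (- beta) ^+ (N - 2 * s) = w [set trace (- s%:Z) (-1) (N - 2 * s)].
  by rewrite wt_set1 size_trace expRM_natr.
apply: le_wt; first by apply: finite_setIl; exact: K_fin.
have sN0 : (0 < 2 * s < N)%N by have := s2N; lia.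
move=> _ ->; split.
  have -> : K 0 (- s%:Z) s = K 0 (- s%:Z) (- s%:Z + (2 * s)%N) by congr (K _ _ _); lia.
  by rewrite K0 //; right.
apply/negP => /(@trace_mem)[i hi].
by rewrite mulN1r; apply: q_neq; have := s2N; lia.
Qed.

Lemma W_S m : W m.+1 <= W m * (1 + 2 * X m * \sum_(i < N) Y m ^+ i).
Proof.
have o1 : (1 : int) = 1 \/ (1 : int) = -1 by left.
have o2 := eps1N o1.
have jq e : e = 1 \/ e = -1 -> qq 0 <> junction 0 e 0%N.
  move=> e1 h; have [_] := cr_v (cell_ringP m 0 e1) 0; rewrite -h => /(@corner0 m 0 e e1).
  by rewrite !modn_small; lia.
apply: (wt_walks_le (cell_ringP m 0 o1) (cell_ringP m 0 o2) (edge_opp0 m 0 1)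
  (edge_opp1 m 0 o1) (junction_opp0 0 o1)).
- exact: cell0.
- exact: edge_crossings_fin.
- exact: edge_crossings_fin.
- exact: edge_walks_fin.
- exact: edge_walks_fin.
- exact: walks_E_fin.
- exact: jq.
- exact: jq.
- exact: wt_corner_walks.
- exact: wt_first.
- exact: wt_first.
- exact: wt_cross.
- exact: wt_cross.
- exact: wt_junction_walks.
- exact: wt_junction_walks.
Qed.

(** On either arc a crossing contains full crossings of its two end cells, so the minimal length at
    least doubles. *)
Lemma K_around_size m j0 eps (k L : nat) p : eps = 1 \/ eps = -1 -> (0 < k < N)%N ->
    (forall p, K m 0 s p -> (L <= size p)%N) ->
  K m.+1 j0 (idx j0 eps k) p -> (L + L <= size p)%N.
Proof.
move=> e1 kN hL; rewrite K_around //.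
have step e n b : e = 1 \/ e = -1 -> (0 < n)%N -> qq b = qq (idx j0 e n) ->
    around (e := cell_edge m j0 e) (v := junction j0 e) (qq j0) (qq b) n p -> (L + L <= size p)%N.
  move=> e1' n0 ->; apply: around_size => // q.
    by apply: (isom_size (first_isom m j0 e1')) => //.
  by have := isom_size (last_isom m j0 e1' n.-1) hL; rewrite prednK //; apply.
case=> -[h _]; first by apply: (step _ _ _ e1 _ erefl h); lia.
by apply: (step _ _ _ (eps1N e1) _ _ h); rewrite ?idx_opp //; lia.
Qed.

Lemma K_size m p : K m 0 s p \/ K m (- s%:Z) s p -> (m < size p)%N.
Proof.
have s2N' := s2N; have o1 : (1 : int) = 1 \/ (1 : int) = -1 by left.
have eY : idx (- s%:Z) 1 (2 * s) = s by rewrite /idx mul1r; lia.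
have eX : idx 0 1 s = s by rewrite /idx mul1r add0r.
elim: m p => [|m IH] p.
  case=> -[_ _]; case: p => //= /esym h; exfalso; move: h; first by apply: q_neq; lia.
  by apply: q_neq; lia.
have hX q : K m 0 s q -> (m.+1 <= size q)%N by move=> h; apply: IH; left.
case=> h; apply: (@leq_trans (m.+1 + m.+1)); rewrite ?addSn ?ltnS ?leq_addl //; last first.
- by apply: (K_around_size (j0 := - s%:Z) o1 (k := 2 * s) _ hX); rewrite ?eY //; lia.
- by apply: (K_around_size (j0 := 0) o1 (k := s) _ hX); rewrite ?eX //; lia.
Qed.

(** For each of the two crossings an arc of fewer than N cells is chosen, on which every
    concatenation is self-avoiding. *)
Lemma expands_K kappa m l : expands kappa beta (K m 0 s) (V m) l ->
    expands kappa beta (K m (- s%:Z) s) (V m) l ->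
  expands kappa beta (K m.+1 0 s) (V m.+1) (l + l) /\
  expands kappa beta (K m.+1 (- s%:Z) s) (V m.+1) (l + l).
Proof.
move=> hX hY; have s2N' := s2N.
have step j0 eps k : eps = 1 \/ eps = -1 -> (0 < k)%N -> (k.+1 < N)%N ->
    expands kappa beta (K m.+1 j0 (idx j0 eps k)) (V m.+1) (l + l).
  move=> e1 k0 kN.
  have h := expands_around (cell_ringP m j0 e1) (kappa := kappa) (beta := beta)
    (b := qq (idx j0 eps k)) (l := l) k0 kN (cell0 m j0 eps) (@edge_crossings_fin m j0 eps e1)
    (fun j => isom_expands (cross_isom m j0 e1 j) hY) (isom_expands (first_isom m j0 e1) hX).
  have hl : expands kappa beta (crossings (cell_edge m j0 eps k) (junction j0 eps k.-1)
      (qq (idx j0 eps k))) (cell m j0 eps k) l.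
    by have := isom_expands (last_isom m j0 e1 k.-1) hX; rewrite prednK.
  apply: (expands_sub (h hl)) => //.
  - rewrite K_around //; last by lia.
    move=> p hp; left; split=> //.
    by apply: (around_lt_uniq (cell_ringP m j0 e1) k0 kN _ hp); exact: cell0.
  - exact: K_fin.
  - by move=> x [i Vx]; exists (idx j0 eps i).
split.
  have := step 0 1 s (or_introl erefl); rewrite /idx mul1r add0r; apply; lia.
(* The clockwise arc: the anticlockwise one has 2 s + 1 cells, which are all of them for N = 3,
   5. *)
have := step (- s%:Z) (-1) (N - 2 * s)%N (or_intror erefl).
rewrite /idx mulN1r /K.
have -> : qq (- s%:Z - (N - 2 * s)%N%:Z) = qq s.
  have -> : - s%:Z - (N - 2 * s)%N%:Z = s%:Z - N%:Z by lia.
  by rewrite q_add q_conj q_N conjc1 mulr1.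
apply; lia.
Qed.

End Weights.

End Geometry.

(** * Walks in the rescaled graphs *)

Section Rescaling.
Local Open Scope complex_scope.
Context {R : realType}.
Variable N : nat.
Hypotheses (N3 : (3 <= N)%N) (N4 : ~~ (4 %| N)%N).
Local Notation s := (sN N).
Local Notation C := R[i].
Local Notation qq := (q R N).
Local Notation Ps := (@Psi R N).
Local Notation Pi := (@Psi_inv R N).
Local Notation E := (@level_adj R N).
Local Notation V := (@level_vert R N).

(** F_m is the level-m graph of the unit cell blown up by [unscale]; walks are studied before the
    blow-up. *)
Definition scale m : C -> C := iter m (Ps 0).
Definition unscale m : C -> C := iter m (Pi 0).

Lemma scaleK m : cancel (scale m) (unscale m).
Proof.
elim: m => // m IH x; rewrite /scale /unscale iterSr iterS -/(scale m _) -/(unscale m _).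
by rewrite PsiK // IH.
Qed.

Lemma unscaleK m : cancel (unscale m) (scale m).
Proof.
elim: m => // m IH x; rewrite /scale /unscale iterSr iterS -/(scale m _) -/(unscale m _).
by rewrite Psi_invK // IH.
Qed.

Lemma E_word m x y : E m x y <->
  exists w : m.-tuple 'I_N, exists u v, [/\ adj (F0 R N) u v, Psi_word w u = x & Psi_word w v = y].
Proof.
elim: m x y => [|m IH] x y.
  split=> [/asboolP h|[w [u [v [h]]]]]; first by exists [tuple], x, y.
  by rewrite (tuple0 w) /= => <- <-; apply/asboolP.
rewrite E_S; split=> [[i /IH[w [u [v [h hu hv]]]]]|].
  have [k hk] := int_mod_ord N3 N4 i (R := R).
  exists [tuple of k :: w], u, v; split=> //=; rewrite ?hu ?hv -(Psi_eq hk) Psi_invK //.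
move=> [w [u [v [h hu hv]]]]; case/tupleP: w hu hv => k w /= hu hv.
by exists (k : nat); apply/IH; exists w, u, v; split=> //; rewrite -?hu -?hv PsiK.
Qed.

Lemma adj_F m x y : adj (F R N m) x y <-> E m (scale m x) (scale m y).
Proof.
rewrite E_word; split=> [[w [u [v [h <- <-]]]]|[w [u [v [h hu hv]]]]].
  by exists w, u, v; split=> //=; rewrite unscaleK.
exists w, u, v; split=> //; first by rewrite -[RHS](scaleK m) -hu.
by rewrite -[RHS](scaleK m) -hv.
Qed.

Lemma V_word m x : V m x <->
  exists w : m.-tuple 'I_N, exists2 u, range qq u & Psi_word w u = x.
Proof.
elim: m x => [|m IH] x.
  split=> [h|[w [u h]]]; first by exists [tuple], x.
  by rewrite (tuple0 w) /= => <-.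
split=> [[i /IH[w [u h hu]]]|].
  have [k hk] := int_mod_ord N3 N4 i (R := R).
  exists [tuple of k :: w], u => //=; by rewrite hu -(Psi_eq hk) Psi_invK.
move=> [w [u h hu]]; case/tupleP: w hu => k w /= hu.
by exists (k : nat); apply/IH; exists w, u => //; rewrite -hu PsiK.
Qed.

Lemma vert_F m x : vert (F R N m) x <-> V m (scale m x).
Proof.
rewrite V_word; split=> [[w _ [u h <-]]|[w [u h hu]]].
  by exists w, u => //=; rewrite unscaleK.
by exists w => //; exists u => //=; rewrite -[RHS](scaleK m) -hu.
Qed.

Lemma saw_walks m a p : V m (scale m a) ->
  saw (F R N m) a p <-> walks (E m) (scale m a) (map (scale m) p).
Proof.
move=> Va; have si := can_inj (scaleK m).
have pE b r : path (fun x y => `[< adj (F R N m) x y >]) b r =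
    path (E m) (scale m b) (map (scale m) r).
  elim: r b => //= y r IH b; rewrite IH; congr (_ && _).
  by apply/asboolP/idP => /adj_F.
split=> [[_ pp up]|[pp up]]; split; rewrite ?pE //.
- by rewrite -pE.
- by rewrite -map_cons map_inj_uniq.
- move=> x xp; apply/vert_F; move: pp Va; move: (xp); rewrite -(mem_map si) /=.
  elim: p (a) {xp up} => [|y p IH] b /=; first by rewrite inE => /eqP->.
  rewrite in_cons => /orP[/eqP->//|xp] /andP[/E_V[_ Vy] pp] _; exact: (IH y xp pp Vy).
- by move: up; rewrite -map_cons map_inj_uniq.
Qed.

Lemma scale_bdry m j : scale m (bdry R N m j) = qq j.
Proof. exact: unscaleK. Qed.

Lemma bdry0 m : bdry R N m 0 = qq 0.
Proof.
elim: m => // m IH; rewrite /bdry /= -/(bdry R N m 0) IH.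
by rewrite -{1}(Psi_q N 0) PsiK.
Qed.

Lemma Z_eq_wt m a b (P : seq C -> Prop) (Q : set (seq C)) beta :
    (forall p, P (bdry R N m a :: p) <-> Q (map (scale m) p)) ->
  Z N m (bdry R N m a) (bdry R N m b) P beta = wt beta (@corner_crossings R N m a b `&` Q).
Proof.
move=> PQ; rewrite /Z -/(wt beta _); have si := can_inj (scaleK m).
rewrite -[RHS](wt_map beta _ (can_inj (unscaleK m))); congr wt.
have Va : V m (scale m (bdry R N m a)) by rewrite scale_bdry; exact: V_q.
apply/seteqP; split=> p.
  move=> [/(saw_walks _ Va) [pp up] lp /PQ Pp].
  exists (map (scale m) p); last exact: mapK (scaleK m) p.
  split=> //; rewrite scale_bdry in pp up; split=> //.
  by rewrite -(scale_bdry m a) last_map lp scale_bdry.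
move=> [r [[pp up lp] Qr] <-]; have rE : map (scale m) (map (unscale m) r) = r.
  exact: mapK (unscaleK m) r.
split.
- by apply/(saw_walks _ Va); rewrite scale_bdry rE.
- by apply: si; rewrite scale_bdry -last_map rE scale_bdry.
- by apply/PQ; rewrite rE.
Qed.

Lemma bdry_mem m t a p : qq t <> qq a ->
  (bdry R N m t \in bdry R N m a :: p) = (qq t \in map (scale m) p).
Proof.
move=> ta; have si := can_inj (scaleK m).
rewrite -(mem_map si) map_cons !scale_bdry inE.
by rewrite (introF eqP ta).
Qed.

Lemma Z_all m a b beta :
  Z N m (bdry R N m a) (bdry R N m b) (fun=> True) beta = wt beta (@corner_crossings R N m a b).
Proof. by rewrite -[corner_crossings N m a b]setIT; apply: Z_eq_wt. Qed.

Lemma Z_avoid m a b t beta : qq t <> qq a ->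
  Z N m (bdry R N m a) (bdry R N m b) (fun w => bdry R N m t \notin w) beta =
  wt beta (@corner_crossings R N m a b `&` avoid (qq t)).
Proof. by move=> ta; apply: Z_eq_wt => p; rewrite bdry_mem. Qed.

Lemma Z_visit m a b t beta : qq t <> qq a ->
  Z N m (bdry R N m a) (bdry R N m b) (fun w => bdry R N m t \in w) beta =
  wt beta (@corner_crossings R N m a b) - wt beta (@corner_crossings R N m a b `&` avoid (qq t)).
Proof.
move=> ta; rewrite (@Z_eq_wt m a b _ (~` avoid (qq t))).
  by rewrite [in RHS](wt_split beta (avoid (qq t)) (K_fin N3 N4 m a b)) addrAC subrr add0r.
by move=> p; rewrite bdry_mem // /avoid /setC /=; split=> [-> //|/negP]; rewrite negbK.
Qed.

Lemma adj_F_S m x y : adj (F R N m) x y -> adj (F R N m.+1) x y.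
Proof.
move=> /adj_F h; apply/adj_F/E_S; exists 0.
by rewrite /scale iterS PsiK // PsiK.
Qed.

Lemma adj_F_le m n x y : (m <= n)%N -> adj (F R N m) x y -> adj (F R N n) x y.
Proof.
move=> /subnKC <-; elim: (n - m)%N => [|k IH]; first by rewrite addn0.
by rewrite addnS => /IH/adj_F_S.
Qed.

Definition root_walks m n : set (seq C) :=
  [set p | walks (E m) (qq 0) p /\ size p = n].

Definition root_saws n : set (seq C) := [set p | saw (Finf R N) (qq 0) p /\ size p = n].

Definition root_saws_in m n : set (seq C) := [set p | saw (F R N m) (qq 0) p /\ size p = n].

Lemma scale_root m : scale m (qq 0) = qq 0.
Proof. by rewrite -{1}(bdry0 m) scale_bdry. Qed.

Lemma V_root m : V m (scale m (qq 0)).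
Proof. by rewrite scale_root; exact: V_q. Qed.

Lemma root_saws_inE m n : root_saws_in m n = map (unscale m) @` root_walks m n.
Proof.
apply/seteqP; split=> p.
  move=> [/(saw_walks _ (V_root m)) wp sp]; exists (map (scale m) p); last exact: mapK (scaleK m) p.
  by rewrite scale_root in wp; split; rewrite ?size_map.
move=> [r [wr sr] <-]; split; last by rewrite size_map.
by apply/(saw_walks _ (V_root m)); rewrite scale_root (mapK (unscaleK m)).
Qed.

Lemma root_walks_fin m n : finite_set (root_walks m n).
Proof. by apply: sub_finite_set (walks_E_fin N3 N4 m (qq 0)) => p []. Qed.

Lemma root_saws_in_fin m n : finite_set (root_saws_in m n).
Proof. rewrite root_saws_inE; exact/finite_image/root_walks_fin. Qed.

Lemma cnt_root_saws_in m n : cnt (R := R) (root_saws_in m n) = cnt (root_walks m n).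
Proof. by rewrite root_saws_inE cnt_image //; exact/inj_map/(can_inj (unscaleK m)). Qed.

Lemma root_saws_in_mono m m' n : (m <= m')%N -> root_saws_in m n `<=` root_saws_in m' n.
Proof.
move=> mm p [[vp pp up] sp]; split=> //; split=> //.
  move=> x /vp; rewrite !vert_F => Vx.
  rewrite -(subnKC mm); elim: (m' - m)%N => [|k IH]; rewrite ?addn0 // addnS.
  by exists 0; rewrite /scale iterS PsiK.
apply: sub_path pp => x y /asboolP h; apply/asboolP; exact: adj_F_le h.
Qed.

(** A walk has finitely many edges and the graphs F_m increase, so one of them contains it. *)
Lemma root_saws_bigcup n : root_saws n = \bigcup_m root_saws_in m n.
Proof.
apply/seteqP; split=> p; last first.
  move=> [m _ [[vp pp up] sp]]; split=> //; split=> //.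
    by move=> x /vp h; exists m.
  by apply: sub_path pp => x y /asboolP h; apply/asboolP; exists m.
move=> [[vp pp up] sp].
have [m hm] : exists m, path (fun x y => `[< adj (F R N m) x y >]) (qq 0) p.
  elim: p (qq 0) pp {vp up sp} => [|y p IH] x /=; first by exists 0%N.
  move=> /andP[/asboolP[m1 h1] /IH[m2 h2]]; exists (maxn m1 m2); apply/andP; split.
    by apply/asboolP; apply: adj_F_le h1; exact: leq_maxl.
  by apply: sub_path h2 => u v /asboolP h; apply/asboolP; apply: adj_F_le h; exact: leq_maxr.
exists m => //; split=> //; apply/(saw_walks _ (V_root m)).
split; last by rewrite -map_cons map_inj_uniq //; exact: can_inj (scaleK m).
elim: p (qq 0) hm {vp pp up sp} => //= y p IH x /andP[/asboolP/adj_F-> h]; exact: IH.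
Qed.

Lemma pref_root_walks m n b : pref n (crossings (E m) (qq 0) b) `<=` root_walks m n.
Proof.
move=> _ [p [[pp up _] np] <-]; split; last exact: size_takel.
split; first by move: pp; rewrite -{1}(cat_take_drop n p) cat_path => /andP[].
by move: up; rewrite -{1}(cat_take_drop n p) -cat_cons cat_uniq => /andP[].
Qed.

(** Finiteness belongs to the conclusion because [fset_set] of an infinite set is empty, which would
    make the count 0. An infinite set of walks would have a finite subset of more than c elements,
    and every finite subset lies in a single F_m. *)
Lemma saw_count_ub (c : R) n :
  (forall m, cnt (root_walks m n) <= c) ->
  finite_set (root_saws n) /\ (saw_count R N n)%:R <= c.
Proof.
move=> h; have sub (X : {fset seq C}) : [set` X] `<=` root_saws n -> (#|` X|%fset)%:R <= c.
  move=> XS; have [m hm] : exists m, [set` X] `<=` root_saws_in m n.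
    have [m hm] : exists m, forall x, x \in (X : seq _) -> root_saws_in m n x.
      have : forall x, x \in (X : seq _) -> root_saws n x by move=> x xX; apply: XS.
      elim: (X : seq _) => [|x t IH] hx; first by exists 0%N.
      have [m1 h1] := IH (fun y yt => hx y (mem_behead (s := x :: t) yt)).
      have := hx x (mem_head _ _); rewrite root_saws_bigcup => -[m2 _ h2].
      exists (maxn m1 m2) => y; rewrite inE => /orP[/eqP->|/h1].
        by apply: root_saws_in_mono h2; exact: leq_maxr.
      by apply: root_saws_in_mono; exact: leq_maxl.
    by exists m => x /= xX; apply: hm.
  apply: le_trans (h m); rewrite -cnt_root_saws_in.
  rewrite (_ : (#|` X|)%:R = cnt [set` X]); last by rewrite cntE ?set_fsetK.
  by apply: le_wt => //; exact: root_saws_in_fin.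
have fin : finite_set (root_saws n).
  apply: contrapT => /infinite_set_fset; move=> /(_ (Num.truncn c).+1)[X XS cX].
  have := sub X XS; rewrite leNgt => /negP; apply.
  apply: lt_le_trans (truncnS_gt c) _; by rewrite ler_nat.
split=> //; apply: sub; rewrite fset_setK //.
Qed.

Lemma saw_count_lb (c : R) n m : finite_set (root_saws n) ->
  c <= cnt (pref n (@corner_crossings R N m 0 s)) -> c <= (saw_count R N n)%:R.
Proof.
move=> fin h; apply: (le_trans h); rewrite -[X in _ <= X](cntE fin).
apply: le_trans (_ : cnt (root_walks m n) <= _).
  by apply: le_wt; [exact: root_walks_fin|exact: pref_root_walks].
rewrite -cnt_root_saws_in; apply: le_wt => // p hp; rewrite root_saws_bigcup.
by exists m.
Qed.

Lemma cnt_root_walks_W beta m n :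
  cnt (root_walks m n) <= expR (beta * n%:R) * @walks_weight R N beta m.
Proof.
rewrite mulrC -ler_pdivrMr ?expR_gt0 // -expRN -mulNr.
have fr := root_walks_fin m n.
have -> : cnt (root_walks m n) * expR (- beta * n%:R) = wt beta (root_walks m n).
  rewrite /cnt !wt_fset // mulr_suml big_seq [RHS]big_seq; apply: eq_bigr => p.
  by rewrite in_fset_set // inE => -[_ ->]; rewrite oppr0 mul0r expR0 mul1r.
by apply: le_wt => [|p []//]; exact: walks_E_fin.
Qed.

End Rescaling.

(** * Growth of the crossing vector *)

Section PolynomialRecursion.
Context {S : comNzRingType}.
Variable N : nat.
Local Notation s := (sN N).

(** The recursion is written over any commutative ring, to be read both for real weights and for
    polynomial variables; evaluation is a morphism between the two. *)
Definition ends_poly (x xa : S) (k : nat) := if k.+1 == N then xa * x + (x - xa) * xa else x * x.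
Definition X_poly (x xa y : S) :=
  ends_poly x xa s * y ^+ s.-1 + ends_poly x xa (N - s) * y ^+ (N - s).-1.
Definition Y_poly (x xa y : S) :=
  ends_poly x xa (2 * s) * y ^+ (2 * s).-1 + ends_poly x xa (N - 2 * s) * y ^+ (N - 2 * s).-1.
Definition Xa_poly (x xa y ya : S) :=
  ends_poly x xa (N - s) * (y ^+ (N - s).-2 * ya) + ends_poly x xa s * y ^+ s.-1.
Definition Ya_poly (x xa y ya : S) :=
  ends_poly x xa (2 * s) * (y ^+ (2 * s).-2 * ya) +
  ends_poly x xa (N - 2 * s) * y ^+ (N - 2 * s).-1.
End PolynomialRecursion.

Section PolynomialMorphism.
Context {S S' : comNzRingType}.
Variables (N : nat) (f : {rmorphism S -> S'}).

Lemma ends_polyM x xa k : f (ends_poly N x xa k) = ends_poly N (f x) (f xa) k.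
Proof. by rewrite /ends_poly; case: eqP => _; rewrite ?rmorphD ?rmorphB !rmorphM ?rmorphB. Qed.

Lemma X_polyM x xa y : f (X_poly N x xa y) = X_poly N (f x) (f xa) (f y).
Proof. by rewrite /X_poly rmorphD !rmorphM !rmorphXn !ends_polyM. Qed.

Lemma Y_polyM x xa y : f (Y_poly N x xa y) = Y_poly N (f x) (f xa) (f y).
Proof. by rewrite /Y_poly rmorphD !rmorphM !rmorphXn !ends_polyM. Qed.

Lemma Xa_polyM x xa y ya : f (Xa_poly N x xa y ya) = Xa_poly N (f x) (f xa) (f y) (f ya).
Proof. by rewrite /Xa_poly rmorphD !rmorphM !rmorphXn !ends_polyM. Qed.

Lemma Ya_polyM x xa y ya : f (Ya_poly N x xa y ya) = Ya_poly N (f x) (f xa) (f y) (f ya).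
Proof. by rewrite /Ya_poly rmorphD !rmorphM !rmorphXn !ends_polyM. Qed.
End PolynomialMorphism.

Section Crossing.
Import (canonicals) mpoly.
Context {R : realType}.
Variable N : nat.
Hypotheses (N3 : (3 <= N)%N) (N4 : ~~ (4 %| N)%N).
Local Notation s := (sN N).
Local Notation qq := (q R N).
Local Notation X := (@X_weight R N).
Local Notation Y := (@Y_weight R N).
Local Notation Xa := (@X_avoid_weight R N).
Local Notation Ya := (@Y_avoid_weight R N).

Lemma ends_polyE beta m k : ends N beta m k = ends_poly N (X beta m) (Xa beta m) k.
Proof. by []. Qed.

Lemma sN_3 : N = 3%N -> s = 1%N. Proof. by move->. Qed.
Lemma sN_5 : N = 5%N -> s = 2%N. Proof. by move->. Qed.

(** Apart from N = 3, 5, none of the four arcs uses all N cells, so X and Y alone form a closed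
    system. *)
Lemma ends_generic k (x xa : R) : N != 3%N -> N != 5%N ->
  k = s \/ k = (N - s)%N \/ k = (2 * s)%N \/ k = (N - 2 * s)%N -> ends_poly N x xa k = x * x.
Proof.
move=> h3 h5 hk; rewrite /ends_poly; case: eqP => // e; exfalso.
have [h1 h2 h6] := sN_bounds N3 N4; have h7 := two_s_lt N3 N4; move: h3 h5 => /eqP h3 /eqP h5.
by lia.
Qed.

Lemma crossing_seqE beta m : crossing_seq N m beta =
  if N == 3%N then [:: Xa beta m; X beta m - Xa beta m]
  else if N == 5%N then
    [:: Xa beta m; X beta m - Xa beta m; Ya beta m; Y beta m - Ya beta m]
  else [:: X beta m; Y beta m].
Proof.
have [h1 h2 h6] := sN_bounds N3 N4; have h7 := two_s_lt N3 N4.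
have n1 : qq (- s%:Z) <> qq 0 by apply/nesym/(q_neq N3 N4); lia.
have n2 : qq 0 <> qq (- s%:Z) by apply/nesym.
rewrite /crossing_seq; case: eqP => [e3|_].
  have -> : (1 : int) = s by rewrite sN_3.
  by rewrite Z_avoid // Z_visit.
case: eqP => [e5|_]; last by rewrite !Z_all.
have -> : (2 : int) = s by rewrite sN_5.
by rewrite !Z_avoid // !Z_visit.
Qed.

Local Notation var i := (@mpoly.mpolyX (crossing_dim N) R (mpoly.mnm1 i)).

Lemma crossing_recursion : exists P : 'I_(crossing_dim N) -> mpoly.mpoly (crossing_dim N) R,
  forall (m : nat) (beta : R), crossing N m.+1 beta = poly_map P (crossing N m beta).
Proof.
have entry m beta (i : nat) (hi : (i < crossing_dim N)%N) :
    mpoly.meval (crossing N m beta 0) (var (Ordinal hi)) = (crossing_seq N m beta)`_i.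
  by rewrite mpoly.mevalXU /crossing mxE.
(* The i-th variable, and 0 out of range, so that [L] can be written before the dimension is known
   to be 2 or 4. *)
pose p (i : nat) : mpoly.mpoly (crossing_dim N) R :=
  if insub i is Some j then var j else 0.
have pE m beta (i : nat) : (i < crossing_dim N)%N ->
    mpoly.meval (crossing N m beta 0) (p i) = (crossing_seq N m beta)`_i.
  by move=> hi; rewrite /p (insubT (fun i => i < crossing_dim N)%N hi) entry.
(* For N = 3, 5 the totals X and Y are sums of an avoiding and a visiting entry, with Y = X for N =
   3. Otherwise [ends_poly] is x * x whatever the avoiding weight, for which 0 is put. *)
pose L : seq (mpoly.mpoly (crossing_dim N) R) :=
  if N == 3%N then
    let x := p 0%N + p 1%N in
    [:: Xa_poly N x (p 0%N) x (p 0%N); X_poly N x (p 0%N) x - Xa_poly N x (p 0%N) x (p 0%N)]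
  else if N == 5%N then
    let x := p 0%N + p 1%N in let y := p 2%N + p 3%N in
    [:: Xa_poly N x (p 0%N) y (p 2%N); X_poly N x (p 0%N) y - Xa_poly N x (p 0%N) y (p 2%N);
        Ya_poly N x (p 0%N) y (p 2%N); Y_poly N x (p 0%N) y - Ya_poly N x (p 0%N) y (p 2%N)]
  else [:: X_poly N (p 0%N) 0 (p 1%N); Y_poly N (p 0%N) 0 (p 1%N)].
exists (fun i => L`_i) => m beta; apply/rowP => i; rewrite !mxE.
have XE : X beta m.+1 = X_poly N (X beta m) (Xa beta m) (Y beta m) := X_S N3 N4 beta m.
have YE : Y beta m.+1 = Y_poly N (X beta m) (Xa beta m) (Y beta m) := Y_S N3 N4 beta m.
have XaE : Xa beta m.+1 = Xa_poly N (X beta m) (Xa beta m) (Y beta m) (Ya beta m) :=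
  Xa_S N3 N4 beta m.
have YaE : Ya beta m.+1 = Ya_poly N (X beta m) (Xa beta m) (Y beta m) (Ya beta m) :=
  Ya_S N3 N4 beta m.
pose ev := mpoly.meval (crossing N m beta 0).
have [e3|n3] := eqVneq N 3%N.
  have d2 : crossing_dim N = 2%N by rewrite e3.
  have [YX YaXa] := Y_eq_X N3 N4 beta m e3.
  have E0 : ev (p 0%N) = Xa beta m by rewrite /ev pE ?d2 // crossing_seqE e3 eqxx.
  have E1 : ev (p 0%N + p 1%N) = X beta m.
    by rewrite /ev mpoly.mevalD !pE ?d2 // crossing_seqE e3 eqxx /= addrC subrK.
  have b3 : (N == 3%N) = true by apply/eqP.
  rewrite crossing_seqE /L b3.
  case: i => -[|[|i]] hi /=; last by exfalso; move: hi; rewrite d2.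
    by rewrite -/ev XaE YX YaXa -E0 -E1 -Xa_polyM.
  by rewrite -/ev XE XaE YX YaXa -E0 -E1 -Xa_polyM -X_polyM -rmorphB.
have [e5|n5] := eqVneq N 5%N.
  have d4 : crossing_dim N = 4%N by rewrite e5.
  have cE : crossing_seq N m beta =
      [:: Xa beta m; X beta m - Xa beta m; Ya beta m; Y beta m - Ya beta m].
    by rewrite crossing_seqE (negbTE n3) e5.
  have E0 : ev (p 0%N) = Xa beta m by rewrite /ev pE ?d4 // cE.
  have E1 : ev (p 0%N + p 1%N) = X beta m.
    by rewrite /ev rmorphD /= !pE ?d4 // cE /= addrC subrK.
  have E2 : ev (p 2%N) = Ya beta m by rewrite /ev pE ?d4 // cE.
  have E3 : ev (p 2%N + p 3%N) = Y beta m.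
    by rewrite /ev rmorphD /= !pE ?d4 // cE /= addrC subrK.
  have b5 : (N == 5%N) = true by apply/eqP.
  rewrite crossing_seqE /L (negbTE n3) b5.
  case: i => -[|[|[|[|i]]]] hi /=; last by exfalso; move: hi; rewrite d4.
  - by rewrite -/ev XaE -E0 -E1 -E2 -E3 -Xa_polyM.
  - by rewrite -/ev XE XaE -E0 -E1 -E2 -E3 -Xa_polyM -X_polyM -rmorphB.
  - by rewrite -/ev YaE -E0 -E1 -E2 -E3 -Ya_polyM.
  - by rewrite -/ev YE YaE -E0 -E1 -E2 -E3 -Ya_polyM -Y_polyM -rmorphB.
have d2 : crossing_dim N = 2%N by rewrite /crossing_dim (negbTE n5).
have cE : crossing_seq N m beta = [:: X beta m; Y beta m].
  by rewrite crossing_seqE (negbTE n3) (negbTE n5).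
have E0 : ev (p 0%N) = X beta m by rewrite /ev pE ?d2 // cE.
have E1 : ev (p 1%N) = Y beta m by rewrite /ev pE ?d2 // cE.
rewrite crossing_seqE /L (negbTE n3) (negbTE n5).
have gen k xa : k = s \/ k = (N - s)%N \/ k = (2 * s)%N \/ k = (N - 2 * s)%N ->
    ends_poly N (X beta m) (Xa beta m) k = ends_poly N (X beta m) xa k.
  by move=> hk; rewrite !ends_generic.
case: i => -[|[|i]] hi /=; last by exfalso; move: hi; rewrite d2.
  have -> : X beta m.+1 = X_poly N (ev (p 0%N)) (ev 0) (ev (p 1%N)).
    by rewrite XE E0 E1 /X_poly !(gen _ (ev 0)); auto.
  by rewrite -X_polyM.
have -> : Y beta m.+1 = Y_poly N (ev (p 0%N)) (ev 0) (ev (p 1%N)).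
  by rewrite YE E0 E1 /Y_poly !(gen _ (ev 0)); auto.
by rewrite -Y_polyM.
Qed.

Lemma X_ge0 beta m : 0 <= X beta m. Proof. exact: wt_ge0. Qed.
Lemma Y_ge0 beta m : 0 <= Y beta m. Proof. exact: wt_ge0. Qed.
Lemma Xa_ge0 beta m : 0 <= Xa beta m. Proof. exact: wt_ge0. Qed.
Lemma Ya_ge0 beta m : 0 <= Ya beta m. Proof. exact: wt_ge0. Qed.
Lemma Xa_le beta m : Xa beta m <= X beta m.
Proof. by apply: le_wt => [|p []//]; exact: K_fin. Qed.
Lemma Ya_le beta m : Ya beta m <= Y beta m.
Proof. by apply: le_wt => [|p []//]; exact: K_fin. Qed.

Definition bounded_at beta := exists M : R, forall m, X beta m <= M /\ Y beta m <= M.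

Lemma row_norm_leP (n : nat) (u : 'rV[R]_n) (M : R) : 0 <= M ->
  `|u| <= M <-> forall i, `|u 0 i| <= M.
Proof.
move=> M0; have -> : `|u| = \big[Num.max/0]_ij `|u ij.1 ij.2|.
  by rewrite [LHS]/Num.Def.normr /= mx_normrE.
split=> [h i|h].
  by apply: le_trans h; exact: (le_bigmax _ (fun ij => `|u ij.1 ij.2|) (0, i)).
by apply: bigmax_le => // -[i j] _ /=; rewrite ord1.
Qed.

Lemma norm_crossing_leP beta m (M : R) : 0 <= M ->
  `|crossing N m beta| <= M <->
  forall i, (i < crossing_dim N)%N -> `|(crossing_seq N m beta)`_i| <= M.
Proof.
move=> M0; rewrite row_norm_leP //; split=> h i; last by rewrite mxE; exact: h.
by move=> hi; have := h (Ordinal hi); rewrite mxE.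
Qed.

Lemma norm_crossing_le beta m (M : R) : X beta m <= M -> Y beta m <= M ->
  `|crossing N m beta| <= M.
Proof.
move=> XM YM; have M0 : 0 <= M := le_trans (X_ge0 _ _) XM.
have := Xa_ge0 beta m; have := Ya_ge0 beta m; have := Xa_le beta m; have := Ya_le beta m.
have := X_ge0 beta m; have := Y_ge0 beta m => y0 x0 ya xa ya0 xa0.
apply/norm_crossing_leP => // i _; rewrite crossing_seqE.
case: eqP => _; last case: eqP => _; case: i => [|[|[|[|i]]]] /=;
  rewrite ?nth_nil ?normr0 // ger0_norm ?subr_ge0 //; lra.
Qed.

(** The bound is M + M since for N = 3, 5 a total weight is the sum of two entries of the vector. *)
Lemma crossing_le_norm beta m (M : R) : 0 <= M -> `|crossing N m beta| <= M ->
  X beta m <= M + M /\ Y beta m <= M + M.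
Proof.
move=> M0 /norm_crossing_leP -/(_ M0); rewrite crossing_seqE /crossing_dim => h.
have le i : (i < crossing_dim N)%N -> (crossing_seq N m beta)`_i <= M.
  by move=> hi; apply: le_trans (ler_norm _) _; rewrite crossing_seqE; apply: h.
have [e3|n3] := eqVneq N 3%N.
  have [-> _] := Y_eq_X N3 N4 beta m e3.
  have b3 : (N == 3%N) = true by apply/eqP.
  have := le 0%N; have := le 1%N; rewrite crossing_seqE b3 /crossing_dim e3 /= => h1 h0.
  by have := h1 isT; have := h0 isT => ? ?; split; lra.
have [e5|n5] := eqVneq N 5%N.
  have b5 : (N == 5%N) = true by apply/eqP.
  have := le 0%N; have := le 1%N; have := le 2%N; have := le 3%N.
  rewrite crossing_seqE (negbTE n3) b5 /crossing_dim b5 /= => h3 h2 h1 h0.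
  by have := h1 isT; have := h0 isT; have := h2 isT; have := h3 isT => *; split; lra.
have := le 0%N; have := le 1%N.
rewrite crossing_seqE (negbTE n3) (negbTE n5) /crossing_dim (negbTE n5) /= => h1 h0.
by have := h1 isT; have := h0 isT => *; split; lra.
Qed.

Lemma bounded_crossing beta :
  (ereal_sup [set `|crossing N m beta|%:E | m in [set: nat]] < +oo)%E <-> bounded_at beta.
Proof.
set A := [set _ | _ in _]; split=> [h|[M hM]].
  have ub m : (`|crossing N m beta|%:E <= ereal_sup A)%E by apply: ereal_sup_ubound; exists m.
  have fin : ereal_sup A \is a fin_num.
    by rewrite fin_numE -ltey h andbT gt_eqF // (lt_le_trans _ (ub 0%N)) ?ltNyr.
  exists (fine (ereal_sup A) + fine (ereal_sup A)) => m.
  have le : `|crossing N m beta| <= fine (ereal_sup A) by rewrite -lee_fin fineK.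
  by apply: crossing_le_norm => //; apply: le_trans le.
apply: (@le_lt_trans _ _ M%:E); last exact: ltry.
apply: ge_ereal_sup => _ [m _ <-]; rewrite lee_fin; have [h1 h2] := hM m.
exact: norm_crossing_le.
Qed.

(** * Unbounded crossing weights reach 1 together *)

Lemma X_Y_generic beta m : N != 3%N -> N != 5%N ->
  X beta m.+1 = X beta m ^+ 2 * (Y beta m ^+ s.-1 + Y beta m ^+ (N - s).-1) /\
  Y beta m.+1 = X beta m ^+ 2 * (Y beta m ^+ (2 * s).-1 + Y beta m ^+ (N - 2 * s).-1).
Proof.
move=> n3 n5; rewrite (X_S N3 N4) (Y_S N3 N4) !ends_polyE !ends_generic; auto.
by rewrite !mulrDr !expr2.
Qed.

Lemma X_Y_5 beta m : N = 5%N ->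
  let c := Xa beta m * X beta m + (X beta m - Xa beta m) * Xa beta m in
  [/\ X beta m.+1 = X beta m ^+ 2 * (Y beta m + Y beta m ^+ 2),
      Y beta m.+1 = X beta m ^+ 2 + c * Y beta m ^+ 3,
      Xa beta m.+1 = X beta m ^+ 2 * Y beta m * (1 + Ya beta m) &
      Ya beta m.+1 = X beta m ^+ 2 + c * Y beta m ^+ 2 * Ya beta m].
Proof.
move=> e5; rewrite (X_S N3 N4) (Y_S N3 N4) (Xa_S N3 N4) (Ya_S N3 N4) !ends_polyE /ends_poly.
rewrite e5 /=; split; rewrite ?expr0 ?expr1 ?mulr1 //; ring.
Qed.

(** With y^a factored out this is (1 - u)(1 - v) >= 0 for u = y^(c - a) and v = y^(e - a), which lie
    on the same side of 1. *)
Lemma pow_mono_conv (y : R) (a c e b : nat) : 0 <= y -> (a <= c)%N -> (a <= e)%N ->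
  (a + b = c + e)%N -> y ^+ c + y ^+ e <= y ^+ a + y ^+ b.
Proof.
move=> y0 ac ae abce.
have -> : c = (a + (c - a))%N by lia.
have -> : e = (a + (e - a))%N by lia.
have -> : b = (a + ((c - a) + (e - a)))%N by lia.
rewrite !exprD -[X in _ <= X + _]mulr1 -!mulrDr ler_wpM2l ?exprn_ge0 //.
have u0 : 0 <= y ^+ (c - a) by exact: exprn_ge0.
have v0 : 0 <= y ^+ (e - a) by exact: exprn_ge0.
have [y1|/ltW y1] := leP y 1.
  have : y ^+ (c - a) <= 1 by exact: exprn_ile1.
  have : y ^+ (e - a) <= 1 by exact: exprn_ile1.
  by nra.
have : 1 <= y ^+ (c - a) by exact: exprn_ege1.
have : 1 <= y ^+ (e - a) by exact: exprn_ege1.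
by nra.
Qed.

Lemma generic_exponents : N != 3%N -> N != 5%N -> [/\ (2 <= s)%N, (3 * s <= N)%N,
  (N - 2 * s - 1 <= 2 * (s - 1))%N & (2 * s < N)%N].
Proof.
move=> n3 n5; have [h1 h2 h3] := sN_bounds N3 N4; have h7 := two_s_lt N3 N4.
by move: n3 n5 => /eqP n3 /eqP n5; split; lia.
Qed.

(** In both recursions the exponents of Y add up to N - 2, and s - 1 is the smallest of the four
    since 3 s <= N. *)
Lemma Y_le_X beta m : N != 3%N -> N != 5%N -> Y beta m <= X beta m.
Proof.
move=> n3 n5; have [s2 sN3' _ s2N] := generic_exponents n3 n5.
case: m => [|m].
  rewrite (X_0 N3 N4) (Y_0 N3 N4) pow_mono_conv ?expR_ge0 //; lia.
have [-> ->] := X_Y_generic beta m n3 n5.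
rewrite ler_wpM2l ?exprn_ge0 ?X_ge0 // pow_mono_conv ?Y_ge0 //; lia.
Qed.

Lemma X0_le2 beta : 0 <= beta -> X beta 0 <= 2 /\ Y beta 0 <= 2.
Proof.
move=> b0; rewrite (X_0 N3 N4) (Y_0 N3 N4).
have z1 : expR (- beta) <= 1 by rewrite -expR0 ler_expR oppr_le0.
have h k : expR (- beta) ^+ k <= 1 by rewrite exprn_ile1 ?expR_ge0.
by split; rewrite -[2]/(1 + 1) lerD.
Qed.

Lemma exponent_split (x y : R) (a e : nat) :
  x ^+ (4 + 2 * e) * y ^+ (2 * a + e * e) = (x ^+ 2 * y ^+ a) ^+ 2 * (x ^+ 2 * y ^+ e) ^+ e.
Proof.
by rewrite !exprMn -!exprM mulrACA -!exprD; congr (_ ^+ _ * _ ^+ _); clear N3 N4; lia.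
Qed.

(* Since y^D <= x^-(4 + 2 e), the D-th power of x^2 y^a is at most x^(2 D - (4 + 2 e) a)
   when x >= 1, and D is chosen so that this exponent is less than D. *)
Lemma generic_step (x y x' : R) (a e D : nat) : D = (2 * a + e * e)%N ->
    0 <= x -> 0 <= y <= 1 -> 0 <= x' -> (1 <= a)%N -> (a <= e <= 2 * a)%N ->
    x ^+ (4 + 2 * e) * y ^+ D <= 1 -> x' <= 2 * (x ^+ 2 * y ^+ a) ->
  x <= 2 ^+ D -> x' <= 2 ^+ D.
Proof.
move=> DE x0 /andP[y0 y1] x'0 a1 /andP[ae ea] small xD xM.
have De : (e * e + 2 <= D)%N by rewrite DE; lia.
have le1 : ((4 + 2 * e) * a <= 2 * D)%N by rewrite DE; nia.
have le2 : (2 * D - (4 + 2 * e) * a <= D.-1)%N by rewrite DE; nia.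
clear DE; have D0 : (0 < D)%N by lia.
set M : R := 2 ^+ D in xM *; have M1 : 1 <= M by rewrite exprn_ege1 // ler1n.
have M0 : 0 <= M by exact: le_trans M1.
rewrite -(@ler_pXn2r _ D) ?nnegrE //.
apply: (@le_trans _ _ ((2 * (x ^+ 2 * y ^+ a)) ^+ D)).
  by rewrite lerXn2r ?nnegrE // !mulr_ge0 ?exprn_ge0.
have ME : M ^+ D = M * M ^+ D.-1 by rewrite -exprS prednK.
rewrite exprMn -/M ME ler_wpM2l //.
have [x1|/ltW x1] := leP x 1.
  apply: (@le_trans _ _ 1); last exact: exprn_ege1.
  by rewrite exprn_ile1 ?mulr_ge0 ?exprn_ge0 // mulr_ile1 ?exprn_ge0 ?exprn_ile1.
apply: (@le_trans _ _ (x ^+ D.-1)); last by rewrite lerXn2r ?nnegrE.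
have -> : (x ^+ 2 * y ^+ a) ^+ D =
    (x ^+ (4 + 2 * e) * y ^+ D) ^+ a * x ^+ (2 * D - (4 + 2 * e) * a).
  have E : x ^+ (2 * D) = x ^+ ((4 + 2 * e) * a) * x ^+ (2 * D - (4 + 2 * e) * a).
    by rewrite -exprD subnKC.
  rewrite (exprMn _ (x ^+ 2)) (exprMn _ (x ^+ (4 + _))) -!exprM E (mulnC a D).
  by rewrite mulrAC.
apply: (@le_trans _ _ (1 * x ^+ (2 * D - (4 + 2 * e) * a))).
  by rewrite ler_wpM2r ?exprn_ge0 // exprn_ile1 // mulr_ge0 ?exprn_ge0.
by rewrite mul1r ler_weXn2l.
Qed.

(** Since Y_m <= X_m, the assumption means that Y_m < 1 at every level. A large X_m then comes with
    a small Y_m, which keeps X_(m+1) below 2^D. *)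
Lemma growth_generic beta : N != 3%N -> N != 5%N -> 0 <= beta ->
  (forall m, ~ (1 <= X beta m /\ 1 <= Y beta m)) -> bounded_at beta.
Proof.
move=> n3 n5 b0 small; have [s2 sN3' es s2N] := generic_exponents n3 n5.
have Y1 m : Y beta m < 1.
  rewrite ltNge; apply/negP => h; apply: (small m); split=> //.
  exact: le_trans h (Y_le_X _ _ n3 n5).
(* [a] and [e] are exponents of Y in the recursions of X and Y. Bounding Y_(m+2) below by X_(m+1)^2
   Y_(m+1)^e gives Y_m the exponent 2 a + e^2. *)
pose a := s.-1; pose e := (N - 2 * s).-1; pose D := (2 * a + e * e)%N.
have a1 : (1 <= a)%N by rewrite /a; lia.
have ea : (a <= e <= 2 * a)%N by rewrite /e /a; lia.
have ab : (a <= (N - s).-1)%N by rewrite /a; lia.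
suff H m : X beta m <= 2 ^+ D.
  exists (2 ^+ D) => m; split=> //; exact: le_trans (Y_le_X _ _ n3 n5) (H m).
elim: m => [|m IH].
  have [h _] := X0_le2 b0; apply: (le_trans h).
  by rewrite -[X in X <= _]expr1 ler_weXn2l ?ler1n // /D addn_gt0 muln_gt0 a1.
have [XE YE] := X_Y_generic beta m n3 n5; rewrite -/a -/e in XE YE.
(* Two steps of the recursion bound Y_(m+2) < 1 below by X_m^(4 + 2 e) Y_m^D. *)
have x0 := X_ge0 beta m; have y0 := Y_ge0 beta m; have y1 := ltW (Y1 m).
apply: (generic_step erefl x0 _ (X_ge0 _ _) a1 ea _ _ IH (y := Y beta m)).
- by rewrite y0.
- have h1 : X beta m ^+ 2 * Y beta m ^+ a <= X beta m.+1.
    by rewrite XE ler_wpM2l ?exprn_ge0 // lerDl exprn_ge0.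
  have h2 : X beta m ^+ 2 * Y beta m ^+ e <= Y beta m.+1.
    by rewrite YE ler_wpM2l ?exprn_ge0 // lerDr exprn_ge0.
  have h3 : X beta m.+1 ^+ 2 * Y beta m.+1 ^+ e <= Y beta m.+2.
    have [_ ->] := X_Y_generic beta m.+1 n3 n5.
    by rewrite ler_wpM2l ?exprn_ge0 ?X_ge0 // lerDr exprn_ge0 ?Y_ge0.
  rewrite exponent_split; apply: le_trans (ltW (Y1 m.+2)); apply: le_trans h3.
  apply: ler_pM; rewrite ?exprn_ge0 ?mulr_ge0 ?exprn_ge0 //.
    by rewrite lerXn2r ?nnegrE ?mulr_ge0 ?exprn_ge0 ?X_ge0 ?Y_ge0.
  by rewrite lerXn2r ?nnegrE ?mulr_ge0 ?exprn_ge0 ?X_ge0 ?Y_ge0.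
- rewrite XE mulrCA ler_wpM2l ?exprn_ge0 // mulr2n mulrDl mul1r lerD2l.
  exact: ler_wiXn2l.
Qed.

Lemma growth_3 beta : N = 3%N -> 0 <= beta ->
  (forall m, ~ (1 <= X beta m /\ 1 <= Y beta m)) -> bounded_at beta.
Proof.
move=> e3 b0 small; exists 1 => m; have [YX _] := Y_eq_X N3 N4 beta m e3.
have [h|h] := leP (X beta m) 1; first by rewrite YX.
by exfalso; apply: (small m); rewrite YX; split; exact: ltW.
Qed.

(** True at level 0, where the shorter way avoids the third corner, and inherited through the
    recursion. It controls the loss on the arc through all five cells. *)
Lemma half_5 beta m : N = 5%N -> 0 <= beta ->
  X beta m <= 2 * Xa beta m /\ Y beta m <= 2 * Ya beta m.
Proof.
move=> e5 b0; have z0 := expR_ge0 (- beta).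
have z1 : expR (- beta) <= 1 by rewrite -expR0 ler_expR oppr_le0.
have s2 : s = 2%N := sN_5 e5.
elim: m => [|m [IHx IHy]].
  have := Xa_0 N3 N4 beta; have := Ya_0 N3 N4 beta; rewrite (X_0 N3 N4) (Y_0 N3 N4) s2.
  have -> : (N - 2 * 2)%N = 1%N by rewrite e5.
  have -> : (N - 2)%N = 3%N by rewrite e5.
  have h3 : expR (- beta) ^+ 3 <= expR (- beta) ^+ 2 by apply: ler_wiXn2l.
  have h4 : expR (- beta) ^+ (2 * 2) <= expR (- beta) ^+ 1 by apply: ler_wiXn2l.
  by move=> h1 h2; split; lra.
have [-> -> -> ->] := X_Y_5 beta m e5.
have x0 := X_ge0 beta m; have y0 := Y_ge0 beta m; have xa0 := Xa_ge0 beta m.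
have xax := Xa_le beta m.
set x := X beta m in x0 xax IHx *; set y := Y beta m in y0 IHy *.
set xa := Xa beta m in xa0 xax IHx *; set ya := Ya beta m in IHy *.
have c0 : 0 <= xa * x + (x - xa) * xa by rewrite addr_ge0 ?mulr_ge0 // subr_ge0.
set c := _ + _ in c0 *.
have x2 : 0 <= x ^+ 2 by rewrite exprn_ge0.
have y2 : 0 <= y ^+ 2 by rewrite exprn_ge0.
have x2y : 0 <= x ^+ 2 * y by rewrite mulr_ge0.
have cy2 : 0 <= c * y ^+ 2 by rewrite mulr_ge0.
split.
  have -> : x ^+ 2 * (y + y ^+ 2) = x ^+ 2 * y * (1 + y) by ring.
  rewrite mulrCA ler_wpM2l //; lra.
have -> : c * y ^+ 3 = c * y ^+ 2 * y by ring.
have : c * y ^+ 2 * y <= c * y ^+ 2 * (2 * ya) by rewrite ler_wpM2l.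
lra.
Qed.

(** The end factor of the full arc is X^2 - (X - Xa)^2, and X - Xa <= X/2 by [half_5]; hence 3/4. *)
Lemma step_5 beta m : N = 5%N -> 0 <= beta ->
  [/\ X beta m.+1 = X beta m ^+ 2 * (Y beta m + Y beta m ^+ 2),
      3 / 4 * (X beta m ^+ 2 * (1 + Y beta m ^+ 3)) <= Y beta m.+1 &
      Y beta m.+1 <= X beta m ^+ 2 * (1 + Y beta m ^+ 3)].
Proof.
move=> e5 b0; have [-> -> _ _] := X_Y_5 beta m e5; have [h _] := half_5 m e5 b0.
have x0 := X_ge0 beta m; have y0 := Y_ge0 beta m; have xa0 := Xa_ge0 beta m.
have xax := Xa_le beta m.
set x := X beta m in x0 xax h *; set y := Y beta m in y0 *; set xa := Xa beta m in xa0 xax h *.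
have y3 : 0 <= y ^+ 3 by rewrite exprn_ge0.
have c1 : xa * x + (x - xa) * xa <= x ^+ 2.
  by rewrite expr2; nra.
have c2 : 3 / 4 * x ^+ 2 <= xa * x + (x - xa) * xa.
  by rewrite expr2; nra.
set c := _ + _ in c1 c2 *.
have x2 : 0 <= x ^+ 2 by rewrite exprn_ge0.
have h1 : c * y ^+ 3 <= x ^+ 2 * y ^+ 3 by rewrite ler_wpM2r.
have h2 : 3 / 4 * x ^+ 2 * y ^+ 3 <= c * y ^+ 3 by rewrite ler_wpM2r.
by split=> //; rewrite mulrDr mulr1; lra.
Qed.

(** Above level 0 it suffices that y + y^2 <= 1 + y^3, the difference being (1 - y)^2 (1 + y). *)
Lemma X_le_Y_5 beta m : N = 5%N -> 0 <= beta -> 3 / 4 * X beta m <= Y beta m.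
Proof.
move=> e5 b0; case: m => [|m].
  have z0 := expR_ge0 (- beta).
  have z1 : expR (- beta) <= 1 by rewrite -expR0 ler_expR oppr_le0.
  rewrite (X_0 N3 N4) (Y_0 N3 N4) (sN_5 e5).
  have -> : (N - 2 * 2)%N = 1%N by rewrite e5.
  have -> : (N - 2)%N = 3%N by rewrite e5.
  rewrite -[(2 * 2)%N]/4%N; move: (expR _) z0 z1 => z z0 z1.
  have h1 : z ^+ 3 <= z ^+ 2 by apply: ler_wiXn2l.
  have h2 : z ^+ 2 <= z ^+ 1 by apply: ler_wiXn2l.
  have h4 : 0 <= z ^+ 4 by apply: exprn_ge0.
  have h5 : 0 <= z * ((1 - z) * (1 - z ^+ 2)).
    by rewrite !mulr_ge0 // subr_ge0 // exprn_ile1.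
  have h6 : 0 <= z ^+ 2 by apply: exprn_ge0.
  have h7 : 0 <= z ^+ 3 by apply: exprn_ge0.
  have -> : z ^+ 4 + z ^+ 1 = z * ((1 - z) * (1 - z ^+ 2)) + (z ^+ 2 + z ^+ 3) by ring.
  lra.
have [-> h _] := step_5 m e5 b0; apply: le_trans h; rewrite ler_wpM2l //.
have y0 := Y_ge0 beta m; rewrite ler_wpM2l ?exprn_ge0 ?X_ge0 //.
set y := Y beta m in y0 *; have : 0 <= (1 - y) ^+ 2 * (1 + y) by rewrite mulr_ge0 ?sqr_ge0 //; lra.
by rewrite -subr_ge0; congr (0 <= _); ring.
Qed.

Lemma growth_5 beta : N = 5%N -> 0 <= beta ->
  (forall m, ~ (1 <= X beta m /\ 1 <= Y beta m)) -> bounded_at beta.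
Proof.
move=> e5 b0 small.
(* X_m >= 4/3 would give Y_m >= 1 as well, by [X_le_Y_5]. *)
have Xlt m : X beta m < 4 / 3.
  rewrite ltNge; apply/negP => h; apply: (small m).
  by have := X_le_Y_5 m e5 b0; split; lra.
suff H m : Y beta m <= 7 by exists 7 => m; split=> //; have := Xlt m; lra.
elim: m => [|m IH]; first by have [_ h] := X0_le2 b0; lra.
have [XE Yge Yle] := step_5 m e5 b0.
have [XE' _ _] := step_5 m.+1 e5 b0.
have x0 := X_ge0 beta m; have y0 := Y_ge0 beta m; have xl := Xlt m.
have x0' := X_ge0 beta m.+1; have y0' := Y_ge0 beta m.+1; have xl' := Xlt m.+2.
move: XE Yge Yle XE' IH x0 y0 xl x0' y0' xl'.
move: (X beta m) (Y beta m) (X beta m.+1) (Y beta m.+1) (X beta m.+2) => x y x' y' x''.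
move=> XE Yge Yle XE' IH x0 y0 xl x0' y0' xl'.
have x2 : x ^+ 2 <= 16 / 9 by rewrite expr2; nra.
(* Y_(m+1) is at most x^2 + t. From X_(m+2) < 4/3 one gets (3/4 t^2)^2 <= 4/3 y^2 with y <= 7, which
   is impossible for t > 4; hence Y_(m+1) <= 16/9 + 4 < 7. *)
pose t := x ^+ 2 * y ^+ 3.
have t0 : 0 <= t by rewrite mulr_ge0 ?exprn_ge0.
have x2y2 : 0 <= x ^+ 2 * y ^+ 2 by rewrite mulr_ge0 ?exprn_ge0.
have h1 : x ^+ 2 * y ^+ 2 <= x'.
  by rewrite XE ler_wpM2l ?exprn_ge0 // lerDr.
have h2 : 3 / 4 * t <= y'.
  apply: le_trans Yge; rewrite ler_wpM2l //.
  by rewrite ler_wpM2l ?exprn_ge0 // lerDr.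
have h3 : (x' * y') ^+ 2 <= 4 / 3.
  apply: le_trans (ltW xl'); rewrite XE' exprMn ler_wpM2l ?exprn_ge0 // lerDr //.
have h4 : x ^+ 2 * y ^+ 2 * (3 / 4 * t) <= x' * y' by apply: ler_pM => //; lra.
have h5 : (x ^+ 2 * y ^+ 2 * (3 / 4 * t)) ^+ 2 <= 4 / 3.
  apply: le_trans h3; rewrite lerXn2r ?nnegrE ?mulr_ge0 //; lra.
have h6 : (3 / 4 * t ^+ 2) ^+ 2 <= 4 / 3 * y ^+ 2.
  have -> : (3 / 4 * t ^+ 2) ^+ 2 = (x ^+ 2 * y ^+ 2 * (3 / 4 * t)) ^+ 2 * y ^+ 2.
    by rewrite /t; ring.
  by rewrite ler_wpM2r ?exprn_ge0.
have y2 : y ^+ 2 <= 49 by rewrite expr2; nra.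
have t4 : t <= 4.
  rewrite leNgt; apply/negP => t4.
  have t16 : 16 <= t ^+ 2 by rewrite expr2; nra.
  have : 144 <= (3 / 4 * t ^+ 2) ^+ 2 by rewrite [_ ^+ 2]expr2; nra.
  lra.
by move: Yle; rewrite mulrDr mulr1 -/t; lra.
Qed.

Lemma growth beta : 0 <= beta -> ~ bounded_at beta ->
  exists m, 1 <= X beta m /\ 1 <= Y beta m.
Proof.
move=> b0 nb; apply: contrapT => /forallNP small; apply: nb.
have [e3|n3] := eqVneq N 3%N; first exact: growth_3.
have [e5|n5] := eqVneq N 5%N; first exact: growth_5.
exact: growth_generic.
Qed.

End Crossing.

(** * The connective constant *)

Section ExponentialGrowth.
Context {R : realType}.

Lemma finite_size_bound (T : choiceType) (A : set (seq T)) : finite_set A ->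
  exists M, forall p, A p -> (size p <= M)%N.
Proof.
move=> fA; exists (\max_(p <- fset_set A) size p)%N => p Ap.
by apply: leq_bigmax_seq => //; rewrite in_fset_set // inE.
Qed.

Lemma wt_decay (T : choiceType) (A : set (seq T)) (b1 b : R) (m : nat) : finite_set A ->
    b1 <= b -> (forall p, A p -> (m <= size p)%N) ->
  wt b A <= wt b1 A * expR (b1 - b) ^+ m.
Proof.
move=> fA bb hm; rewrite !wt_fset // mulr_suml big_seq [leRHS]big_seq.
apply: ler_sum => p; rewrite in_fset_set // inE => /hm mp.
rewrite -expRM_natl -expRD ler_expR -subr_ge0.
rewrite (_ : _ - _ = (b - b1) * ((size p)%:R - m%:R)); last by rewrite mulr_natl; ring.
by rewrite mulr_ge0 // subr_ge0 // ler_nat.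
Qed.

Lemma root_growth_cvg (c : nat -> R) (b : R) :
    (forall e, 0 < e -> exists k C, [/\ 0 < k, 0 < C & forall n : nat,
      k * expR ((b - e) * n%:R) <= c n <= C * expR ((b + e) * n%:R)]) ->
  (fun n => c n `^ (n%:R^-1)) @ \oo --> expR b.
Proof.
move=> h.
have c0 n : 0 < c n.
  have [k [C [k0 _ /(_ n)/andP[hn _]]]] := h 1 ltr01.
  by apply: lt_le_trans hn; rewrite mulr_gt0 ?expR_gt0.
have -> : (fun n => c n `^ (n%:R^-1)) = (fun n => expR (n%:R^-1 * ln (c n))).
  by apply/funext => n; rewrite /powR gt_eqF.
apply: (@cvg_comp _ _ _ (fun n => n%:R^-1 * ln (c n)) expR); last exact: continuous_expR.
apply/cvgrPdist_le => e e0; have e2 : 0 < e / 2 by rewrite divr_gt0.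
have [k [C [k0 C0 hc]]] := h _ e2; pose D := `|ln k| + `|ln C|.
have D0 : 0 <= D by rewrite addr_ge0.
near=> n.
have n0 : 0 < n%:R :> R by rewrite ltr0n; near: n; exact: nbhs_infty_gt.
have nD : D <= e / 2 * n%:R.
  rewrite -ler_pdivrMl //; near: n; exact: nbhs_infty_ger.
have /andP[h1 h2] := hc n.
have {}h1 : ln k + (b - e / 2) * n%:R <= ln (c n).
  rewrite -ler_expR expRD !lnK ?posrE //.
have {}h2 : ln (c n) <= ln C + (b + e / 2) * n%:R.
  rewrite -ler_expR expRD !lnK ?posrE //.
have k1 : - D <= ln k.
  by rewrite /D; have := ler_norm (- ln k); rewrite normrN; have := normr_ge0 (ln C); lra.
have C1 : ln C <= D.
  by rewrite /D; have := ler_norm (ln C); have := normr_ge0 (ln k); lra.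
have -> : b - n%:R^-1 * ln (c n) = (b * n%:R - ln (c n)) / n%:R by field; rewrite gt_eqF.
rewrite normrM (@gtr0_norm _ n%:R^-1) ?invr_gt0 // ler_pdivrMr // ler_norml; apply/andP; split; lra.
Unshelve. all: by end_near. Qed.

End ExponentialGrowth.

Section Criticality.
Context {R : realType}.
Variable N : nat.
Hypotheses (N3 : (3 <= N)%N) (N4 : ~~ (4 %| N)%N).
Local Notation s := (sN N).
Local Notation qq := (q R N).
Local Notation K := (@corner_crossings R N).
Local Notation V := (@level_vert R N).
Local Notation X := (@X_weight R N).
Local Notation Y := (@Y_weight R N).
Local Notation W := (@walks_weight R N).

Lemma expands_levels (kappa beta : R) m k :
    expands kappa beta (K m 0 s) (V m) 1 ->
    expands kappa beta (K m (- s%:Z) s) (V m) 1 ->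
  expands kappa beta (K (m + k) 0 s) (V (m + k)) k.+1 /\
  expands kappa beta (K (m + k) (- s%:Z) s) (V (m + k)) k.+1.
Proof.
move=> hX hY; elim: k => [|k [IHX IHY]]; first by rewrite addn0.
rewrite addnS; have [hX' hY'] := expands_K N3 N4 IHX IHY.
split; [apply: (expands_sub hX')|apply: (expands_sub hY')] => //; try exact: K_fin.
  by lia.
by lia.
Qed.

Lemma saw_count_lower (beta : R) m : 0 <= beta -> 1 <= X beta m -> 1 <= Y beta m ->
  exists2 kappa : R, 0 < kappa & forall n, finite_set (@root_saws R N n) ->
    kappa * expR (beta * n%:R) <= (saw_count R N n)%:R.
Proof.
move=> b0 X1 Y1; have [s0 s1 _] := sN_bounds N3 N4; have s2 := @two_s_lt R N N3 N4.
have [M1 hM1] := finite_size_bound (@K_fin R N N3 N4 m 0 s).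
have [M2 hM2] := finite_size_bound (@K_fin R N N3 N4 m (- s%:Z) s).
(* One [kappa] must serve both kinds of crossings. *)
pose M := maxn M1 M2; exists (expR (- beta * M%:R)); first exact: expR_gt0.
move=> n fin; apply: (@saw_count_lb R N N3 N4 _ n (m + n)) => //.
have hX : expands (expR (- beta * M%:R)) beta (K m 0 s) (V m) 1.
  apply: (@expands_base _ _ _ _ _ (qq s)) => //; first exact: K_fin.
  - by apply: crossings_ends => /esym; apply: q_neq => //; lia.
  - exact: V_q.
  - by move=> p /hM1 h; apply: leq_trans h _; exact: leq_maxl.
have hY : expands (expR (- beta * M%:R)) beta (K m (- s%:Z) s) (V m) 1.
  apply: (@expands_base _ _ _ _ _ (qq s)) => //; first exact: K_fin.
  - by apply: crossings_ends => /esym; apply: q_neq => //; lia.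
  - exact: V_q.
  - by move=> p /hM2 h; apply: leq_trans h _; exact: leq_maxr.
have [hn _] := expands_levels n hX hY.
(* The branching starts from the empty word alone, with n0 = 0; level m + n then reaches the length
   n + 1. *)
have catA0 A : catset A [set [::]] = A :> set (seq R[i]).
  apply/seteqP; split=> p.
    by move=> /catsetP[p1 [p2 [Ap -> ->]]]; rewrite cats0.
  by move=> Ap; apply/catsetP; exists p, [::]; split=> //; rewrite cats0.
rewrite -[K _ _ _]catA0; apply: (hn 0%N) => //.
- by move=> p ->.
- move=> k; rewrite leqn0 => /eqP->; rewrite mulr0 expR0 mulr1.
  apply: (@le_trans _ _ 1).
    by rewrite -expR0 ler_expR mulNr oppr_le0 mulr_ge0.
  by apply: (@cnt_ge1 _ _ _ [::]); [exact: pref_fin|exists [::]].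
Qed.

Lemma W_bounded (b1 b : R) : bounded_at N b1 -> b1 < b -> exists C, forall m, W b m <= C.
Proof.
move=> [M0 hM0] bb; pose M := Num.max M0 0.
have M_ge0 : 0 <= M by rewrite le_max lexx orbT.
have hM m : X b1 m <= M /\ Y b1 m <= M.
  by have [h1 h2] := hM0 m; rewrite !le_max h1 h2.
pose r := expR (b1 - b); have r0 : 0 <= r by exact: expR_ge0.
have r1 : r < 1 by rewrite -expR0 ltr_expR subr_lt0.
have decay m : X b m <= M * r ^+ m.
  apply: le_trans (_ : X b1 m * r ^+ m <= _); last first.
    by apply: ler_wpM2r; [rewrite exprn_ge0|have [] := hM m].
  apply: wt_decay (ltW bb) _; first exact: K_fin.
  by move=> p Kp; apply/ltnW/(@K_size R N N3 N4); left.
have Yle m : Y b m <= M.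
  apply: le_trans (_ : Y b1 m * r ^+ 0 <= _); last by rewrite expr0 mulr1; have [] := hM m.
  by apply: wt_decay (ltW bb) _ => //; exact: K_fin.
(* With this D, one level multiplies W by at most 1 + D r^m <= exp(D r^m), and these exponents have
   a convergent sum. *)
pose D := 2 * M * \sum_(i < N) M ^+ i.
have D0 : 0 <= D by rewrite !mulr_ge0 // sumr_ge0 // => i _; rewrite exprn_ge0.
have W0 m : 0 <= W b m by exact: wt_ge0.
have step m : W b m.+1 <= W b m * expR (D * r ^+ m).
  apply: le_trans (W_S N3 N4 b m) _; rewrite ler_wpM2l //.
  apply: le_trans (expR_ge1Dx _); rewrite lerD2l.
  have -> : D * r ^+ m = 2 * (M * r ^+ m) * \sum_(i < N) M ^+ i by rewrite /D; ring.
  apply: ler_pM => //.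
  - by rewrite mulr_ge0 // X_ge0.
  - by rewrite sumr_ge0 // => i _; rewrite exprn_ge0 // Y_ge0.
  - by rewrite ler_wpM2l.
  - by apply: ler_sum => i _; rewrite lerXn2r ?nnegrE ?Y_ge0.
have geo m : \sum_(i < m) r ^+ i <= (1 - r)^-1.
  have r10 : 0 < 1 - r by rewrite subr_gt0.
  rewrite -[leRHS]mul1r ler_pdivlMr // mulrC.
  have -> : (1 - r) * \sum_(i < m) r ^+ i = 1 - r ^+ m.
    by rewrite -opprB mulNr -subrX1 opprB.
  by rewrite lerBlDr lerDl exprn_ge0.
exists (W b 0 * expR (D * (1 - r)^-1)) => m.
apply: le_trans (_ : W b 0 * expR (D * \sum_(i < m) r ^+ i) <= _); last first.
  by rewrite ler_wpM2l // ler_expR ler_wpM2l.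
elim: m => [|m IH]; first by rewrite big_ord0 mulr0 expR0 mulr1.
apply: le_trans (step m) _; rewrite big_ord_recr /= mulrDr expRD mulrA.
by rewrite ler_wpM2r ?expR_ge0.
Qed.

Lemma saw_count_upper (b1 b : R) : bounded_at N b1 -> b1 < b ->
  exists2 C, 0 < C & forall n, finite_set (@root_saws R N n) /\
    (saw_count R N n)%:R <= C * expR (b * n%:R).
Proof.
move=> hb bb; have [C hC] := W_bounded hb bb; exists (Num.max C 1).
  by rewrite lt_max ltr01 orbT.
move=> n; apply: saw_count_ub => // m; apply: le_trans (cnt_root_walks_W N3 N4 b m n) _.
by rewrite mulrC ler_wpM2r ?expR_ge0 // le_max hC.
Qed.

Lemma ends_le (beta : R) m k : ends N beta m k <= X beta m ^+ 2.
Proof.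
rewrite /ends expr2; case: ifP => // _; rewrite -subr_ge0.
rewrite (_ : _ - _ = (X beta m - X_avoid_weight N beta m) ^+ 2) ?sqr_ge0 //; ring.
Qed.

(** This makes the critical value finite. At e^(-beta) = 1/4 the bound 1/2 is preserved, since the
    next X and Y are sums of two terms of at most X^2 <= 1/4. *)
Lemma bounded_at_ln4 : bounded_at N (ln 4 : R).
Proof.
have [s0 s1 _] := sN_bounds N3 N4; have s2 := @two_s_lt R N N3 N4.
have z4 : expR (- ln 4) = 4^-1 :> R by rewrite expRN lnK // posrE.
have small k : (0 < k)%N -> (4^-1 : R) ^+ k <= 4^-1.
  move=> k0; rewrite -[leRHS]expr1; apply: ler_wiXn2l => //; lra.
exists (1 / 2); elim=> [|m [hX hY]].
  rewrite (X_0 N3 N4) (Y_0 N3 N4) !z4.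
  have h1 := small s s0.
  have h2 : (4^-1 : R) ^+ (N - s) <= 4^-1 by apply: small; lia.
  have h3 : (4^-1 : R) ^+ (2 * s) <= 4^-1 by apply: small; lia.
  have h4 : (4^-1 : R) ^+ (N - 2 * s) <= 4^-1 by apply: small; lia.
  by split; lra.
have x0 := X_ge0 N (ln 4 : R) m; have y0 := Y_ge0 N (ln 4 : R) m.
have e k j : ends N (ln 4) m k * Y (ln 4) m ^+ j <= 1 / 4.
  have /le_trans -> // : ends N (ln 4) m k * Y (ln 4) m ^+ j <= X (ln 4) m ^+ 2 * 1.
    apply: le_trans (_ : X (ln 4) m ^+ 2 * Y (ln 4) m ^+ j <= _).
      by apply: ler_wpM2r; [rewrite exprn_ge0|exact: ends_le].
    by rewrite ler_wpM2l ?exprn_ge0 // exprn_ile1 //; lra.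
  by rewrite mulr1 expr2; nra.
rewrite (X_S N3 N4) (Y_S N3 N4); split.
  by have := e s s.-1; have := e (N - s)%N (N - s).-1; lra.
by have := e (2 * s)%N (2 * s).-1; have := e (N - 2 * s)%N (N - 2 * s).-1; lra.
Qed.

Definition bounded_betas : set R := [set beta | 0 <= beta /\ bounded_at N beta].

Lemma bounded_betas_ln4 : bounded_betas (ln 4).
Proof. by split; [rewrite ln_ge0 //; lra|exact: bounded_at_ln4]. Qed.

Lemma bounded_betas_lb : has_lbound bounded_betas.
Proof. by exists 0 => b []. Qed.

Lemma bounded_betas_inf : has_inf bounded_betas.
Proof. by split; [exists (ln 4); exact: bounded_betas_ln4|exact: bounded_betas_lb]. Qed.

Lemma beta_crE : beta_cr R N = (inf bounded_betas)%:E.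
Proof.
rewrite -ereal_inf_EFin; last by exists (ln 4); exact: bounded_betas_ln4.
  rewrite /beta_cr; congr (ereal_inf _); congr (_ @` _).
  by apply/seteqP; split=> b [b0 hb]; split=> //; apply/bounded_crossing.
exact: bounded_betas_lb.
Qed.

Lemma saw_root_cvg : saw_root R N @ \oo --> expR (inf bounded_betas).
Proof.
apply: root_growth_cvg => e e0; set b := inf _.
have [b1 [_ hb1] lt1] := inf_adherent e0 bounded_betas_inf.
have [C C0 hC] := saw_count_upper hb1 lt1.
have [k k0 hk] : exists2 k : R, 0 < k & forall n, finite_set (@root_saws R N n) ->
    k * expR ((b - e) * n%:R) <= (saw_count R N n)%:R.
  (* Below the infimum a nonnegative b - e gives unbounded weights; if b - e is negative, beta = 0
     serves instead, where X_0 = Y_0 = 2. *)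
  have [be|be] := leP 0 (b - e).
    have nb : ~ bounded_at N (b - e).
      move=> h; have : b <= b - e by apply: ge_inf; [exact: bounded_betas_lb|split].
      lra.
    have [m [hX hY]] := growth N3 N4 be nb.
    exact: saw_count_lower hX hY.
  have [||k k0 hk] := @saw_count_lower 0 0 (lexx 0).
  - by rewrite (X_0 N3 N4) oppr0 expR0 !expr1n; lra.
  - by rewrite (Y_0 N3 N4) oppr0 expR0 !expr1n; lra.
  exists k => // n fin; apply: le_trans (hk n fin).
  by rewrite ler_wpM2l ?(ltW k0) // ler_expR ler_wpM2r // ltW.
exists k, C; split=> // n; have [fin ->] := hC n; rewrite andbT; exact: hk.
Qed.

Lemma mu_eq : mu R N = expR (inf bounded_betas).
Proof. by apply: cvg_lim => //; exact: saw_root_cvg. Qed.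

End Criticality.

(** * The cases N = 6 and N = 9 *)

Section Algebraic.
Context {F E : fieldType} (h : {rmorphism F -> E}).

Lemma algebraic_nat n : algebraicOver h n%:R.
Proof. by rewrite -(rmorph_nat h); exact: algebraic_id. Qed.

Lemma algebraic_of_exp (x : E) n : (0 < n)%N -> algebraicOver h (x ^+ n) -> algebraicOver h x.
Proof.
move=> n0 [p p0 px]; exists (p \Po 'X^n).
  by rewrite comp_poly_eq0 // size_polyXn.
by move: px; rewrite /root map_comp_poly horner_comp map_polyXn hornerXn.
Qed.

End Algebraic.

Section Triple.
Context {R : realType}.
Variable N : nat.
Hypotheses (N3 : (3 <= N)%N) (N4 : ~~ (4 %| N)%N).
Local Notation s := (sN N).
Hypotheses (NE : N = (3 * sN N)%N) (s2 : (2 <= sN N)%N).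
Local Notation X := (@X_weight R N).
Local Notation Y := (@Y_weight R N).

Definition tau : R := (Num.sqrt 5 - 1) / 2.
Definition t_crit : R := tau `^ (s%:R^-1).
Definition y_crit : R := (Num.sqrt (1 + 4 * t_crit) - 1) / 2.

Lemma tau_gt0 : 0 < tau.
Proof.
rewrite /tau divr_gt0 // subr_gt0 -[ltLHS]sqrtr1 ltr_sqrt //; lra.
Qed.

Lemma tauE : tau * (1 + tau) = 1.
Proof.
have : Num.sqrt 5 ^+ 2 = 5 :> R by rewrite sqr_sqrtr.
rewrite /tau expr2 => h; set r := Num.sqrt 5 in h *.
rewrite (_ : _ * _ = (r * r - 1) / 4); last by field.
rewrite h; lra.
Qed.

Lemma t_crit_gt0 : 0 < t_crit. Proof. by rewrite powR_gt0 // tau_gt0. Qed.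

Lemma t_critX : t_crit ^+ s = tau.
Proof.
rewrite -powR_mulrn ?(ltW t_crit_gt0) // /t_crit -powRrM mulVf ?powRr1 ?(ltW tau_gt0) //.
by rewrite pnatr_eq0; lia.
Qed.

Lemma t_crit_lt1 : t_crit < 1.
Proof.
rewrite ltNge; apply/negP => h; have : 1 <= tau by rewrite -t_critX exprn_ege1.
by have := tauE; nra.
Qed.

Lemma y_crit_gt0 : 0 < y_crit.
Proof.
have t0 := t_crit_gt0; rewrite /y_crit divr_gt0 // subr_gt0 -[ltLHS]sqrtr1 ltr_sqrt //; lra.
Qed.

Lemma y_critE : y_crit + y_crit ^+ 2 = t_crit.
Proof.
have : Num.sqrt (1 + 4 * t_crit) ^+ 2 = 1 + 4 * t_crit.
  by rewrite sqr_sqrtr // addr_ge0 // mulr_ge0 // ltW // t_crit_gt0.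
rewrite /y_crit !expr2 => h; set r := Num.sqrt _ in h *.
rewrite (_ : _ + _ = (r * r - 1) / 4); last by field.
rewrite h; lra.
Qed.

Lemma y_crit_lt1 : y_crit < 1.
Proof.
have := y_critE; have := y_crit_gt0; have := t_crit_lt1; rewrite expr2; nra.
Qed.

(** With N = 3 s the exponents s - 1 and 2 s - 1 occur in both recursions, in exchanged order, so X
    and Y agree at every level. *)
Lemma X_Y_triple beta m : Y beta m = X beta m /\
  X beta m.+1 = X beta m * (X beta m ^+ s * (1 + X beta m ^+ s)).
Proof.
have n3 : N != 3%N by lia.
have n5 : N != 5%N by lia.
have e1 : (N - s)%N = (2 * s)%N by lia.
have e2 : (N - 2 * s)%N = s by lia.
have YX k : Y beta k = X beta k.
  case: k => [|k]; first by rewrite (Y_0 N3 N4) (X_0 N3 N4) e1 e2 addrC.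
  by have [-> ->] := X_Y_generic N3 N4 beta k n3 n5; rewrite e1 e2 [_ + _ in LHS]addrC.
split=> //; have [-> _] := X_Y_generic N3 N4 beta m n3 n5; rewrite YX e1.
move: (X beta m) => x; case: s s2 => // k _.
by rewrite mulnS mulSn /= !exprD !exprS; ring.
Qed.

(** By tau (1 + tau) = 1 the growth factor X^s (1 + X^s) is at most 1 up to [t_crit]. If X_0 is
    larger, it is at least some c > 1 at every level, and X_m dominates an increasing arithmetic
    progression. *)
Lemma bounded_triple beta : bounded_at N beta <-> X beta 0 <= t_crit.
Proof.
have t0 := t_crit_gt0; have X0 m : 0 <= X beta m by exact: X_ge0.
split=> [[M hM]|h].
  rewrite leNgt; apply/negP => h.
  have x0 : 0 < X beta 0 by exact: lt_trans h.
  pose c := X beta 0 ^+ s * (1 + X beta 0 ^+ s).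
  have ts : tau < X beta 0 ^+ s.
    by rewrite -t_critX ltrXn2r ?nnegrE ?ltW //; lia.
  have c1 : 0 < c - 1.
    by rewrite subr_gt0 /c; have := tauE; have := tau_gt0; nra.
  have H m : X beta 0 + m%:R * ((c - 1) * X beta 0) <= X beta m.
    elim: m => [|m IH]; first by rewrite mul0r addr0.
    have [_ ->] := X_Y_triple beta m.
    have le0 : X beta 0 <= X beta m.
      by apply: le_trans IH; rewrite lerDl !mulr_ge0 // ltW.
    have ge_c : c <= X beta m ^+ s * (1 + X beta m ^+ s).
      have le_s : X beta 0 ^+ s <= X beta m ^+ s by rewrite lerXn2r ?nnegrE.
      by rewrite /c ler_pM ?addr_ge0 ?exprn_ge0 // lerD2l.
    have : X beta m * c <= X beta m * (X beta m ^+ s * (1 + X beta m ^+ s)).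
      by rewrite ler_wpM2l.
    have : (c - 1) * X beta 0 <= (c - 1) * X beta m by rewrite ler_wpM2l // ltW.
    rewrite -natr1; lra.
  have d0 : 0 < (c - 1) * X beta 0 by rewrite mulr_gt0.
  have := truncnS_gt (M / ((c - 1) * X beta 0)); set n := (_.+1).
  rewrite ltr_pdivrMr // => hn.
  by have := H n; have [+ _] := hM n; lra.
exists t_crit => m; have [-> _] := X_Y_triple beta m.
suff : X beta m <= t_crit by [].
elim: m => // m IH; have [_ ->] := X_Y_triple beta m.
apply: (le_trans _ IH); rewrite -[leRHS]mulr1 ler_wpM2l //.
have : X beta m ^+ s <= tau by rewrite -t_critX lerXn2r ?nnegrE // ltW.
by have := tauE; have := exprn_ge0 s (X0 m); nra.
Qed.

Lemma bounded_betas_triple beta : bounded_betas N beta <-> - ln y_crit / s%:R <= beta.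
Proof.
have s0 : 0 < s%:R :> R by rewrite ltr0n; lia.
have yc0 := y_crit_gt0.
have e1 : (N - s)%N = (s + s)%N by lia.
have key : X beta 0 <= t_crit <-> - ln y_crit / s%:R <= beta.
  rewrite (X_0 N3 N4) e1 exprD -expr2.
  have -> : (- ln y_crit / s%:R <= beta) = (expR (- beta) ^+ s <= y_crit).
    rewrite ler_pdivrMr // lerNl -{2}(lnK (x := y_crit)) ?posrE //.
    by rewrite -expRM_natr ler_expR mulNr.
  have := exprn_ge0 s (expR_ge0 (- beta)); move: (_ ^+ s) => y y0.
  rewrite -y_critE -subr_ge0 (_ : _ - _ = (y_crit - y) * (1 + y_crit + y)).
    rewrite pmulr_lge0 ?subr_ge0 //; lra.
  by rewrite !expr2; ring.
split=> [[_ /bounded_triple/key]//|h]; split; last exact/bounded_triple/key.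
apply: le_trans h; by rewrite divr_ge0 // oppr_ge0 ln_le0 // ltW // y_crit_lt1.
Qed.

Lemma mu_triple : mu R N = y_crit `^ (- s%:R^-1).
Proof.
rewrite (mu_eq N3 N4) /powR gt_eqF ?y_crit_gt0 // mulNr mulrC -mulNr; congr expR.
apply/eqP; rewrite eq_le; apply/andP; split.
  by apply: ge_inf; [exact: bounded_betas_lb|apply/bounded_betas_triple].
apply: lb_le_inf; first by exists (ln 4); exact: bounded_betas_ln4.
by move=> b /bounded_betas_triple.
Qed.

Lemma mu_triple_algebraic : algebraicOver (@ratr R) (mu R N).
Proof.
pose A := algebraicOver (@ratr R : {rmorphism rat -> R}).
have natA n : A n%:R by exact: algebraic_nat.
have tauA : A tau.
  apply: algebraic_div (natA 2); apply: algebraic_sub (natA 1).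
  by apply: (@algebraic_of_exp _ _ _ _ 2) => //; rewrite sqr_sqrtr //; exact: (natA 5).
have tA : A t_crit by apply: (@algebraic_of_exp _ _ _ _ s); [lia|rewrite t_critX].
have yA : A y_crit.
  apply: algebraic_div (natA 2); apply: algebraic_sub (natA 1).
  apply: (@algebraic_of_exp _ _ _ _ 2) => //; rewrite sqr_sqrtr.
    by apply: algebraic_add (natA 1) _; apply: algebraic_mul (natA 4) tA.
  by rewrite addr_ge0 // mulr_ge0 // ltW // t_crit_gt0.
apply: (@algebraic_of_exp _ _ _ _ s); first by lia.
have -> : mu R N ^+ s = y_crit^-1; last exact: algebraic_inv.
have y0 := ltW y_crit_gt0.
rewrite mu_triple powRN exprVn -powR_mulrn ?powR_ge0 // -powRrM mulVf ?powRr1 //.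
by rewrite pnatr_eq0; lia.
Qed.

End Triple.

Theorem theorem3 (R : realType) (N : nat) (hN3 : (3 <= N)%N)
    (hN4 : ~~ (4 %| N)%N) :
  [/\ exists P : 'I_(crossing_dim N) -> mpoly.mpoly (crossing_dim N) R,
        forall (m : nat) (beta : R), 0 <= beta ->
          crossing N m.+1 beta = poly_map P (crossing N m beta),
      cvgn (saw_root R N) /\ (mu R N)%:E = expeR (beta_cr R N)
    & (N = 6 \/ N = 9)%N ->
      let tau : R := (Num.sqrt 5 - 1) / 2 in
      let d : nat := (N %/ 3)%N in
      mu R N = ((Num.sqrt (1 + 4 * tau `^ (d%:R^-1)) - 1) / 2) `^ (- d%:R^-1)
      /\ algebraicOver (@ratr R) (mu R N)].
Proof.
split.
- by have [P hP] := @crossing_recursion R N hN3 hN4; exists P.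
- split; first by apply/cvg_ex; eexists; exact: saw_root_cvg.
  by rewrite beta_crE // mu_eq.
move=> N69 /=; have -> : (N %/ 3)%N = sN N by case: N69 => ->.
have NE : N = (3 * sN N)%N by case: N69 => ->.
have s2 : (2 <= sN N)%N by case: N69 => ->.
split; first exact: mu_triple.
exact: mu_triple_algebraic.
Qed.
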